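(* Fix $0<\delta<1$. There exist constants $0<\nu_0\le 1$, $c>0$ and $C>1$ such that the following holds. Let $0<\nu<\nu_0$, let $\theta_{in}\in L^2(\mathbb{T}_\delta^2)$, and let $\theta=\theta(t,x,y)$ be the solution on $\mathbb{T}_\delta^2$ of the linearized critical dissipative quasi-geostrophic equation $$\partial_t\theta+\nu(-\Delta)^{\frac12}\theta+e^{-\nu t}\cos y\,\partial_x\big(1-(-\Delta)^{-\frac12}\big)\theta=0,\qquad \theta|_{t=0}=\theta_{in}.$$ Then for all $0\le t\le C^{-1}\nu^{-1}$, $$\|\theta_{\neq}(t)\|_{L^2(\mathbb{T}_\delta^2)}\le C e^{-c\nu^{3/5}t}\,\|\theta_{in}\|_{L^2(\mathbb{T}_\delta^2)},$$ where $\theta_{\neq}(t,x,y)=\theta(t,x,y)-\frac{1}{2\pi\delta}\int_{\mathbb{T}_{2\pi\delta}}\theta(t,x,y)\,dx$.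
   Context: $\mathbb{T}_\delta^2=\{(x,y): x\in\mathbb{T}_{2\pi\delta},\ y\in\mathbb{T}_{2\pi}\}$, where $\mathbb{T}_{L}=\mathbb{R}/L\mathbb{Z}$; thus the Fourier wave numbers are $\alpha\in\delta^{-1}\mathbb{Z}$ in $x$ and $\beta\in\mathbb{Z}$ in $y$. The operators $(-\Delta)^{s}$ are Fourier multipliers with symbol $(\alpha^2+\beta^2)^{s}$; the operator $(-\Delta)^{-\frac12}$ commutes with $\partial_x$, so $\partial_x(-\Delta)^{-\frac12}$ acts only on the modes with $\alpha\ne0$ (it gives $0$ on the modes with $\alpha=0$). *)

(* Defs.v *)
From HB Require Import structures.
From mathcomp Require Import all_boot all_order all_algebra.
From mathcomp Require Import complex.
From mathcomp Require Import all_classical all_reals all_analysis.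
From mathcomp Require Import measurable_realfun ring.

Set Implicit Arguments.
Unset Strict Implicit.
Unset Printing Implicit Defensive.
Import Order.TTheory GRing.Theory Num.Theory.
Import numFieldNormedType.Exports.

Local Open Scope classical_set_scope.
Local Open Scope ring_scope.
Local Open Scope complex_scope.

(* [measurableTypeR R] is R with its Borel sigma-algebra. *)
Notation plane R := (measurableTypeR R * measurableTypeR R)%type.

(* A function on the torus R/(2 pi delta)Z x R/(2 pi)Z is a doubly periodic
   function on the plane; it is integrated over [0, 2 pi delta[ x [0, 2 pi[. *)
Section Torus.
Context {R : realType}.
Implicit Types (delta nu t L s x y : R) (f : plane R -> R) (k l : int).

Definition circle_measure L : set (measurableTypeR R) -> \bar R :=
  mrestr lebesgue_measure (measurable_itv `[0, L[).

HB.instance Definition _ L := Measure.on (circle_measure L).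

Fact circle_measure_fin L : fin_num_fun (circle_measure L).
Proof.
move=> A mA; rewrite ge0_fin_numE ?measure_ge0//.
apply: (@le_lt_trans _ _ (lebesgue_measure (`[0, L[%classic : set R))).
  by rewrite /circle_measure /mrestr; apply: le_measure;
    rewrite ?inE//; apply: measurableI.
by rewrite lebesgue_measure_itv/=; case: ifP => _; rewrite ltry.
Qed.

HB.instance Definition _ L :=
  @Measure_isFinite.Build _ _ _ (circle_measure L) (@circle_measure_fin L).

Definition torus_measure delta : set (plane R) -> \bar R :=
  (circle_measure (2 * pi * delta) \x circle_measure (2 * pi))%E.

HB.instance Definition _ delta := Measure.on (torus_measure delta).

Definition torus_L2 delta f : Prop :=
  [/\ forall x y, f (x + 2 * pi * delta, y) = f (x, y),
      forall x y, f (x, y + 2 * pi) = f (x, y) &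
      f \in Lfun (torus_measure delta) 2%:E].

Definition L2norm delta f : \bar R := 'N[torus_measure delta]_2%:E[EFin \o f].

Definition nonzero_modes delta f : plane R -> R := fun z =>
  f z - (2 * pi * delta)^-1 *
    \int[circle_measure (2 * pi * delta)]_x f (x, z.2).

(* The coefficient at (k, l) is that of the character
   exp (i (freq_x delta k * x + freq_y l * y)). *)
Definition fourier_series := int -> int -> R[i].

Definition freq_x delta k : R := k%:~R / delta.
Definition freq_y l : R := l%:~R.

Definition phase delta k l (z : plane R) : R :=
  freq_x delta k * z.1 + freq_y l * z.2.

Definition fourier delta f : fourier_series := fun k l =>
  ((2 * pi * delta) * (2 * pi))^-1%:C *
  ((\int[torus_measure delta]_z (f z * cos (phase delta k l z)))
   -i* (\int[torus_measure delta]_z (f z * sin (phase delta k l z)))).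

(* (-Delta)^s. For s != 0 the symbol vanishes at (0, 0), since [0 `^ s = 0]. *)
Definition laplacian_pow delta s (u : fourier_series) : fourier_series :=
  fun k l => ((freq_x delta k ^+ 2 + freq_y l ^+ 2) `^ s)%:C * u k l.

Definition partial_x delta (u : fourier_series) : fourier_series :=
  fun k l => 'i * (freq_x delta k)%:C * u k l.

(* Multiplication by cos y = (exp (i y) + exp (- i y)) / 2, extended from
   functions to formal series; see [fourier_mul_cos_y] below. *)
Definition mul_cos_y (u : fourier_series) : fourier_series :=
  fun k l => (u k (l - 1) + u k (l + 1)) / 2.

Fact torus_measure_fin delta : torus_measure delta setT \is a fin_num.
Proof.
rewrite /torus_measure -setXTT product_measure1E//.
by rewrite fin_numM// fin_num_measure.
Qed.

Lemma measurable_phase delta k l : measurable_fun setT (phase delta k l).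
Proof.
by apply: measurable_funD; apply: measurable_funM.
Qed.

Lemma fourier_integrable delta f (g : R -> R) k l : torus_L2 delta f ->
  measurable_fun setT g -> (forall x, `|g x| <= 1) ->
  (torus_measure delta).-integrable setT
    (EFin \o (fun z => f z * g (phase delta k l z))).
Proof.
move=> [_ _ fL2] mg g1.
have fi : (torus_measure delta).-integrable setT (EFin \o f).
  apply/Lfun1_integrable; exact: (Lfun_subset12 (torus_measure_fin delta) fL2).
apply: (@integrableMl _ _ _ (torus_measure delta) setT measurableT _
  (g \o phase delta k l) fi).
  by apply: measurableT_comp => //; exact: measurable_phase.
exists 1; split => // M M1 z _ /=; exact: le_trans (g1 _) (ltW M1).
Qed.

Lemma fourier_mul_cos_y delta f : torus_L2 delta f ->
  fourier delta (fun z => cos z.2 * f z) = mul_cos_y (fourier delta f).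
Proof.
move=> fL2.
have mc : measurable_fun setT (@cos R).
  by apply: continuous_measurable_fun; exact: continuous_cos.
have ms : measurable_fun setT (@sin R).
  by apply: continuous_measurable_fun; exact: continuous_sin.
have ic k l : (torus_measure delta).-integrable setT
    (EFin \o (fun z => f z * cos (phase delta k l z))).
  by apply: fourier_integrable => // x; rewrite ler_norml cos_geN1 cos_le1.
have is_ k l : (torus_measure delta).-integrable setT
    (EFin \o (fun z => f z * sin (phase delta k l z))).
  by apply: fourier_integrable => // x; rewrite ler_norml sin_geN1 sin_le1.
have pm k l z : phase delta k (l - 1) z = phase delta k l z - z.2.
  by rewrite /phase /freq_y rmorphB/= mulrBl mul1r addrA.
have pp k l z : phase delta k (l + 1) z = phase delta k l z + z.2.
  by rewrite /phase /freq_y rmorphD/= mulrDl mul1r addrA.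
have h (u v w : plane R -> R) :
   (torus_measure delta).-integrable setT (EFin \o v) ->
   (torus_measure delta).-integrable setT (EFin \o w) ->
   (forall z, u z = 2^-1 * (v z + w z)) ->
   \int[torus_measure delta]_z u z =
   2^-1 * (\int[torus_measure delta]_z v z + \int[torus_measure delta]_z w z).
  move=> iv iw uE; rewrite -RintegralD// -RintegralZl//.
    by apply: eq_Rintegral => z _; rewrite uE.
  by apply: eq_integrable (integrableD measurableT iv iw).
apply/funext => k; apply/funext => l; rewrite /mul_cos_y /fourier -mulrDr -[RHS]mulrA.
congr (_ * _).
rewrite (h (fun z => cos z.2 * f z * cos (phase delta k l z)) _ _ (ic k (l-1)) (ic k (l+1))); last first.
  move=> z; rewrite pm pp cosB cosD.
  move: (f z) (cos (phase delta k l z)) (sin _) (cos z.2) (sin z.2) => a b c d e.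
  by field.
rewrite (h (fun z => cos z.2 * f z * sin (phase delta k l z)) _ _ (is_ k (l-1)) (is_ k (l+1))); last first.
  move=> z; rewrite pm pp sinB sinD.
  move: (f z) (cos (phase delta k l z)) (sin (phase _ _ _ _)) (cos z.2) (sin z.2) => a b c d e.
  by field.
have -> : (2^-1 : R[i]) = (2^-1)%:C by rewrite fmorphV rmorph_nat.
by apply/eqP; rewrite mulrC; simpc; rewrite -opprD mulNr [2^-1 * _]mulrC.
Qed.

(* cos y d/dx (1 - (-Delta)^(-1/2)) u *)
Definition transport delta (u : fourier_series) : fourier_series :=
  mul_cos_y (partial_x delta
    (fun k l => u k l - laplacian_pow delta (- (1 / 2)) u k l)).

Definition is_complex_derive (c : R -> R[i]) t (d : R[i]) : Prop :=
  is_derive t (1 : R) (fun s => complex.Re (c s)) (complex.Re d) /\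
  is_derive t (1 : R) (fun s => complex.Im (c s)) (complex.Im d).

(* Solutions in C([0, +oo[; L2). The unknown is only L2, so the equation is read
   in the sense of distributions, i.e. coefficient by coefficient. *)
Definition is_solution delta nu (theta_in : plane R -> R)
    (theta : R -> plane R -> R) : Prop :=
  [/\ forall t, 0 <= t -> torus_L2 delta (theta t),
      forall t, 0 <= t ->
        L2norm delta (theta s \- theta t) @[s --> within [set s | 0 <= s] (nbhs t)]
          --> (0 : \bar R),
      ae_eq (torus_measure delta) setT (theta 0) theta_in &
      forall t, 0 < t -> forall k l,
        is_complex_derive (fun s => fourier delta (theta s) k l) t
          (- (nu%:C * laplacian_pow delta (1 / 2) (fourier delta (theta t)) k l
              + (expR (- nu * t))%:C * transport delta (fourier delta (theta t)) k l))].

End Torus.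

(* Main.v *)
Require Import Defs.
From HB Require Import structures.
From mathcomp Require Import all_boot all_order all_algebra.
From mathcomp Require Import complex.
From mathcomp Require Import all_classical all_reals all_analysis.
From mathcomp Require Import measurable_realfun ring lra zify.

Set Implicit Arguments.
Unset Strict Implicit.
Unset Printing Implicit Defensive.
Import Order.TTheory GRing.Theory Num.Theory.
Import numFieldNormedType.Exports.

(** Why the nonzero modes decay at the rate nu^(3/5).

    The modes in x decouple. For k <> 0 put a = |k| / delta > 1,
    lam_l = sqrt (a^2 + l^2) and b_l = 1 - 1 / lam_l; then q_l = b_l u_l obeys,
    up to complex conjugation when k < 0,
      q_l' = - nu lam_l q_l - i a w b_l (q_{l-1} + q_{l+1}) / 2,
    with w = exp (- nu t), which stays above 1/2 on the time interval at hand.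
    The transport conserves the energy sum |q_l|^2 / b_l, and the dissipation
    alone gives only the rate nu. But the transport carries the solution to high
    frequencies l: the commutator of b cos y with an escape function G_l sin y,
    G_l close to l, produces b G' sin^2 y plus a potential of size l^2 / lam^3
    coming from the variation of b ([transport_twist], [Wpot_ge]). Both
    degenerate where sin y = 0 and l = 0; there the uncertainty principle, in
    the form of a discrete Hardy inequality ([hardy]), bounds sin^2 y from below
    by a potential of size 1 / a. Altogether the gain is of size 1 / lam
    ([potential_key]). The escape term has to be weighted by 1 / n with
    nu = n^-5: then the gain n^-1 / lam and the dissipation n^-5 lam balance at
    lam = n^2, where both equal n^-3 = nu^(3/5).

    The errors made at high frequency are absorbed by a third term, [well]:
    the transport also conserves the energy of the image of q under its own
    generator b cos y, so that the difference with the energy of q, essentially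
    the size of (sin y) q, is conserved as well ([transport_well]), and its
    dissipation controls lam |(sin y) q|^2. The weights of the last two terms
    are x^3 / n and n^2 x^4 with x = t / (t + n^3). They vanish at time 0, so
    that the functional starts from the energy of the data, and the delay this
    causes is a multiple of n^3, hence a constant factor in the estimate.

    All these computations are identities and inequalities at each l up to a
    discrete divergence ([subdiv]), with fluxes bounded by the mass nearby; the
    outcome is [local_decay]. Summing over the boxes |l| <= M and then averaging
    over M removes the fluxes, since the boundaries of different boxes are
    disjoint ([integrate_flux]); only the square summability of the coefficients
    is used. This yields [modes_decay].

    The passage between functions and coefficients uses the functions
    cos + sin of the phase, an orthogonal basis that is real. Bessel's
    inequality bounds the data and the solution. Parseval's inequality needs
    completeness, which is proved by a functional monotone class argument: the
    bounded functions approximable in L2 by trigonometric polynomials form an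
    algebra closed under bounded limits, which contains the indicators of
    half-planes of a fundamental domain and hence all bounded measurable
    functions ([trig_dense]). *)

Local Open Scope classical_set_scope.
Local Open Scope ring_scope.

(** * Identities on the lattice of wave numbers *)

Ltac nonneg :=
  first [ assumption | exact: ltW |
  lazymatch goal with
  | |- is_true (0 <= ?x ^+ 2) => apply: sqr_ge0
  | |- is_true (0 <= ?x ^+ _) => apply: exprn_ge0; nonneg
  | |- is_true (0 <= ?x ^-1) => rewrite invr_ge0; nonneg
  | |- is_true (0 <= ?x * ?y) => apply: mulr_ge0; nonneg
  | |- is_true (0 <= ?x + ?y) => apply: addr_ge0; nonneg
  end | lra ].

Section Lattice.
Context {R : realFieldType}.
Implicit Types (X Y U V b G n F : int -> R) (K : R) (l : int).

Definition nbh n l := n (l - 2) + n (l - 1) + n l + n (l + 1) + n (l + 2).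

(** Inequality up to a discrete divergence: when summed over l, [F] leaves only
    boundary fluxes, and these are controlled by the mass [n] near the boundary. *)
Definition subdiv K n F := exists2 f : int -> R,
  forall l, `|f l| <= K * nbh n l & forall l, F l <= f (l + 1) - f l.

Fact shiftE : (forall l, l + 1 - 2 = l - 1) * (forall l, l + 1 - 1 = l) *
  (forall l, l + 1 + 1 = l + 2) * (forall l, l - 1 - 1 = l - 2) *
  (forall l, l - 1 + 1 = l) * (forall l, l - 1 + 2 = l + 1) *
  (forall l, l + 2 - 1 = l + 1) * (forall l, l - 2 + 1 = l - 1).
Proof. by do ![split] => l; ring. Qed.

Fact castE : (forall l, (l + 1)%:~R = l%:~R + 1 :> R) *
  (forall l, (l + 2)%:~R = l%:~R + 2 :> R) * (forall l, (l - 1)%:~R = l%:~R - 1 :> R) *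
  (forall l, (l - 2)%:~R = l%:~R - 2 :> R).
Proof. by do ![split] => l; rewrite ?rmorphB ?rmorphD. Qed.

Lemma subdivD K1 K2 n F1 F2 :
  subdiv K1 n F1 -> subdiv K2 n F2 -> subdiv (K1 + K2) n (fun l => F1 l + F2 l).
Proof.
move=> [f1 b1 d1] [f2 b2 d2]; exists (fun l => f1 l + f2 l) => l.
  by rewrite mulrDl (le_trans (ler_normD _ _))// lerD.
by have := d1 l; have := d2 l; lra.
Qed.

Lemma subdivZ K n F c :
  0 <= c -> subdiv K n F -> subdiv (c * K) n (fun l => c * F l).
Proof.
move=> c0 [f b d]; exists (fun l => c * f l) => l.
  by rewrite normrM (ger0_norm c0) -mulrA ler_wpM2l.
by rewrite -mulrBr ler_wpM2l.
Qed.

Lemma subdiv_le K n F1 F2 :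
  (forall l, F1 l <= F2 l) -> subdiv K n F2 -> subdiv K n F1.
Proof.
by move=> le12 [f b d]; exists f => // l; exact: le_trans (le12 l) (d l).
Qed.

Lemma subdivE K n F (f : int -> R) :
  (forall l, `|f l| <= K * nbh n l) -> (forall l, F l = f (l + 1) - f l) ->
  subdiv K n F.
Proof. by move=> b d; exists f => // l; rewrite d. Qed.

(** Multiplication by sin y, up to a factor i, and by cos y, read on Fourier
    coefficients. [X] and [Y] are the real and imaginary parts of a sequence q. *)
Definition dif X l := (X (l - 1) - X (l + 1)) / 2.
Definition avg X l := (X (l - 1) + X (l + 1)) / 2.
Definition nrm X Y l := X l ^+ 2 + Y l ^+ 2.
Definition snrm X Y l := dif X l ^+ 2 + dif Y l ^+ 2.
Definition mnrm X Y l := avg X l ^+ 2 + avg Y l ^+ 2.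
(** The density of the quadratic form of sin y. *)
Definition twist X Y l := X l * dif Y l - Y l * dif X l.

Definition current X Y l := X l * Y (l + 1) - Y l * X (l + 1).

(** For the norm with weight 1 / b, the transport is generated by the symmetric
    operator A q = b avg q, and the sum of [well] over l is |q|^2 - |A q|^2; hence
    it is conserved. Trading |q|^2 = |dif q|^2 + |avg q|^2 (true after summation)
    writes it with nonnegative densities only. *)
Definition well b X Y l :=
  snrm X Y l + (b l)^-1 * nrm X Y l - nrm X Y l + (1 - b l) * mnrm X Y l.

(** The derivatives of these forms at (X, Y) in the direction (U, V). *)
Definition dnrm X Y U V l := 2 * (X l * U l + Y l * V l).
Definition dsnrm X Y U V l := 2 * (dif X l * dif U l + dif Y l * dif V l).
Definition dmnrm X Y U V l := 2 * (avg X l * avg U l + avg Y l * avg V l).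
Definition dtwist X Y U V l :=
  U l * dif Y l + X l * dif V l - V l * dif X l - Y l * dif U l.
Definition dwell b X Y U V l :=
  dsnrm X Y U V l + (b l)^-1 * dnrm X Y U V l - dnrm X Y U V l
  + (1 - b l) * dmnrm X Y U V l.

(** The transport q' = - i b avg q. *)
Definition trX b Y l := b l * avg Y l.
Definition trY b X l := - (b l * avg X l).

Lemma transport_nrm b X Y l : b l != 0 ->
  (b l)^-1 * dnrm X Y (trX b Y) (trY b X) l = current X Y l - current X Y (l - 1).
Proof.
move=> b0; rewrite /dnrm /current /trX /trY /avg !shiftE; field; exact: b0.
Qed.

(** What the variation of [b] leaves of the commutator of the transport with
    G sin y, once b G' sin^2 y has been extracted. *)
Definition Wpot b G l := (b (l + 1) * (3 * G l + 2 * G (l + 1) - G (l + 2))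
  - b (l - 1) * (3 * G l + 2 * G (l - 1) - G (l - 2))) / 4.

Definition cross X Y l := X (l - 1) * X (l + 1) + Y (l - 1) * Y (l + 1).

Definition twist_flux b G X Y l :=
  - 4^-1 * G (l - 1) * b (l - 1) * nrm X Y l - 4^-1 * G l * b l * nrm X Y (l - 1)
  + 4^-1 * G (l - 1) * b l * cross X Y l + 4^-1 * G l * b (l - 1) * cross X Y (l - 1)
  - 8^-1 * (G l - G (l - 2)) * b (l - 1) * nrm X Y l
  + 8^-1 * (G (l + 1) - G (l - 1)) * b l * nrm X Y (l - 1).

(** The escape mechanism: the transport increases the escape term at the rate
    b G' sin^2 y, up to a potential and a flux. *)
Lemma transport_twist b G X Y l :
  G l * dtwist X Y (trX b Y) (trY b X) l =
  b l * ((G (l + 1) - G (l - 1)) / 2) * snrm X Y l + Wpot b G l / 2 * nrm X Y l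
  + (twist_flux b G X Y (l + 1) - twist_flux b G X Y l).
Proof.
rewrite /dtwist /twist_flux /Wpot /cross /snrm /nrm /trX /trY /dif /avg !shiftE.
by field.
Qed.

Definition well_flux b X Y l :=
  current X Y (l - 1)
  - b (l - 1) * b l * (avg X (l - 1) * avg Y l - avg Y (l - 1) * avg X l)
  + (b l * (current X Y l - current X Y (l - 1))
     - b (l - 1) * (current X Y (l - 1) - current X Y (l - 2))) / 2.

Lemma transport_well b X Y l : b l != 0 ->
  dwell b X Y (trX b Y) (trY b X) l = well_flux b X Y (l + 1) - well_flux b X Y l.
Proof.
move=> b0.
rewrite /dwell transport_nrm// /well_flux /dsnrm /dmnrm /dnrm /current /trX /trY.
rewrite /dif /avg !shiftE.
by field.
Qed.

End Lattice.

(** * The symbols and the commutator potential *)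

Section Symbols.
Context {R : rcfType}.
Implicit Types (a sg y : R) (l : int).

Definition lam a l : R := Num.sqrt (a ^+ 2 + l%:~R ^+ 2).
Definition bsym a l : R := 1 - (lam a l)^-1.
(** The escape function: close to l below the frequency 1 / sg, and bounded by
    1 / sg, so that the escape term is dominated by the energy. *)
Definition esc sg l : R := l%:~R / (1 + sg * `|l%:~R|).

Lemma lam_sqr a l : lam a l ^+ 2 = a ^+ 2 + l%:~R ^+ 2.
Proof. by rewrite sqr_sqrtr// addr_ge0// sqr_ge0. Qed.

Lemma lam_ge0 a l : 0 <= lam a l. Proof. exact: sqrtr_ge0. Qed.

Lemma lam_gea a l : 0 <= a -> a <= lam a l.
Proof.
move=> a0; rewrite -(@ler_pXn2r _ 2)// ?nnegrE ?lam_ge0//.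
by rewrite lam_sqr lerDl sqr_ge0.
Qed.

Lemma lam_gel a l : `|l%:~R| <= lam a l.
Proof.
rewrite -(@ler_pXn2r _ 2)// ?nnegrE ?lam_ge0//.
by rewrite lam_sqr real_normK ?num_real// lerDr sqr_ge0.
Qed.

Lemma lam_lip a l : `|lam a (l + 1) - lam a l| <= 1.
Proof.
set u := lam a (l + 1); set v := lam a l.
have u2 : u ^+ 2 = v ^+ 2 + 2 * l%:~R + 1.
  by rewrite !lam_sqr castE; ring.
have u0 : 0 <= u := lam_ge0 _ _.
have v0 : 0 <= v := lam_ge0 _ _.
have vl : `|l%:~R| <= v := lam_gel _ _.
have ul : `|(l + 1)%:~R| <= u := lam_gel _ _.
move: vl ul; rewrite castE !ler_norml => /andP[v1 v2] /andP[u1 u3].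
by apply/andP; split; nra.
Qed.

Lemma lam_lipm a l : `|lam a (l - 1) - lam a l| <= 1.
Proof. by have := lam_lip a (l - 1); rewrite subrK distrC. Qed.

Lemma lam_le2 a l : 1 <= a -> lam a (l + 1) <= 2 * lam a l.
Proof.
move=> a1; have := lam_lip a l; have := @lam_gea a l ltac:(lra).
by rewrite ler_norml => ? /andP[]; lra.
Qed.

Lemma lam_le2m a l : 1 <= a -> lam a (l - 1) <= 2 * lam a l.
Proof.
move=> a1; have := lam_lipm a l; have := @lam_gea a l ltac:(lra).
by rewrite ler_norml => ? /andP[]; lra.
Qed.

Lemma lamN a l : lam a (- l) = lam a l.
Proof. by rewrite /lam rmorphN/= sqrrN. Qed.

Lemma bsymN a l : bsym a (- l) = bsym a l.
Proof. by rewrite /bsym lamN. Qed.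

Lemma escN sg l : esc sg (- l) = - esc sg l.
Proof. by rewrite /esc rmorphN/= normrN mulNr. Qed.

Lemma WpotN (b G : int -> R) l : (forall l, b (- l) = b l) ->
  (forall l, G (- l) = - G l) -> Wpot b G (- l) = Wpot b G l.
Proof.
move=> be Go; rewrite /Wpot.
have -> : - l + 1 = - (l - 1) by ring.
have -> : - l - 1 = - (l + 1) by ring.
have -> : - l + 2 = - (l - 2) by ring.
have -> : - l - 2 = - (l + 2) by ring.
by rewrite !be !Go; ring.
Qed.

Definition sat sg y : R := y / (1 + sg * y).

Lemma sat_concave sg y : 0 <= sg -> 0 <= y ->
  sat sg y + sat sg (y + 2) <= 2 * sat sg (y + 1).
Proof.
move=> s0 y0; have sy : 0 <= sg * y by exact: mulr_ge0.
rewrite -subr_ge0 /sat.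
have -> : 2 * ((y + 1) / (1 + sg * (y + 1))) -
   (y / (1 + sg * y) + (y + 2) / (1 + sg * (y + 2))) =
   2 * sg / ((1 + sg * y) * (1 + sg * (y + 1)) * (1 + sg * (y + 2))).
  by field; do !(apply/andP; split); rewrite gt_eqF//; nra.
by rewrite divr_ge0 ?mulr_ge0//; lra.
Qed.

Lemma sat_third sg y : 0 <= sg -> 2 <= y ->
  - (12 * sg ^+ 2) <= 2 * sat sg (y + 1) - 2 * sat sg (y - 1)
    - sat sg (y + 2) + sat sg (y - 2).
Proof.
move=> s0 y2; have sy : 0 <= sg * (y - 2) by apply: mulr_ge0 => //; lra.
rewrite /sat.
have -> : 2 * ((y + 1) / (1 + sg * (y + 1))) - 2 * ((y - 1) / (1 + sg * (y - 1)))
   - (y + 2) / (1 + sg * (y + 2)) + (y - 2) / (1 + sg * (y - 2)) =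
   - (12 * sg ^+ 2) / ((1 + sg * (y - 2)) * (1 + sg * (y - 1)) *
       (1 + sg * (y + 1)) * (1 + sg * (y + 2))).
  by field; do !(apply/andP; split); rewrite gt_eqF//; nra.
rewrite mulNr lerN2 ler_pdivrMr; last by rewrite !mulr_gt0//; nra.
rewrite ler_peMr//; first by rewrite mulr_ge0// sqr_ge0.
by do !(apply: mulr_ege1 => //); nra.
Qed.

Lemma esc_nat sg l : 0 <= l -> esc sg l = sat sg l%:~R.
Proof. by move=> l0; rewrite /esc ger0_norm// ler0z. Qed.

Lemma bsym_diff a l : 1 <= a -> 0 <= l ->
  l%:~R / (4 * lam a l ^+ 3) <= bsym a (l + 1) - bsym a (l - 1).
Proof.
move=> a1 l0; rewrite /bsym.
have lr : 0 <= (l%:~R : R) by rewrite ler0z.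
have p0 := @lam_gea a (l + 1) ltac:(lra); have m0 := @lam_gea a (l - 1) ltac:(lra).
have c0 := @lam_gea a l ltac:(lra).
have p2 := lam_sqr a (l + 1); have m2 := lam_sqr a (l - 1).
have ple := lam_le2 l a1; have mle := lam_le2m l a1.
move: p0 m0 c0 p2 m2 ple mle.
rewrite !castE.
move: (lam a (l + 1)) (lam a (l - 1)) (lam a l) (l%:~R : R) lr => p m c y y0.
move=> p0 m0 c0 p2 m2 ple mle.
have -> : 1 - p^-1 - (1 - m^-1) = (p ^+ 2 - m ^+ 2) / (p * m * (p + m)).
  by field; do !(apply/andP; split); rewrite gt_eqF//; lra.
have -> : p ^+ 2 - m ^+ 2 = 4 * y by rewrite p2 m2; ring.
rewrite ler_pdivrMr; last by rewrite mulr_gt0// exprn_gt0//; lra.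
rewrite mulrAC ler_pdivlMr; last by rewrite !mulr_gt0//; lra.
have le1 : p * m * (p + m) <= (2 * c) * (2 * c) * (4 * c).
  by apply: ler_pM; rewrite ?mulr_ge0//; try lra; apply: ler_pM => //; lra.
have -> : 4 * y * (4 * c ^+ 3) = y * ((2 * c) * (2 * c) * (4 * c)) by ring.
exact: ler_wpM2l.
Qed.

Lemma bsym_ge0 a l : 1 <= a -> 0 <= bsym a l.
Proof.
move=> a1; have := @lam_gea a l ltac:(lra); rewrite /bsym subr_ge0 => la.
by rewrite invf_le1; lra.
Qed.

Lemma bsym_gt0 a l : 1 < a -> 0 < bsym a l.
Proof.
move=> a1; have := @lam_gea a l ltac:(lra); rewrite /bsym subr_gt0 => la.
by rewrite invf_lt1; lra.
Qed.

Lemma bsym_le1 a l : bsym a l <= 1.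
Proof. by rewrite /bsym gerBl invr_ge0 lam_ge0. Qed.

(** Sorting the terms of [Wpot] by increments: those of [b] multiply a quantity
    that is at least 4 G by concavity of G, and what remains is a third difference
    of G, of size sg^2. *)
Lemma Wpot_ge_nat a sg l : 1 <= a -> 0 <= sg -> 0 <= l ->
  (bsym a (l + 1) - bsym a (l - 1)) * esc sg l - 3 * sg ^+ 2 <=
  Wpot (bsym a) (esc sg) l.
Proof.
move=> a1 s0 l0; rewrite /Wpot.
have bm0 := bsym_ge0 (l - 1) a1; have bm1 := bsym_le1 a (l - 1).
have y0 : 0 <= (l%:~R : R) by rewrite ler0z.
have d0 : 0 <= bsym a (l + 1) - bsym a (l - 1).
  apply: le_trans (bsym_diff a1 l0); rewrite divr_ge0// mulr_ge0//.
  by rewrite exprn_ge0// lam_ge0.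
have F1 : 4 * esc sg l <= 3 * esc sg l + 2 * esc sg (l + 1) - esc sg (l + 2).
  rewrite !esc_nat ?addr_ge0// !castE.
  by have := sat_concave s0 y0; lra.
have F2 : - (12 * sg ^+ 2) <= 2 * esc sg (l + 1) - 2 * esc sg (l - 1)
    - esc sg (l + 2) + esc sg (l - 2).
  have s2 := sqr_ge0 sg.
  case: l l0 {F1 d0 y0 bm0 bm1} => // -[_|[_|m _]].
  - rewrite -[Posz 0 - 2]/(- 2%:Z) -[Posz 0 - 1]/(- 1%:Z) !escN !add0r.
    have := sat_concave s0 (lexx 0); rewrite !add0r !esc_nat//.
    by rewrite {1}/sat mul0r; lra.
  - rewrite -[Posz 1 - 2]/(- 1%:Z) subrr !escN.
    have := sat_concave s0 (@ler01 R); rewrite !esc_nat// !castE.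
    rewrite (_ : (Posz 1)%:~R = 1 :> R)//.
    have -> : sat sg (0%:~R : R) = 0 by rewrite /sat mul0r.
    by lra.
  - have y2 : (2:R) <= (Posz m.+2)%:~R by rewrite -[2]/(2%:~R) ler_int.
    have := sat_third s0 y2; rewrite !esc_nat ?subr_ge0 ?addr_ge0//.
    by rewrite !castE.
move: F1 F2 d0 bm0 bm1.
move: (bsym a (l + 1)) (bsym a (l - 1)) (esc sg (l + 1)) (esc sg (l - 1)) => bp bm.
move: (esc sg (l + 2)) (esc sg (l - 2)) (esc sg l) => gp2 gm2 g gp gm F1 F2 d0 bm0 bm1.
have h1 := ler_wpM2l d0 F1.
have h2 := ler_wpM2l bm0 F2.
have h3 : bm * sg ^+ 2 <= sg ^+ 2 by rewrite ler_piMl// sqr_ge0.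
by lra.
Qed.

(** The potential is even in l, of size l^2 / lam^3 where the escape function is
    not saturated, and bounded below by - 3 sg^2. It degenerates at l = 0. *)
Lemma Wpot_ge a sg l : 1 <= a -> 0 <= sg ->
  - (3 * sg ^+ 2) <= Wpot (bsym a) (esc sg) l /\
  (sg * `|l%:~R| <= 1 ->
    l%:~R ^+ 2 / (8 * lam a l ^+ 3) - 3 * sg ^+ 2 <= Wpot (bsym a) (esc sg) l).
Proof.
move=> a1 s0; wlog l0 : l / 0 <= l.
  move=> h; have [l0|l0] := leP 0 l; first exact: h.
  have := h (- l) ltac:(rewrite oppr_ge0; exact: ltW).
  by rewrite WpotN ?rmorphN/= ?normrN ?sqrrN ?lamN//; [exact: bsymN|exact: escN].
have W := Wpot_ge_nat a1 s0 l0.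
have y0 : 0 <= (l%:~R : R) by rewrite ler0z.
have db := bsym_diff a1 l0.
have c0 : 0 < lam a l by apply: lt_le_trans (@lam_gea a l _); lra.
have d0 : 0 <= l%:~R / (4 * lam a l ^+ 3).
  by rewrite divr_ge0// mulr_ge0// exprn_ge0// ltW.
have g0 : 0 <= esc sg l by rewrite esc_nat// divr_ge0// addr_ge0// mulr_ge0.
split.
  by have := mulr_ge0 (le_trans d0 db) g0; lra.
rewrite (ger0_norm y0) => sy.
have g1 : l%:~R / 2 <= esc sg l.
  have sy0 := mulr_ge0 s0 y0.
  by rewrite esc_nat// /sat ler_wpM2l// lef_pV2 ?posrE; lra.
have y2 : 0 <= (l%:~R : R) / 2 by lra.
have := ler_pM d0 y2 db g1.
have -> : l%:~R / (4 * lam a l ^+ 3) * (l%:~R / 2) = l%:~R ^+ 2 / (8 * lam a l ^+ 3).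
  by field; rewrite gt_eqF.
by lra.
Qed.

End Symbols.

(** * A discrete Hardy inequality *)

Section Hardy.
Context {R : realFieldType}.
Implicit Types (K y : R) (l : int).

(** The Hardy potential 2 - (p (l - 2) + p (l + 2)) / p l of the positive sequence
    p l = 1 / (K + l^2). It is positive for l^2 up to a multiple of K, and
    negative but of order l^2 / (K + l^2)^2 beyond. *)
Definition hweight K y := 2 - (K + y ^+ 2) / (K + (y - 2) ^+ 2)
                            - (K + y ^+ 2) / (K + (y + 2) ^+ 2).

Lemma hweightE K y : 0 < K -> hweight K y =
  (8 * K + 32 - 24 * y ^+ 2) / ((K + (y - 2) ^+ 2) * (K + (y + 2) ^+ 2)).
Proof.
move=> K0; rewrite /hweight; field.
by apply/andP; split; rewrite gt_eqF// ltr_wpDr// sqr_ge0.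
Qed.

Lemma hweight_core K y : 8 <= K -> 24 * y ^+ 2 <= 4 * K ->
  2 / (3 * K) <= hweight K y.
Proof.
move=> K8 yK; rewrite hweightE; last by lra.
have y2 := sqr_ge0 y; have m2 := sqr_ge0 (y - 2); have p2 := sqr_ge0 (y + 2).
have D0 : 0 < (K + (y - 2) ^+ 2) * (K + (y + 2) ^+ 2) by rewrite mulr_gt0//; lra.
rewrite ler_pdivlMr// mulrAC ler_pdivrMr; last by lra.
have e : (K + (y - 2) ^+ 2) * (K + (y + 2) ^+ 2) = (K + y ^+ 2 + 4) ^+ 2 - 16 * y ^+ 2.
  by ring.
rewrite e; have : (K + y ^+ 2 + 4) ^+ 2 <= (2 * K) ^+ 2.
  by rewrite ler_pXn2r// ?nnegrE; lra.
have : 0 <= K * (K - 8) by rewrite mulr_ge0; lra.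
have : 0 <= K * (4 * K - 24 * y ^+ 2) by rewrite mulr_ge0; lra.
by nra.
Qed.

Lemma hweight_ge K y : 8 <= K ->
  - (96 * y ^+ 2 / (K + y ^+ 2) ^+ 2) <= hweight K y.
Proof.
move=> K8; rewrite hweightE; last by lra.
have y2 := sqr_ge0 y; have m2 := sqr_ge0 (y - 2); have p2 := sqr_ge0 (y + 2).
have D0 : 0 < (K + (y - 2) ^+ 2) * (K + (y + 2) ^+ 2) by rewrite mulr_gt0//; lra.
have E0 : 0 < (K + y ^+ 2) ^+ 2 by rewrite exprn_gt0//; lra.
have DE : (K + y ^+ 2) ^+ 2 <= 4 * ((K + (y - 2) ^+ 2) * (K + (y + 2) ^+ 2)).
  have -> : (K + y ^+ 2) ^+ 2 = ((K + y ^+ 2) * (K + y ^+ 2)) by ring.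
  have -> : 4 * ((K + (y - 2) ^+ 2) * (K + (y + 2) ^+ 2)) =
     (2 * (K + (y - 2) ^+ 2)) * (2 * (K + (y + 2) ^+ 2)) by ring.
  have h1 := sqr_ge0 (y - 4); have h2 := sqr_ge0 (y + 4).
  by apply: ler_pM; lra.
apply: (@le_trans _ _ (- (24 * y ^+ 2) /
    ((K + (y - 2) ^+ 2) * (K + (y + 2) ^+ 2)))); last first.
  by rewrite ler_pM2r ?invr_gt0//; lra.
rewrite mulNr lerN2 ler_pdivrMr// mulrAC ler_pdivlMr//.
have -> : 96 * y ^+ 2 * ((K + (y - 2) ^+ 2) * (K + (y + 2) ^+ 2)) =
   24 * y ^+ 2 * (4 * ((K + (y - 2) ^+ 2) * (K + (y + 2) ^+ 2))) by ring.
by rewrite ler_wpM2l//; lra.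
Qed.

(** A form of the uncertainty principle: what is concentrated near l = 0 cannot
    also be concentrated where sin y = 0. The proof is the ground state substitution
    with 1 / (K + l^2), performed on l - 1 and l + 1, the sites that [dif] couples. *)
Lemma hardy (K : R) (X Y : int -> R) : 8 <= K ->
  subdiv 16 (nrm X Y) (fun l => hweight K l%:~R * nrm X Y l - 4 * snrm X Y l).
Proof.
move=> K8; pose u (l : int) : R := K + l%:~R ^+ 2.
have u0 l : 0 < u l by have := sqr_ge0 (l%:~R : R); rewrite /u; lra.
pose p l := 1 - u (l + 1) / u (l - 1); pose m l := 1 - u (l - 1) / u (l + 1).
have n0 l : 0 <= nrm X Y l by rewrite addr_ge0// sqr_ge0.
have r1 l : u (l + 1) / u (l - 1) <= 9.
  rewrite ler_pdivrMr// /u !castE.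
  by have := sqr_ge0 (2 * (l%:~R : R) - 5 / 2); lra.
have r2 l : u (l - 1) / u (l + 1) <= 9.
  rewrite ler_pdivrMr// /u !castE.
  by have := sqr_ge0 (2 * (l%:~R : R) + 5 / 2); lra.
have r3 l : 0 < u (l + 1) / u (l - 1) by rewrite divr_gt0.
have r4 l : 0 < u (l - 1) / u (l + 1) by rewrite divr_gt0.
exists (fun l => - p (l - 1) * nrm X Y l + m l * nrm X Y (l - 1)) => l.
  apply: le_trans (ler_normD _ _) _; rewrite !normrM !(ger0_norm (n0 _)) normrN.
  have h1 : `|p (l - 1)| <= 8.
    by rewrite /p ler_norml; have := r1 (l - 1); have := r3 (l - 1); lra.
  have h2 : `|m l| <= 8.
    by rewrite /m ler_norml; have := r2 l; have := r4 l; lra.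
  have := ler_wpM2r (n0 l) h1; have := ler_wpM2r (n0 (l - 1)) h2.
  have := n0 (l - 2); have := n0 (l - 1); have := n0 l; have := n0 (l + 1).
  by have := n0 (l + 2); rewrite /nbh; lra.
have -> : hweight K l%:~R = p (l - 1) + m (l + 1).
  by rewrite /p /m !shiftE /hweight /u !castE; ring.
rewrite !shiftE.
(* Young with weights u(l+1)/u(l-1) and its inverse *)
have q0 := r3 l.
have e : u (l - 1) / u (l + 1) = (u (l + 1) / u (l - 1))^-1.
  by field; rewrite !gt_eqF.
suff : p l * nrm X Y (l + 1) + m l * nrm X Y (l - 1) <= 4 * snrm X Y l by lra.
rewrite /p /m e; move: (u (l + 1) / u (l - 1)) q0 => r q0.
rewrite -subr_ge0.
have -> : 4 * snrm X Y l - ((1 - r) * nrm X Y (l + 1) + (1 - r^-1) * nrm X Y (l - 1))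
  = r^-1 * ((r * X (l + 1) - X (l - 1)) ^+ 2 + (r * Y (l + 1) - Y (l - 1)) ^+ 2).
  by rewrite /snrm /nrm /dif; field; rewrite gt_eqF.
by rewrite mulr_ge0 ?addr_ge0 ?sqr_ge0// invr_ge0 ltW.
Qed.

End Hardy.

(** * The gain at every frequency *)

Section Gain.
Context {R : rcfType}.
Implicit Types (a : R) (l : int).

Lemma low_freq_core (a u y V Q M r : R) : 1 <= a -> a <= u ->
  u ^+ 2 = a ^+ 2 + y ^+ 2 -> 0 < Q -> 48 * Q <= M -> 128 * Q <= r ->
  2 / (3 * (8 * a)) <= V ->
  Q / u <= r / 32 * a * y ^+ 2 / u ^+ 3 + M / 4 * V.
Proof.
move=> a1 ua u2 Q0 MQ rQ hV.
have a0 : 0 < a by clear -a1; lra.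
have u0 : 0 < u := lt_le_trans a0 ua.
have r0 : 0 <= r by clear -Q0 rQ; lra.
have t0 : 0 <= r / 32 * a * y ^+ 2 / u ^+ 3 by clear -r0 a0 u0; nonneg.
have h1 : Q / u <= Q / a by rewrite ler_pM2l// lef_pV2// posrE.
have M0 : 0 < M / 4 by clear -Q0 MQ; lra.
have h2 : M / 4 * (2 / (3 * (8 * a))) <= M / 4 * V by rewrite ler_pM2l.
have e : M / 4 * (2 / (3 * (8 * a))) = (M / 48) / a by clear -a0; field; rewrite gt_eqF.
have h3 : Q / a <= (M / 48) / a by rewrite ler_pM2r ?invr_gt0//; clear -MQ; lra.
by rewrite e in h2; clear -h1 h2 h3 t0; lra.
Qed.

Lemma low_freq_tail (a u y V Q M r : R) : 1 <= a -> a <= u ->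
  u ^+ 2 = a ^+ 2 + y ^+ 2 -> 0 < Q -> 0 < M -> 1536 * M <= r -> 128 * Q <= r ->
  4 * (8 * a) <= 24 * y ^+ 2 ->
  - (96 * y ^+ 2 / (8 * a + y ^+ 2) ^+ 2) <= V ->
  Q / u <= r / 32 * a * y ^+ 2 / u ^+ 3 + M / 4 * V.
Proof.
move=> a1 ua u2 Q0 M0 rM rQ yK hV.
have a0 : 0 < a by clear -a1; lra.
have u0 : 0 < u := lt_le_trans a0 ua.
have y2 := sqr_ge0 y.
have u3 : 0 < u ^+ 3 by rewrite exprn_gt0.
have v0 : 0 < 8 * a + y ^+ 2 by clear -a0 y2; lra.
have ay : 0 <= a * y ^+ 2 by rewrite mulr_ge0// ltW.
have p1 : 0 <= (a - 1) * y ^+ 2 by rewrite mulr_ge0// subr_ge0.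
have p2 : 0 <= a * (24 * y ^+ 2 - 4 * (8 * a)) by rewrite mulr_ge0 ?subr_ge0// ltW.
have M4 : 0 <= M / 4 by clear -M0; lra.
have h2 := ler_wpM2l M4 hV.
have e2 : M / 4 * - (96 * y ^+ 2 / (8 * a + y ^+ 2) ^+ 2) =
    - (24 * M * y ^+ 2 / (8 * a + y ^+ 2) ^+ 2) by clear -v0; field; rewrite gt_eqF.
have c1 : Q / u <= r / 64 * a * y ^+ 2 / u ^+ 3.
  rewrite ler_pdivlMr//.
  have -> : Q / u * u ^+ 3 = Q * u ^+ 2 by clear -u0; field; rewrite gt_eqF.
  rewrite u2; have q0 : 0 <= (r - 128 * Q) * (a * y ^+ 2).
    by rewrite mulr_ge0 ?subr_ge0.
  have : Q * (a ^+ 2 + y ^+ 2) <= Q * (2 * (a * y ^+ 2)).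
    by rewrite ler_pM2l//; clear -p1 p2 ay; lra.
  by clear -q0; lra.
have c2 : 24 * M * y ^+ 2 / (8 * a + y ^+ 2) ^+ 2 <= r / 64 * a * y ^+ 2 / u ^+ 3.
  rewrite ler_pdivrMr ?exprn_gt0// [leRHS]mulrAC ler_pdivlMr//.
  have ua2 : u <= a + y ^+ 2.
    rewrite -(@ler_pXn2r _ 2)// ?nnegrE ?(ltW u0) ?(addr_ge0 (ltW a0))//.
    by rewrite u2 sqrrD; have := sqr_ge0 (y ^+ 2); clear -p1 y2; lra.
  have ua3 : u ^+ 3 <= a * (8 * a + y ^+ 2) ^+ 2.
    have -> : u ^+ 3 = u ^+ 2 * u by ring.
    have -> : a * (8 * a + y ^+ 2) ^+ 2 = (a * (8 * a + y ^+ 2)) * (8 * a + y ^+ 2) by ring.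
    apply: ler_pM; [exact: sqr_ge0|exact: ltW| |clear -ua2 a0; lra].
    by rewrite u2; have := sqr_ge0 a; clear -p1; lra.
  have -> : r / 64 * a * y ^+ 2 * (8 * a + y ^+ 2) ^+ 2 =
     (r / 64 * y ^+ 2) * (a * (8 * a + y ^+ 2) ^+ 2) by ring.
  have My : 0 <= 24 * M * y ^+ 2 by clear -M0; nonneg.
  apply: ler_pM => //; first exact: ltW.
  by rewrite ler_wpM2r//; clear -rM; lra.
by clear -h2 e2 c1 c2; lra.
Qed.

(** The two potentials complement one another. The Hardy potential is positive
    for l^2 of order at most a; beyond, a l^2 / lam^3 dominates both 1 / lam and the
    negative part of the Hardy potential. *)
Lemma low_freq a l (Q M r : R) : 1 <= a -> 0 < Q -> 48 * Q <= M ->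
  1536 * M <= r -> 128 * Q <= r ->
  Q / lam a l <= r / 32 * a * l%:~R ^+ 2 / lam a l ^+ 3
                 + M / 4 * hweight (8 * a) l%:~R.
Proof.
move=> a1 Q0 MQ rM rQ.
have K8 : 8 <= 8 * a by clear -a1; lra.
have ll2 := lam_sqr a l; have lla : a <= lam a l by apply: lam_gea; clear -a1; lra.
have M0 : 0 < M by clear -Q0 MQ; lra.
have [yK|yK] := leP (24 * (l%:~R : R) ^+ 2) (4 * (8 * a)).
  by apply: low_freq_core => //; exact: hweight_core.
by apply: low_freq_tail => //; [exact: ltW|exact: hweight_ge].
Qed.

(** [potential_key] in numbers: u stands for lam, y for |l|, and W, V for the two
    potentials. When y > 1 / sg the potentials may be slightly negative, and then
    the dissipation u / m pays for everything. *)
Lemma potential_core (a u y W V Q M r kap eta m x A : R) :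
  1 <= a -> a <= u -> 0 <= y -> y <= u ->
  0 < Q -> 0 < M -> 1536 * M <= r -> 128 * Q <= r ->
  0 < kap -> kap <= 1 -> 0 < eta -> r * eta <= 16^-1 ->
  1 <= m -> 0 < x -> x <= 1 -> 2^-1 * a <= A -> A <= a ->
  - (3 * (kap * x / m) ^+ 2) <= W ->
  ((kap * x / m) * y <= 1 -> y ^+ 2 / (8 * u ^+ 3) - 3 * (kap * x / m) ^+ 2 <= W) ->
  - (96 * y ^+ 2 / (8 * a + y ^+ 2) ^+ 2) <= V ->
  Q / u <= r / 32 * a * y ^+ 2 / u ^+ 3 + M / 4 * V ->
  Q * eta * x ^+ 3 * m / u <=
  u / m + 2^-1 * (r * eta) * x ^+ 3 * A * m * W + 4^-1 * M * eta * x ^+ 3 * m * V.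
Proof.
move=> a1 ua y0 yu Q0 M0 rM rQ k0 k1 e0 re m1 x0 x1 Aa1 Aa2.
set sg := kap * x / m => W1 W2 V1 L.
have a0 : 0 < a by clear -a1; lra.
have A0 : 0 <= A by clear -a0 Aa1; lra.
have u0 : 0 < u := lt_le_trans a0 ua.
have m0 : 0 < m by clear -m1; lra.
have sg0 : 0 < sg by rewrite divr_gt0 ?mulr_gt0.
have x3 : 0 < x ^+ 3 by rewrite exprn_gt0.
have x31 : x ^+ 3 <= 1 by apply: exprn_ile1 => //; exact: ltW.
have r0 : 0 < r by clear -M0 rM; lra.
have re0 : 0 < r * eta by rewrite mulr_gt0.
have Me : M * eta <= 1536^-1 / 16.
  have : 0 <= (r - 1536 * M) * eta by rewrite mulr_ge0 ?subr_ge0// ltW.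
  by clear -re; lra.
have Me0 : 0 < M * eta by rewrite mulr_gt0.
have Qe : Q * eta <= 1 / 128 / 16.
  have : 0 <= (r - 128 * Q) * eta by rewrite mulr_ge0 ?subr_ge0// ltW.
  by clear -re; lra.
have Qe0 : 0 < Q * eta by rewrite mulr_gt0.
have Z0 : 0 < u / m by rewrite divr_gt0.
have kx1 : kap * x <= 1 by rewrite mulr_ile1// ltW.
have kx0 : 0 < kap * x by rewrite mulr_gt0.
have sg2 : m * sg ^+ 2 <= m^-1.
  have -> : m * sg ^+ 2 = (kap * x) ^+ 2 / m.
    by rewrite /sg; clear -m0; field; rewrite gt_eqF.
  rewrite -[leRHS]mul1r ler_pM2r ?invr_gt0// exprn_ile1//; exact: ltW.
have aZ : a / m <= u / m by rewrite ler_pM2r ?invr_gt0.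
have mZ : m^-1 <= u / m.
  by rewrite -[leLHS]mul1r ler_pM2r ?invr_gt0// (le_trans a1).
have B0 : 0 <= 2^-1 * (r * eta) * x ^+ 3 by clear -re0 x3; nonneg.
have B1 : 2^-1 * (r * eta) * x ^+ 3 <= 32^-1.
  have : (r * eta) * x ^+ 3 <= 16^-1 * 1 by apply: ler_pM => //; exact: ltW.
  by clear; lra.
have E1 : 2^-1 * (r * eta) * x ^+ 3 * (A * m * (3 * sg ^+ 2)) <= 2^-1 * (u / m).
  have h : A * (m * sg ^+ 2) <= u / m.
    apply: le_trans aZ; apply: ler_pM => //.
    by rewrite mulr_ge0 ?sqr_ge0// ltW.
  have -> : A * m * (3 * sg ^+ 2) = 3 * (A * (m * sg ^+ 2)) by ring.
  have h0 : 0 <= 3 * (A * (m * sg ^+ 2)) by clear -A0 m0; nonneg.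
  have : 2^-1 * (r * eta) * x ^+ 3 * (3 * (A * (m * sg ^+ 2))) <= 32^-1 * (3 * (u / m)).
    by apply: ler_pM => //; clear -h; lra.
  by clear -Z0; lra.
have Am0 : 0 <= A * m by rewrite mulr_ge0// ltW.
have split3 : 2^-1 * (r * eta) * x ^+ 3 * A * m * W = 2^-1 * (r * eta) * x ^+ 3 * (A * m * W).
  by ring.
rewrite split3; have [sy|sy] := leP (sg * y) 1.
- have {}W2 := W2 sy.
  have h1 := ler_wpM2l B0 (ler_wpM2l Am0 W2).
  have y2 : 0 <= y ^+ 2 / (8 * u ^+ 3) by clear -u0; nonneg.
  have h2 : 2^-1 * (r * eta) * x ^+ 3 * (2^-1 * a * m * (y ^+ 2 / (8 * u ^+ 3))) <=
            2^-1 * (r * eta) * x ^+ 3 * (A * m * (y ^+ 2 / (8 * u ^+ 3))).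
    by apply: ler_wpM2l => //; do 2![apply: ler_wpM2r => //]; exact: ltW.
  have c0 : 0 <= eta * x ^+ 3 * m by clear -e0 x3 m0; nonneg.
  have h3 := ler_wpM2l c0 L.
  have e3 : eta * x ^+ 3 * m * (Q / u) = Q * eta * x ^+ 3 * m / u by ring.
  have e4 : eta * x ^+ 3 * m * (r / 32 * a * y ^+ 2 / u ^+ 3 + M / 4 * V) =
    2^-1 * (r * eta) * x ^+ 3 * (2^-1 * a * m * (y ^+ 2 / (8 * u ^+ 3)))
    + 4^-1 * M * eta * x ^+ 3 * m * V by clear -u0; field; rewrite gt_eqF.
  have e1 : 2^-1 * (r * eta) * x ^+ 3 * (A * m * (y ^+ 2 / (8 * u ^+ 3) - 3 * sg ^+ 2))
    = 2^-1 * (r * eta) * x ^+ 3 * (A * m * (y ^+ 2 / (8 * u ^+ 3)))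
      - 2^-1 * (r * eta) * x ^+ 3 * (A * m * (3 * sg ^+ 2)) by ring.
  rewrite e3 e4 in h3; rewrite e1 in h1.
  by clear -E1 h1 h2 h3 Z0; lra.
- have h1 := ler_wpM2l B0 (ler_wpM2l Am0 W1).
  have yi : m <= y.
    have h : m <= sg * y * m by rewrite ler_peMl// ltW.
    apply: le_trans h _; have -> : sg * y * m = kap * x * y.
      by rewrite /sg; clear -m0; field; rewrite gt_eqF.
    by rewrite ler_piMl.
  have V2 : 96 * y ^+ 2 / (8 * a + y ^+ 2) ^+ 2 <= 96 / m ^+ 2.
    have D0 : 0 < 8 * a + y ^+ 2.
      by rewrite ltr_pwDl ?sqr_ge0// mulr_gt0.
    rewrite ler_pdivrMr ?exprn_gt0// mulrAC ler_pdivlMr ?exprn_gt0//.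
    rewrite -mulrA ler_pM2l//.
    have my : m ^+ 2 <= y ^+ 2 by rewrite ler_pXn2r// nnegrE// ltW.
    apply: le_trans (ler_wpM2l (sqr_ge0 y) my) _.
    have -> : y ^+ 2 * y ^+ 2 = (y ^+ 2) ^+ 2 by ring.
    rewrite ler_pXn2r// ?nnegrE ?sqr_ge0 ?(ltW D0)//.
    by rewrite lerDr mulr_ge0// ltW.
  have V3 : - (96 / m ^+ 2) <= V by apply: le_trans V1; rewrite lerN2.
  have b0 : 0 <= 4^-1 * M * eta * x ^+ 3 * m by clear -M0 e0 x3 m0; nonneg.
  have h4 := ler_wpM2l b0 V3.
  have h5 : 4^-1 * M * eta * x ^+ 3 * m * (96 / m ^+ 2) <= 4^-1 * (u / m).
    have -> : 4^-1 * M * eta * x ^+ 3 * m * (96 / m ^+ 2) =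
       24 * (M * eta * x ^+ 3 * m^-1) by clear -m0; field; rewrite gt_eqF.
    have : M * eta * x ^+ 3 * m^-1 <= 96^-1 * m^-1.
      rewrite ler_pM2r ?invr_gt0//.
      have : M * eta * x ^+ 3 <= M * eta * 1 by rewrite ler_pM2l.
      by clear -Me; lra.
    by clear -mZ; lra.
  have h6 : Q * eta * x ^+ 3 * m / u <= 4^-1 * (u / m).
    rewrite ler_pdivrMr//.
    have mu : m <= u := le_trans yi yu.
    have hm : m <= u / m * u.
      by rewrite mulrAC ler_pdivlMr//; apply: ler_pM => //; exact: ltW.
    have : Q * eta * x ^+ 3 * m <= 4^-1 * m.
      rewrite ler_pM2r//.
      have : Q * eta * x ^+ 3 <= Q * eta * 1 by rewrite ler_pM2l.
      by clear -Qe; lra.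
    by clear -hm; lra.
  have e1 : 2^-1 * (r * eta) * x ^+ 3 * (A * m * - (3 * sg ^+ 2)) =
    - (2^-1 * (r * eta) * x ^+ 3 * (A * m * (3 * sg ^+ 2))) by ring.
  rewrite e1 in h1; rewrite mulrN in h4.
  by clear -E1 h1 h4 h5 h6 Z0; lra.
Qed.

(** The gain in |q|^2: dissipation, commutator potential and Hardy potential
    together are at least a multiple of 1 / lam at every frequency. *)
Lemma potential_key a l (Q M r kap eta m x A : R) :
  1 <= a -> 0 < Q -> 48 * Q <= M -> 1536 * M <= r -> 128 * Q <= r ->
  0 < kap -> kap <= 1 -> 0 < eta -> r * eta <= 16^-1 ->
  1 <= m -> 0 < x -> x <= 1 -> 2^-1 * a <= A -> A <= a ->
  Q * eta * x ^+ 3 * m / lam a l <=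
  lam a l / m
  + 2^-1 * (r * eta) * x ^+ 3 * A * m * Wpot (bsym a) (esc (kap * x / m)) l
  + 4^-1 * M * eta * x ^+ 3 * m * hweight (8 * a) l%:~R.
Proof.
move=> a1 Q0 MQ rM rQ k0 k1 e0 re m1 x0 x1 Aa1 Aa2.
have sg0 : 0 <= kap * x / m.
  by rewrite divr_ge0 ?mulr_ge0 ?ltW//; exact: lt_le_trans m1.
have [W1 W2] := @Wpot_ge _ a _ l a1 sg0.
have yy : `|l%:~R : R| ^+ 2 = l%:~R ^+ 2 by rewrite real_normK ?num_real.
apply: (@potential_core a _ `|l%:~R : R| _ _ Q M r kap) => //.
- by apply: lam_gea; clear -a1; lra.
- exact: lam_gel.
- by clear -Q0 MQ; lra.
- by move=> /W2; rewrite yy.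
- by rewrite yy; apply: hweight_ge; clear -a1; lra.
- by rewrite yy; exact: low_freq.
Qed.

End Gain.

(** * Bounds for the fluxes and the dissipation *)

Section Bounds.
Context {R : rcfType}.
Implicit Types (X Y U V b G n F : int -> R) (K B a sg : R) (l : int).

Lemma nrm_ge0 X Y l : 0 <= nrm X Y l. Proof. by rewrite addr_ge0// sqr_ge0. Qed.
Lemma snrm_ge0 X Y l : 0 <= snrm X Y l. Proof. by rewrite addr_ge0// sqr_ge0. Qed.
Lemma mnrm_ge0 X Y l : 0 <= mnrm X Y l. Proof. by rewrite addr_ge0// sqr_ge0. Qed.

Lemma mnrm_le X Y l : mnrm X Y l <= (nrm X Y (l - 1) + nrm X Y (l + 1)) / 2.
Proof.
rewrite /mnrm /nrm /avg.
have := sqr_ge0 (X (l - 1) - X (l + 1)); have := sqr_ge0 (Y (l - 1) - Y (l + 1)).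
by lra.
Qed.

Lemma wedge_le (p q u v : R) :
  `|p * v - q * u| <= ((p ^+ 2 + q ^+ 2) + (u ^+ 2 + v ^+ 2)) / 2.
Proof.
rewrite ler_norml; have := sqr_ge0 (p - v); have := sqr_ge0 (q + u).
have := sqr_ge0 (p + v); have := sqr_ge0 (q - u).
by move=> ? ? ? ?; apply/andP; split; lra.
Qed.

Lemma cross_le X Y l : `|cross X Y l| <= (nrm X Y (l - 1) + nrm X Y (l + 1)) / 2.
Proof.
have := wedge_le (X (l - 1)) (Y (l - 1)) (- Y (l + 1)) (X (l + 1)).
by rewrite /cross /nrm mulrN opprK sqrrN [_ + X (l + 1) ^+ 2]addrC.
Qed.

Lemma current_le X Y l : `|current X Y l| <= (nrm X Y l + nrm X Y (l + 1)) / 2.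
Proof. exact: wedge_le. Qed.

Lemma twist_le X Y l (th : R) : 0 < th ->
  `|twist X Y l| <= (th * nrm X Y l + snrm X Y l / th) / 2.
Proof.
move=> t0; rewrite ler_norml.
have h1 : 0 <= th^-1 * ((th * X l - dif Y l) ^+ 2 + (th * Y l + dif X l) ^+ 2).
  by nonneg.
have h2 : 0 <= th^-1 * ((th * X l + dif Y l) ^+ 2 + (th * Y l - dif X l) ^+ 2).
  by nonneg.
have e1 : th^-1 * ((th * X l - dif Y l) ^+ 2 + (th * Y l + dif X l) ^+ 2) =
  th * nrm X Y l + snrm X Y l / th - 2 * twist X Y l.
  by rewrite /nrm /snrm /twist; field; rewrite gt_eqF.
have e2 : th^-1 * ((th * X l + dif Y l) ^+ 2 + (th * Y l - dif X l) ^+ 2) =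
  th * nrm X Y l + snrm X Y l / th + 2 * twist X Y l.
  by rewrite /nrm /snrm /twist; field; rewrite gt_eqF.
by apply/andP; split; lra.
Qed.

Lemma nbh_ge X Y l : [/\ nrm X Y (l - 2) <= nbh (nrm X Y) l,
  nrm X Y (l - 1) <= nbh (nrm X Y) l, nrm X Y l <= nbh (nrm X Y) l,
  nrm X Y (l + 1) <= nbh (nrm X Y) l & nrm X Y (l + 2) <= nbh (nrm X Y) l].
Proof.
have := nrm_ge0 X Y (l - 2); have := nrm_ge0 X Y (l - 1); have := nrm_ge0 X Y l.
have := nrm_ge0 X Y (l + 1); have := nrm_ge0 X Y (l + 2).
by rewrite /nbh => ? ? ? ? ?; split; lra.
Qed.

Lemma norm_coef_le (c u B N : R) : `|c| <= B -> `|u| <= N -> `|c * u| <= B * N.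
Proof. by move=> cB uN; rewrite normrM ler_pM. Qed.

Lemma twist_flux_le b G B X Y l : (forall l, 0 <= b l <= 1) ->
  (forall l, `|G l| <= B) -> `|twist_flux b G X Y l| <= 2 * B * nbh (nrm X Y) l.
Proof.
move=> b01 GB.
have Gb j k : `|G j * b k| <= B.
  rewrite -[leRHS]mulr1; apply: norm_coef_le => //.
  by have /andP[] := b01 k; rewrite ler_norml; lra.
have := Gb (l - 1) (l - 1); have := Gb l l; have := Gb (l - 1) l.
have := Gb l (l - 1); have := Gb (l - 2) (l - 1); have := Gb (l + 1) l.
have [n1 n2 n3 n4 _] := nbh_ge X Y l.
have := cross_le X Y l; have := cross_le X Y (l - 1); rewrite !shiftE.
have N1 := ger0_norm (nrm_ge0 X Y l); have N2 := ger0_norm (nrm_ge0 X Y (l - 1)).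
rewrite /twist_flux.
have -> :  - 4^-1 * G (l - 1) * b (l - 1) * nrm X Y l - 4^-1 * G l * b l * nrm X Y (l - 1)
  + 4^-1 * G (l - 1) * b l * cross X Y l + 4^-1 * G l * b (l - 1) * cross X Y (l - 1)
  - 8^-1 * (G l - G (l - 2)) * b (l - 1) * nrm X Y l
  + 8^-1 * (G (l + 1) - G (l - 1)) * b l * nrm X Y (l - 1) =
  4^-1 * (- (G (l - 1) * b (l - 1) * nrm X Y l) - (G l * b l * nrm X Y (l - 1))
  + G (l - 1) * b l * cross X Y l + G l * b (l - 1) * cross X Y (l - 1))
  + 8^-1 * (- (G l * b (l - 1) * nrm X Y l) + (G (l - 2) * b (l - 1) * nrm X Y l)
  + (G (l + 1) * b l * nrm X Y (l - 1)) - (G (l - 1) * b l * nrm X Y (l - 1))) by ring.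
move: (nbh _ _) n1 n2 n3 n4 N1 N2 => S.
move: (nrm X Y l) (nrm X Y (l - 1)) (nrm X Y (l + 1)) (nrm X Y (l - 2)) => p pm pp pmm.
move=> n1 n2 n3 n4 N1 N2 c1 c2 g1 g2 g3 g4 g5 g6.
have c1' : `|cross X Y (l - 1)| <= S by lra.
have c2' : `|cross X Y l| <= S by lra.
rewrite -N2 in n2; rewrite -N1 in n3.
have := norm_coef_le g6 n3; have := norm_coef_le g5 n2.
have := norm_coef_le g4 c2'; have := norm_coef_le g3 c1'.
have := norm_coef_le g3 n3; have := norm_coef_le g2 n3.
have := norm_coef_le g1 n2; have := norm_coef_le g4 n2.
rewrite !ler_norml => /andP[? ?] /andP[? ?] /andP[? ?] /andP[? ?] /andP[? ?].
by move=> /andP[? ?] /andP[? ?] /andP[? ?]; apply/andP; split; lra.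
Qed.

Lemma well_flux_le b X Y l : (forall l, 0 <= b l <= 1) ->
  `|well_flux b X Y l| <= 4 * nbh (nrm X Y) l.
Proof.
move=> b01.
have b1 k : `|b k| <= 1 by have /andP[] := b01 k; rewrite ler_norml; lra.
have bb k j : `|b k * b j| <= 1 by rewrite -[leRHS]mulr1 norm_coef_le.
have w := wedge_le (avg X (l - 1)) (avg Y (l - 1)) (avg X l) (avg Y l).
have := mnrm_le X Y l; have := mnrm_le X Y (l - 1); rewrite !shiftE /mnrm.
have := current_le X Y l; have := current_le X Y (l - 1); have := current_le X Y (l - 2).
rewrite !shiftE; have [n1 n2 n3 n4 n5] := nbh_ge X Y l.
rewrite /well_flux; move: (nbh _ _) n1 n2 n3 n4 n5 => S.
move: (nrm X Y l) (nrm X Y (l - 1)) (nrm X Y (l + 1)) (nrm X Y (l - 2)) => p pm pp pmm.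
move=> n1 n2 n3 n4 n5 c1 c2 c3 m1 m2.
have c1' : `|current X Y (l - 2)| <= S by lra.
have c2' : `|current X Y (l - 1)| <= S by lra.
have c3' : `|current X Y l| <= S by lra.
have w' : `|avg X (l - 1) * avg Y l - avg Y (l - 1) * avg X l| <= S by lra.
have := norm_coef_le (bb (l - 1) l) w'.
have := norm_coef_le (b1 l) c3'; have := norm_coef_le (b1 l) c2'.
have := norm_coef_le (b1 (l - 1)) c2'; have := norm_coef_le (b1 (l - 1)) c1'.
move: c2'; rewrite !mulrBr.
rewrite !ler_norml => /andP[? ?] /andP[? ?] /andP[? ?] /andP[? ?] /andP[? ?].
by move=> /andP[? ?]; apply/andP; split; lra.
Qed.

Lemma esc_le_inv sg l : 0 < sg -> `|esc sg l| <= sg^-1.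
Proof.
move=> s0; have y0 := normr_ge0 (l%:~R : R); have sy := mulr_ge0 (ltW s0) y0.
rewrite normrM normfV (@ger0_norm _ (1 + _)); last by lra.
have si : 0 < sg^-1 by rewrite invr_gt0.
by rewrite ler_pdivrMr; [rewrite mulrDr mulKf ?gt_eqF//; lra|lra].
Qed.

Lemma esc_le sg l : 0 <= sg -> `|esc sg l| <= `|l%:~R : R|.
Proof.
move=> s0; have y0 := normr_ge0 (l%:~R : R); have sy := mulr_ge0 s0 y0.
rewrite normrM normfV (@ger0_norm _ (1 + _)); last by lra.
by rewrite ler_pdivrMr ?ler_peMr//; lra.
Qed.

Lemma esc_slope sg l : 0 <= sg -> 0 <= esc sg (l + 1) - esc sg (l - 1) /\
  (sg <= 1 -> sg * `|l%:~R| <= 1 -> 9^-1 <= (esc sg (l + 1) - esc sg (l - 1)) / 2).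
Proof.
move=> s0; rewrite /esc !castE; set y : R := l%:~R.
set u := y + 1; set v := y - 1.
have u0 := normr_ge0 u; have v0 := normr_ge0 v.
have su := mulr_ge0 s0 u0; have sv := mulr_ge0 s0 v0.
have D0 : 0 < (1 + sg * `|u|) * (1 + sg * `|v|) by rewrite mulr_gt0//; lra.
have key : 2 / ((1 + sg * `|u|) * (1 + sg * `|v|)) <=
    u / (1 + sg * `|u|) - v / (1 + sg * `|v|).
  have -> : u / (1 + sg * `|u|) - v / (1 + sg * `|v|) =
    (u - v + sg * (u * `|v| - v * `|u|)) / ((1 + sg * `|u|) * (1 + sg * `|v|)).
    by field; apply/andP; split; rewrite gt_eqF//; lra.
  rewrite ler_pM2r ?invr_gt0//.
  have : 0 <= sg * (u * `|v| - v * `|u|).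
    apply: mulr_ge0 => //; have [hu|hu] := leP 0 u; have [hv|hv] := leP 0 v.
    - by rewrite (ger0_norm hu) (ger0_norm hv); clear; lra.
    - rewrite (ger0_norm hu) (ltr0_norm hv).
      have : 0 <= u * - v by apply: mulr_ge0 => //; rewrite oppr_ge0 ltW.
      by clear; lra.
    - by exfalso; rewrite /u /v in hu hv; lra.
    - by rewrite (ltr0_norm hu) (ltr0_norm hv); clear; lra.
  by rewrite /u /v; lra.
split; first by apply: le_trans key; apply: divr_ge0; [lra|exact: ltW].
move=> s1 sy; suff : 2 / 9 <= u / (1 + sg * `|u|) - v / (1 + sg * `|v|) by lra.
apply: le_trans key; rewrite ler_pM2l// lef_pV2 ?posrE//.
have hu : sg * `|u| <= sg * `|y| + sg.
  by rewrite -{3}[sg]mulr1 -mulrDr ler_wpM2l// (le_trans (ler_normD _ _))// normr1.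
have hv : sg * `|v| <= sg * `|y| + sg.
  by rewrite -{3}[sg]mulr1 -mulrDr ler_wpM2l// (le_trans (ler_normB _ _))// normr1.
have -> : 9 = 3 * 3 :> R by ring.
by apply: ler_pM; lra.
Qed.

(** Summation by parts: mass at the two neighbours of l may be moved to l. *)
Lemma subdiv_shift X Y (c : int -> R) B : (forall l, `|c l| <= B) ->
  subdiv (2 * B) (nrm X Y) (fun l => c l * (nrm X Y (l - 1) + nrm X Y (l + 1))
                     - (c (l - 1) + c (l + 1)) * nrm X Y l).
Proof.
move=> cB.
apply: (@subdivE _ _ _ _
   (fun l => c (l - 1) * nrm X Y l - c l * nrm X Y (l - 1))) => l; last first.
  by rewrite !shiftE; ring.
have [_ n2 n3 _ _] := nbh_ge X Y l.
have N1 := ger0_norm (nrm_ge0 X Y l); have N2 := ger0_norm (nrm_ge0 X Y (l - 1)).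
rewrite -N2 in n2; rewrite -N1 in n3.
have := norm_coef_le (cB (l - 1)) n3; have := norm_coef_le (cB l) n2.
by rewrite !ler_norml => /andP[? ?] /andP[? ?]; apply/andP; split; lra.
Qed.

End Bounds.

Section Dissipation.
Context {R : rcfType}.
Variables (a : R) (a1 : 1 < a) (X Y : int -> R).
Local Notation L := (lam a).
Let LX l := L l * X l.
Let LY l := L l * Y l.
Local Notation N := (nrm X Y).

Let L1 l : 1 <= L l.
Proof. by apply: le_trans (ltW a1) (lam_gea _ _); exact: le_trans ler01 (ltW a1). Qed.

Let L0 l : 0 < L l. Proof. exact: lt_le_trans ltr01 (L1 l). Qed.

Let lam_p l : exists2 h : R, L (l + 1) = L l + h & -1 <= h <= 1.
Proof.
exists (L (l + 1) - L l); first by ring.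
by have := lam_lip a l; rewrite ler_norml.
Qed.

Let lam_m l : exists2 h : R, L (l - 1) = L l + h & -1 <= h <= 1.
Proof.
exists (L (l - 1) - L l); first by ring.
by have := lam_lipm a l; rewrite ler_norml.
Qed.

Let sq_le (h p : R) : -1 <= h <= 1 -> (h * p) ^+ 2 <= p ^+ 2.
Proof.
move=> h1; rewrite exprMn ler_piMl ?sqr_ge0//.
by rewrite -real_normK ?num_real// exprn_ile1// ler_norml.
Qed.

(** As lam is 1-Lipschitz, exchanging it with the shifts in [dif] costs only
    the neighbouring masses divided by lam. *)
Lemma diss_snrm l :
  L l * snrm X Y l - (N (l - 1) + N (l + 1)) / (2 * L l) <= dsnrm X Y LX LY l.
Proof.
have [h eh h1] := lam_p l; have [k ek k1] := lam_m l.
have Lp := L0 l.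
rewrite /dsnrm /LX /LY /dif eh ek.
pose eX := (k * X (l - 1) - h * X (l + 1)) / 2.
pose eY := (k * Y (l - 1) - h * Y (l + 1)) / 2.
have -> : (((L l + k) * X (l - 1) - (L l + h) * X (l + 1)) / 2) = L l * dif X l + eX.
  by rewrite /eX /dif; ring.
have -> : (((L l + k) * Y (l - 1) - (L l + h) * Y (l + 1)) / 2) = L l * dif Y l + eY.
  by rewrite /eY /dif; ring.
have he : eX ^+ 2 + eY ^+ 2 <= (N (l - 1) + N (l + 1)) / 2.
  have := sq_le (X (l - 1)) k1; have := sq_le (Y (l - 1)) k1.
  have := sq_le (X (l + 1)) h1; have := sq_le (Y (l + 1)) h1.
  have := sqr_ge0 (k * X (l - 1) + h * X (l + 1)).
  have := sqr_ge0 (k * Y (l - 1) + h * Y (l + 1)).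
  by rewrite /eX /eY /nrm; lra.
have {}he : (eX ^+ 2 + eY ^+ 2) / L l <= (N (l - 1) + N (l + 1)) / (2 * L l).
  have -> : (N (l - 1) + N (l + 1)) / (2 * L l) = (N (l - 1) + N (l + 1)) / 2 / L l.
    by field; rewrite gt_eqF.
  by rewrite ler_pM2r ?invr_gt0.
have hh : 0 <= (L l)^-1 * ((L l * dif X l + eX) ^+ 2 + (L l * dif Y l + eY) ^+ 2).
  by nonneg.
have e : (L l)^-1 * ((L l * dif X l + eX) ^+ 2 + (L l * dif Y l + eY) ^+ 2) =
   2 * (dif X l * (L l * dif X l + eX) + dif Y l * (L l * dif Y l + eY))
   - L l * snrm X Y l + (eX ^+ 2 + eY ^+ 2) / L l.
  by rewrite /snrm; field; rewrite gt_eqF.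
by rewrite -/(dif X l) -/(dif Y l); lra.
Qed.

Lemma diss_mnrm l : - ((N (l - 1) + N (l + 1)) / 4) <= dmnrm X Y LX LY l.
Proof.
have [h eh h1] := lam_p l; have [k ek k1] := lam_m l.
have Lo := L1 l.
rewrite /dmnrm /LX /LY /avg eh ek.
pose eX := (k * X (l - 1) + h * X (l + 1)) / 2.
pose eY := (k * Y (l - 1) + h * Y (l + 1)) / 2.
have -> : (((L l + k) * X (l - 1) + (L l + h) * X (l + 1)) / 2) = L l * avg X l + eX.
  by rewrite /eX /avg; ring.
have -> : (((L l + k) * Y (l - 1) + (L l + h) * Y (l + 1)) / 2) = L l * avg Y l + eY.
  by rewrite /eY /avg; ring.
have he : eX ^+ 2 + eY ^+ 2 <= (N (l - 1) + N (l + 1)) / 2.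
  have := sq_le (X (l - 1)) k1; have := sq_le (Y (l - 1)) k1.
  have := sq_le (X (l + 1)) h1; have := sq_le (Y (l + 1)) h1.
  have := sqr_ge0 (k * X (l - 1) - h * X (l + 1)).
  have := sqr_ge0 (k * Y (l - 1) - h * Y (l + 1)).
  by rewrite /eX /eY /nrm; lra.
rewrite -/(avg X l) -/(avg Y l).
have := sqr_ge0 (2 * avg X l + eX); have := sqr_ge0 (2 * avg Y l + eY).
have l1 : 0 <= L l - 1 by lra.
have := mulr_ge0 l1 (mnrm_ge0 X Y l); rewrite /mnrm.
by lra.
Qed.

Lemma diss_well l :
  L l * snrm X Y l - (N (l - 1) + N (l + 1)) / L l <= dwell (bsym a) X Y LX LY l.
Proof.
have Lo := L1 l; have Lp := L0 l.
rewrite /dwell; have h1 := diss_snrm l; have h2 := diss_mnrm l.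
have b0 := bsym_gt0 l a1; have b1 := bsym_le1 a l.
have e : 1 - bsym a l = (L l)^-1 by rewrite /bsym subKr.
have Li1 : (L l)^-1 <= 1 by rewrite invf_le1// L0.
have Li0 : 0 < (L l)^-1 by rewrite invr_gt0.
have S0 : 0 <= N (l - 1) + N (l + 1) by rewrite addr_ge0// nrm_ge0.
have h3 : - ((N (l - 1) + N (l + 1)) / (4 * L l)) <= (L l)^-1 * dmnrm X Y LX LY l.
  have := ler_wpM2l (ltW Li0) h2.
  have -> : (L l)^-1 * - ((N (l - 1) + N (l + 1)) / 4) =
    - ((N (l - 1) + N (l + 1)) / (4 * L l)) by field; rewrite gt_eqF.
  by [].
have h4 : 0 <= (bsym a l)^-1 * dnrm X Y LX LY l - dnrm X Y LX LY l.
  have -> : dnrm X Y LX LY l = 2 * (L l * N l) by rewrite /dnrm /LX /LY /nrm; ring.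
  have bi : 1 <= (bsym a l)^-1 by rewrite invf_ge1.
  have : 0 <= 2 * (L l * N l) by have := nrm_ge0 X Y l => ?; nonneg.
  by rewrite subr_ge0 => ?; rewrite ler_peMl.
have e5 : (N (l - 1) + N (l + 1)) / (4 * L l) + (N (l - 1) + N (l + 1)) / (2 * L l)
  = 3 / 4 * ((N (l - 1) + N (l + 1)) / L l) by field; rewrite gt_eqF.
have : 0 <= (N (l - 1) + N (l + 1)) / L l by rewrite divr_ge0// ltW.
by rewrite e; lra.
Qed.

Lemma diss_twist l : `|dtwist X Y LX LY l - 2 * L l * twist X Y l| <=
  N l / 2 + (N (l - 1) + N (l + 1)) / 4.
Proof.
have [h eh h1] := lam_p l; have [k ek k1] := lam_m l.
have -> : dtwist X Y LX LY l - 2 * L l * twist X Y l =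
    k * ((X l * Y (l - 1) - Y l * X (l - 1)) / 2)
    - h * ((X l * Y (l + 1) - Y l * X (l + 1)) / 2).
  by rewrite /dtwist /twist /LX /LY /dif eh ek; ring.
have le1 (c p q : R) : -1 <= c <= 1 -> `|p| <= q -> `|c * p| <= q.
  move=> c1 pq; rewrite -[q]mul1r; apply: norm_coef_le => //.
  by rewrite ler_norml.
have h2 : `|(X l * Y (l - 1) - Y l * X (l - 1)) / 2| <= (N l + N (l - 1)) / 4.
  rewrite normrM (@ger0_norm _ (2^-1)) ?invr_ge0//.
  by have := wedge_le (X l) (Y l) (X (l - 1)) (Y (l - 1)); rewrite /nrm; lra.
have h3 : `|(X l * Y (l + 1) - Y l * X (l + 1)) / 2| <= (N l + N (l + 1)) / 4.
  rewrite normrM (@ger0_norm _ (2^-1)) ?invr_ge0//.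
  by have := wedge_le (X l) (Y l) (X (l + 1)) (Y (l + 1)); rewrite /nrm; lra.
apply: le_trans (ler_normB _ _) _.
have := le1 _ _ _ k1 h2; have := le1 _ _ _ h1 h3.
by lra.
Qed.

Lemma well_le (ib : R) l : (bsym a l)^-1 <= ib ->
  well (bsym a) X Y l <= snrm X Y l + ib * (N l / L l) + (N (l - 1) + N (l + 1)) / (2 * L l).
Proof.
move=> bi; have Lp := L0 l; have b0 := bsym_gt0 l a1.
have e : 1 - bsym a l = (L l)^-1 by rewrite /bsym subKr.
have e2 : (bsym a l)^-1 * N l - N l = (bsym a l)^-1 * (N l / L l).
  by rewrite -e; field; rewrite gt_eqF.
have h1 : (bsym a l)^-1 * (N l / L l) <= ib * (N l / L l).
  by rewrite ler_wpM2r// divr_ge0 ?nrm_ge0// ltW.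
have h2 : (L l)^-1 * mnrm X Y l <= (N (l - 1) + N (l + 1)) / (2 * L l).
  have -> : (N (l - 1) + N (l + 1)) / (2 * L l) =
     (L l)^-1 * ((N (l - 1) + N (l + 1)) / 2) by field; rewrite gt_eqF.
  by rewrite ler_pM2l ?invr_gt0// mnrm_le.
by rewrite /well e; lra.
Qed.

Lemma well_ge l : snrm X Y l <= well (bsym a) X Y l.
Proof.
have Lp := L0 l; have b0 := bsym_gt0 l a1; have b1 := bsym_le1 a l.
have e : 1 - bsym a l = (L l)^-1 by rewrite /bsym subKr.
have h1 : 0 <= (bsym a l)^-1 * N l - N l.
  by rewrite subr_ge0 ler_peMl ?nrm_ge0// invf_ge1.
have h2 : 0 <= (L l)^-1 * mnrm X Y l by rewrite mulr_ge0 ?mnrm_ge0// invr_ge0 ltW.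
by rewrite /well e; lra.
Qed.

End Dissipation.

(** * The functional and its derivative *)

Section Balance.
Context {R : realFieldType}.

(** The balance of all terms at one frequency, in numbers. The gains of
    [potential_key] and [kinetic_key], and a Young inequality for the cross term
    [tau], are the last three hypotheses; what they leave is the defect in the Hardy
    inequality, which is bounded by a divergence. *)
Lemma pointwise_balance (N s tau L W V d x m n kap eta r M Q ib c A : R) :
  0 <= N -> 0 <= s -> 0 < L -> 1 <= m -> 0 <= x -> x <= 1 -> 0 < eta -> eta <= 2^-1 ->
  0 <= c -> c * ib <= eta -> c <= 1 -> 1 <= ib -> 17 + 6 * ib <= Q ->
  Q * eta * x ^+ 3 * m / L <=
    L / m + 2^-1 * (r * eta) * x ^+ 3 * A * m * W + 4^-1 * M * eta * x ^+ 3 * m * V ->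
  (6 + M) * eta * x ^+ 3 * m <= 2^-1 * eta * x ^+ 4 * L + r * eta * x ^+ 3 * m * A * d ->
  5 * r * eta * x ^+ 2 / (kap * n) * L * tau <= 4^-1 * (L / m) * N + 2^-1 * eta * x ^+ 4 * L * s ->
  - A * (r * eta * x ^+ 3 * m) * (d * s + W / 2 * N) - 2 * (L / m) * N
  + 5 * r * eta * x ^+ 2 / (kap * n) * L * tau + 3 / 32 * (L / m) * N
  - eta * x ^+ 4 * L * s + 4 * eta * x ^+ 3 * m * (N / L)
  + 4 * eta * m * x ^+ 3 * (s + ib * (N / L) + 2 * (N / L))
  + c * x ^+ 3 * (2 * ib * N + 2 * (eta * m * x ^+ 4) * (s + ib * (N / L) + 2 * (N / L)))
  <= 4^-1 * M * eta * x ^+ 3 * m * (V * N - 4 * s).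
Proof.
move=> N0 s0 L0 m1 x0 x1 e0 e2 c0 cib c1 ib1 hQ h1 h2 h3.
have m0 : 0 < m := lt_le_trans ltr01 m1.
have x3 : 0 <= x ^+ 3 by rewrite exprn_ge0.
have NL : 0 <= N / L by rewrite divr_ge0// ltW.
set w := s + ib * (N / L) + 2 * (N / L).
have ib0 : 0 <= ib := le_trans ler01 ib1.
have w0 : 0 <= w by rewrite /w; do ![apply: addr_ge0 => //|apply: mulr_ge0 => //].
have b1 : c * x ^+ 3 * (2 * (eta * m * x ^+ 4) * w) <= 2 * (eta * m * x ^+ 3) * w.
  have -> : c * x ^+ 3 * (2 * (eta * m * x ^+ 4) * w) =
     (c * x ^+ 4) * (2 * (eta * m * x ^+ 3) * w) by ring.
  rewrite ler_piMl//; first by clear -e0 m0 x3 w0; nonneg.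
  by rewrite mulr_ile1 ?exprn_ge0// exprn_ile1.
have b2 : c * x ^+ 3 * (2 * ib * N) <= 2 * eta * x ^+ 3 * N.
  have -> : c * x ^+ 3 * (2 * ib * N) = (c * ib) * (2 * x ^+ 3 * N) by ring.
  have -> : 2 * eta * x ^+ 3 * N = eta * (2 * x ^+ 3 * N) by ring.
  by rewrite ler_wpM2r//; clear -x3 N0; nonneg.
(* the two powers of the frequency balance: 2 <= L / m + m / L *)
have b3 : 2 * x ^+ 3 <= L / m + x ^+ 3 * (m / L).
  have h : 0 <= x ^+ 3 * ((L - m) ^+ 2 / (m * L)) by clear -x3 m0 L0; nonneg.
  have e : x ^+ 3 * ((L - m) ^+ 2 / (m * L)) = x ^+ 3 * (L / m) + x ^+ 3 * (m / L) - 2 * x ^+ 3.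
    by clear -m0 L0; field; rewrite !gt_eqF.
  have : x ^+ 3 * (L / m) <= L / m.
    by rewrite ler_piMl ?exprn_ile1// divr_ge0// ltW.
  by rewrite e in h; clear -h; lra.
have b4 : 2 * eta * x ^+ 3 * N <= 2^-1 * (L / m) * N + eta * x ^+ 3 * m * (N / L).
  have LmN : 0 <= L / m * N by clear -L0 m0 N0; nonneg.
  have eN : 0 <= eta * N by rewrite mulr_ge0// ltW.
  have := ler_wpM2l eN b3; have := ler_wpM2r LmN e2.
  have -> : eta * N * (L / m + x ^+ 3 * (m / L)) = eta * (L / m * N) + eta * x ^+ 3 * m * (N / L).
    by ring.
  have -> : eta * N * (2 * x ^+ 3) = 2 * eta * x ^+ 3 * N by ring.
  by clear; lra.
have g1 := ler_wpM2r N0 h1; have g2 := ler_wpM2r s0 h2.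
have emx : 0 <= eta * x ^+ 3 * m * (N / L) by clear -e0 x3 m0 NL; nonneg.
have g3 := ler_wpM2r emx hQ.
have LmN : 0 <= L / m * N by clear -L0 m0 N0; nonneg.
by rewrite /w in b1 *; clear -b1 b2 b4 g1 g2 g3 h3 LmN emx; lra.
Qed.

End Balance.

Section Functional.
Context {R : rcfType}.

Definition density (b G : int -> R) (e1 e2 : R) X Y l :=
  (b l)^-1 * nrm X Y l - e1 * G l * twist X Y l + e2 * well b X Y l.

(** The time derivative of [density]: [dG] is that of e1 * G, and [de2] that of e2. *)
Definition ddensity (b G dG : int -> R) (e1 e2 de2 : R) X Y U V l :=
  (b l)^-1 * dnrm X Y U V l
  - (dG l * twist X Y l + e1 * G l * dtwist X Y U V l)
  + (de2 * well b X Y l + e2 * dwell b X Y U V l).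

(** The equation of one mode, with transport of amplitude A. *)
Definition fieldX (a nu A : R) X Y l := A * trX (bsym a) Y l - nu * (lam a l * X l).
Definition fieldY (a nu A : R) X Y l := A * trY (bsym a) X l - nu * (lam a l * Y l).

(** Only the two gains of the commutator, the dissipation and the motion of the
    weights are not fluxes. *)
Lemma ddensity_field a nu A G dG e1 e2 de2 (X Y : int -> R) l : bsym a l != 0 ->
  let b := bsym a in let LX l := lam a l * X l in let LY l := lam a l * Y l in
  ddensity b G dG e1 e2 de2 X Y (fieldX a nu A X Y) (fieldY a nu A X Y) l =
  A * (current X Y l - current X Y (l - 1))
  - A * e1 * (twist_flux b G X Y (l + 1) - twist_flux b G X Y l)
  + A * e2 * (well_flux b X Y (l + 1) - well_flux b X Y l)
  - A * e1 * (b l * ((G (l + 1) - G (l - 1)) / 2) * snrm X Y l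
              + Wpot b G l / 2 * nrm X Y l)
  - nu * ((b l)^-1 * dnrm X Y LX LY l)
  + nu * (e1 * G l * dtwist X Y LX LY l)
  - nu * (e2 * dwell b X Y LX LY l)
  - dG l * twist X Y l + de2 * well b X Y l.
Proof.
move=> b0 b LX LY.
rewrite -(transport_nrm X Y b0) -(transport_well X Y b0).
have e := transport_twist b G X Y l.
have {}e : b l * ((G (l + 1) - G (l - 1)) / 2) * snrm X Y l + Wpot b G l / 2 * nrm X Y l =
   G l * dtwist X Y (trX b Y) (trY b X) l - (twist_flux b G X Y (l + 1) - twist_flux b G X Y l).
  by rewrite e; ring.
rewrite {}e /ddensity.
have e1' : dnrm X Y (fieldX a nu A X Y) (fieldY a nu A X Y) l =
   A * dnrm X Y (trX b Y) (trY b X) l - nu * dnrm X Y LX LY l.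
  by rewrite /dnrm /fieldX /fieldY /LX /LY /b; ring.
have e2' : dtwist X Y (fieldX a nu A X Y) (fieldY a nu A X Y) l =
   A * dtwist X Y (trX b Y) (trY b X) l - nu * dtwist X Y LX LY l.
  by rewrite /dtwist /dif /fieldX /fieldY /LX /LY /b; ring.
have e3' : dwell b X Y (fieldX a nu A X Y) (fieldY a nu A X Y) l =
   A * dwell b X Y (trX b Y) (trY b X) l - nu * dwell b X Y LX LY l.
  by rewrite /dwell e1' /dsnrm /dmnrm /dif /avg /fieldX /fieldY /LX /LY /b; ring.
by rewrite e1' e2' e3'; ring.
Qed.

End Functional.

(** * The constants and the size of the functional *)

Section Inequalities.
Context {R : realFieldType}.

(** [tau] stands for |twist|, N and s for the densities of |q|^2 and |(sin y) q|^2.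
    The two cross terms of the proof are estimated by two choices of th. *)
Lemma young_tau (N s tau L x n kap eta r : R) :
  0 < L -> 0 < x -> 0 < n -> 0 < kap -> 0 < eta -> 0 < r ->
  50 * r ^+ 2 * eta <= kap ^+ 2 -> 0 <= s ->
  (forall th, 0 < th -> tau <= (th * N + s / th) / 2) ->
  5 * r * eta * x ^+ 2 / (kap * n) * L * tau <=
    4^-1 * (L / n ^+ 2) * N + 2^-1 * eta * x ^+ 4 * L * s /\
  r * eta * x ^+ 2 * n / kap * tau <= 4^-1 * N + 4^-1 * (eta * n ^+ 2 * x ^+ 4) * s.
Proof.
move=> L0 x0 n0 k0 e0 r0 hk s0 ht.
have C0 : 0 < r * eta * x ^+ 2 by rewrite !mulr_gt0// exprn_gt0.
have key : r ^+ 2 * eta / kap ^+ 2 <= 50^-1.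
  by rewrite ler_pdivrMr ?exprn_gt0//; clear -hk; lra.
split.
- have t0 : 0 < kap / (10 * (r * eta * x ^+ 2) * n).
    by rewrite divr_gt0// mulr_gt0// mulr_gt0.
  have c0 : 0 <= 5 * r * eta * x ^+ 2 / (kap * n) * L.
    by clear -r0 e0 x0 k0 n0 L0; nonneg.
  apply: le_trans (ler_wpM2l c0 (ht _ t0)) _.
  have -> : 5 * r * eta * x ^+ 2 / (kap * n) * L *
    ((kap / (10 * (r * eta * x ^+ 2) * n) * N + s / (kap / (10 * (r * eta * x ^+ 2) * n))) / 2)
    = 4^-1 * (L / n ^+ 2) * N + (r ^+ 2 * eta / kap ^+ 2) * (25 * (eta * x ^+ 4 * L * s)).
    by clear -k0 n0 r0 e0 x0; field; rewrite !gt_eqF.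
  have h : 0 <= 25 * (eta * x ^+ 4 * L * s) by clear -e0 x0 L0 s0; nonneg.
  by have := ler_wpM2r h key; clear; lra.
- have t0 : 0 < kap / (2 * (r * eta * x ^+ 2) * n).
    by rewrite divr_gt0// mulr_gt0// mulr_gt0.
  have c0 : 0 <= r * eta * x ^+ 2 * n / kap.
    by clear -r0 e0 x0 k0 n0; nonneg.
  apply: le_trans (ler_wpM2l c0 (ht _ t0)) _.
  have -> : r * eta * x ^+ 2 * n / kap *
    ((kap / (2 * (r * eta * x ^+ 2) * n) * N + s / (kap / (2 * (r * eta * x ^+ 2) * n))) / 2)
    = 4^-1 * N + (r ^+ 2 * eta / kap ^+ 2) * ((eta * n ^+ 2 * x ^+ 4) * s).
    by clear -k0 n0 r0 e0 x0; field; rewrite !gt_eqF.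
  have h : 0 <= (eta * n ^+ 2 * x ^+ 4) * s by clear -e0 x0 n0 s0; nonneg.
  by have := ler_wpM2r h key; move: h; clear; lra.
Qed.

(** Either the escape function still has slope of order one, or the frequency
    is so high that dissipation takes over. *)
Lemma kinetic_key (a beta M r kap eta m x A L y d : R) :
  1 <= a -> 0 < beta -> 0 < M -> 18 * (6 + M) <= r * beta ->
  0 < kap -> 2 * kap * (6 + M) <= 1 -> 0 < eta -> 0 < r ->
  1 <= m -> 0 < x -> 2^-1 * a <= A -> 0 <= y -> y <= L ->
  0 <= d -> (kap * x / m * y <= 1 -> beta / 9 <= d) ->
  (6 + M) * eta * x ^+ 3 * m <= 2^-1 * eta * x ^+ 4 * L + r * eta * x ^+ 3 * m * A * d.
Proof.
move=> a1 b0 M0 rM k0 k1 e0 r0 m1 x0 aA y0 yL d0 hd.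
have m0 : 0 < m := lt_le_trans ltr01 m1.
have L0 : 0 <= L := le_trans y0 yL.
have A2 : 2^-1 <= A by clear -a1 aA; lra.
have A0 : 0 <= A by clear -A2; lra.
have xm : 0 <= eta * x ^+ 3 * m by clear -e0 x0 m0; nonneg.
have [sy|sy] := leP (kap * x / m * y) 1.
- have {}hd := hd sy.
  have h1 : 2^-1 * (beta / 9) <= A * d by apply: ler_pM => //; clear -b0; lra.
  have h2 : 6 + M <= r * (A * d).
    by have := ler_wpM2l (ltW r0) h1; clear -rM; lra.
  have := ler_wpM2r xm h2.
  have : 0 <= 2^-1 * eta * x ^+ 4 * L by clear -e0 x0 L0; nonneg.
  by clear; lra.
- have h1 : m <= kap * x * L.
    have : m <= m * (kap * x / m * y) by rewrite ler_peMr ?ltW.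
    have -> : m * (kap * x / m * y) = kap * x * y by clear -m0; field; rewrite gt_eqF.
    by move=> h; apply: le_trans h _; rewrite ler_wpM2l// mulr_ge0 ?ltW.
  have M6 : 0 <= 6 + M by clear -M0; lra.
  have ex : 0 <= eta * x ^+ 3 by clear -e0 x0; nonneg.
  have h2 := ler_wpM2l (mulr_ge0 M6 ex) h1.
  have h3 : 0 <= eta * x ^+ 4 * L by clear -e0 x0 L0; nonneg.
  have h4 := ler_wpM2r h3 k1.
  have : 0 <= r * eta * x ^+ 3 * m * A * d by clear -r0 e0 x0 m0 A0 d0; nonneg.
  by clear -h2 h4; lra.
Qed.

End Inequalities.

Section Constants.
Context {R : rcfType}.

(** Each line of the argument needs some constant to absorb the previous ones:
    ib bounds 1 / b, then Q, M, r are chosen large in this order, and kap, eta, c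
    small. The viscosity is n^-5. *)
Record admissible (a ib n kap eta r M Q c : R) : Prop := Admissible {
  ad_a : 1 < a; ad_ib : forall l, (bsym a l)^-1 <= ib; ad_n : 1 <= n;
  ad_kap : 0 < kap; ad_kapM : 2 * kap * (6 + M) <= 1; ad_eta : 0 < eta;
  ad_c : 0 <= c; ad_cib : c * ib <= eta; ad_Q : 17 + 6 * ib <= Q;
  ad_M : 48 * Q <= M; ad_rM : 1536 * M <= r; ad_rQ : 128 * Q <= r;
  ad_rib : 18 * (6 + M) <= r * ib^-1; ad_rkap : 50 * r ^+ 2 * eta <= kap ^+ 2;
  ad_reta : r * eta <= 16^-1 }.

Implicit Types (a ib n kap eta r M Q c x : R) (X Y : int -> R) (l : int).

(** The weights at the stage x in [0, 1] of the ramp. The escape function is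
    saturated at the frequency n^2 / (kap x), at which dissipation prevails. *)
Definition sg n kap x := kap * x / n ^+ 2.
Definition twist_coef n eta r x := r * eta * x ^+ 3 / n.
Definition well_coef n eta x := eta * n ^+ 2 * x ^+ 4.
Definition phi a n kap eta r x :=
  density (bsym a) (esc (sg n kap x)) (twist_coef n eta r x) (well_coef n eta x).

Lemma parameter_signs a ib n kap eta r M Q c : admissible a ib n kap eta r M Q c ->
  [/\ 1 <= ib, 0 < Q, 0 < M & 0 < r] /\
  [/\ kap <= 1, eta <= 2^-1, c <= 1, 0 < n & c <= eta].
Proof.
case=> a1 hib n1 k0 k1 e0 c0 cib Q17 MQ rM rQ rib hk re.
have b0 : 0 < bsym a 0 := bsym_gt0 0 a1.
have ib1 : 1 <= ib.
  by apply: le_trans (hib 0); rewrite invf_ge1// bsym_le1.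
have Q0 : 0 < Q by clear -Q17 ib1; lra.
have M0 : 0 < M by clear -MQ Q0; lra.
have r0 : 0 < r by clear -rM M0; lra.
have kM : 0 <= kap * M by rewrite mulr_ge0 ?ltW.
have kle : kap <= 1 by clear -k1 kM; lra.
have r1 : 0 <= (r - 1) * eta.
  by rewrite mulr_ge0 ?ltW// subr_gt0; clear -rQ Q17 ib1; lra.
have ele : eta <= 2^-1 by clear -r1 re; lra.
have cle : c <= eta by apply: le_trans cib; rewrite ler_peMr.
by do ![split=> //]; [clear -cle ele; lra|exact: lt_le_trans ltr01 n1].
Qed.

Lemma twist_coef_esc_le a ib n kap eta r M Q c x l :
  admissible a ib n kap eta r M Q c -> 0 < x ->
  twist_coef n eta r x * `|esc (sg n kap x) l| <= r * eta * x ^+ 2 * n / kap.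
Proof.
move=> ad x0; have [a1 hib n1 k0 k1 e0 c0 cib Q17 MQ rM rQ rib hk re] := ad.
have [[ib1 Q0 M0 r0] [kle ele cle n0 cle2]] := parameter_signs ad.
have s0 : 0 < sg n kap x by rewrite divr_gt0 ?mulr_gt0 ?exprn_gt0.
have c10 : 0 <= twist_coef n eta r x by rewrite /twist_coef; clear -r0 e0 x0 n0; nonneg.
apply: le_trans (ler_wpM2l c10 (esc_le_inv l s0)) _.
by rewrite le_eqVlt; apply/orP; left; apply/eqP; rewrite /twist_coef /sg; field; rewrite !gt_eqF.
Qed.

Lemma twist_term_le a ib n kap eta r M Q c x X Y l : admissible a ib n kap eta r M Q c -> 0 <= x ->
  `|twist_coef n eta r x * esc (sg n kap x) l * twist X Y l| <=
    4^-1 * nrm X Y l + 4^-1 * well_coef n eta x * snrm X Y l.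
Proof.
move=> ad x0; have [a1 hib n1 k0 k1 e0 c0 cib Q17 MQ rM rQ rib hk re] := ad.
have [[ib1 Q0 M0 r0] [kle ele cle n0 cle2]] := parameter_signs ad.
have N0 := nrm_ge0 X Y l; have s0 := snrm_ge0 X Y l.
have [->|xn] := eqVneq x 0.
  rewrite /twist_coef /well_coef !expr0n/= !(mulr0, mul0r, addr0) normr0; clear -N0; lra.
have {}x0 : 0 < x by rewrite lt_neqAle eq_sym xn.
have c10 : 0 <= twist_coef n eta r x by rewrite /twist_coef; clear -r0 e0 x0 n0; nonneg.
rewrite normrM [X in X * _]normrM (ger0_norm c10).
apply: le_trans (ler_wpM2r (normr_ge0 _) (twist_coef_esc_le l ad x0)) _.
by apply: (young_tau (L := 1) _ _ _ _ _ _ _ s0 (fun th => @twist_le _ X Y l th)).2.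
Qed.

(** The corrections do not spoil the energy: the escape term is absorbed by part of
    the energy and of [well]. *)
Lemma phi_ge a ib n kap eta r M Q c x X Y l :
  admissible a ib n kap eta r M Q c -> 0 <= x ->
  2^-1 * nrm X Y l <= phi a n kap eta r x X Y l.
Proof.
move=> ad x0; have [a1 hib n1 k0 k1 e0 c0 cib Q17 MQ rM rQ rib hk re] := ad.
have [[ib1 Q0 M0 r0] [kle ele cle n0 cle2]] := parameter_signs ad.
have N0 := nrm_ge0 X Y l; have s0 := snrm_ge0 X Y l.
have := twist_term_le X Y l ad x0; rewrite ler_norml => /andP[_ h].
have b0 := bsym_gt0 l a1; have b1 := bsym_le1 a l.
have h1 : nrm X Y l <= (bsym a l)^-1 * nrm X Y l by rewrite ler_peMl// invf_ge1.
have c20 : 0 <= well_coef n eta x by rewrite /well_coef; clear -e0 x0; nonneg.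
have h2 := ler_wpM2l c20 (well_ge a1 X Y l).
have := mulr_ge0 c20 s0; rewrite /phi /density.
by move: h h1 h2 N0; lra.
Qed.

Lemma phi_le a ib n kap eta r M Q c x X Y l : admissible a ib n kap eta r M Q c -> 0 <= x ->
  phi a n kap eta r x X Y l <= 2 * ib * nrm X Y l + 2 * (well_coef n eta x * well (bsym a) X Y l).
Proof.
move=> ad x0; have [a1 hib n1 k0 k1 e0 c0 cib Q17 MQ rM rQ rib hk re] := ad.
have [[ib1 Q0 M0 r0] [kle ele cle n0 cle2]] := parameter_signs ad.
have N0 := nrm_ge0 X Y l; have s0 := snrm_ge0 X Y l.
have := twist_term_le X Y l ad x0; rewrite ler_norml => /andP[h _].
have h1 : (bsym a l)^-1 * nrm X Y l <= ib * nrm X Y l by rewrite ler_wpM2r.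
have h3 : nrm X Y l <= ib * nrm X Y l by rewrite ler_peMl.
have c20 : 0 <= well_coef n eta x by rewrite /well_coef; clear -e0 x0; nonneg.
have h2 := ler_wpM2l c20 (well_ge a1 X Y l).
have := mulr_ge0 c20 s0; rewrite /phi /density.
by move: h h1 h2 h3 N0; lra.
Qed.

End Constants.

(** * Decay of the functional at each frequency *)

Section Bookkeeping.
Context {R : realFieldType}.

(** Bookkeeping for [local_decay], in numbers: i3 = n^-3, S is the mass at the two
    neighbours of l, and cl, csum are the coefficients with which [subdiv_shift]
    moves it to l. Each hypothesis is the estimate of one term. *)
Lemma collect_terms (i3 nu e1 e2 de2 gm g G N s S L m n x ib kap eta r c A d W
    twd dn dtw dwl tw wl ph cl csum : R) :
  0 < i3 -> i3 * m <= 1 -> 0 < n -> m = n ^+ 2 -> nu = i3 / m -> e1 = i3 * (r * eta * x ^+ 3 * m) ->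
  e2 = eta * m * x ^+ 4 -> 0 < L -> 1 <= L -> 0 <= N -> 0 <= s -> 0 <= S -> 0 < r -> 0 < eta ->
  0 < x -> x <= 1 -> 0 < kap -> kap <= 1 -> 1 <= n -> r * eta <= 16^-1 -> 0 <= c -> 0 <= ib ->
  G = `|g| -> e1 * G <= r * eta * x ^+ 2 * n / kap -> G <= L ->
  2 * (L * N) <= dn ->
  `|dtw - 2 * L * tw| <= N / 2 + S / 4 -> L * s - S / L <= dwl ->
  wl <= s + ib * (N / L) + S / (2 * L) -> 0 <= wl -> twd = `|tw| ->
  `|gm| <= 3 * r * eta * x ^+ 2 / n * i3 * L -> 0 <= de2 -> de2 <= i3 * (4 * eta * m * x ^+ 3) ->
  ph <= 2 * ib * N + 2 * (e2 * wl) ->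
  cl = nu * (e1 * G) / 4 + i3 * (eta * x ^+ 4 + 2 * eta * m * x ^+ 3 + c * x ^+ 3 * e2) / L ->
  csum <= nu * (e1 * L) + 4 * (i3 * (eta * x ^+ 4 + 2 * eta * m * x ^+ 3 + c * x ^+ 3 * e2) / L) ->
  - A * e1 * (d * s + W / 2 * N) - nu * dn + nu * (e1 * g * dtw) - nu * (e2 * dwl)
  - gm * tw + de2 * wl + i3 * (c * x ^+ 3) * ph - (cl * S - csum * N) <=
  i3 * (- A * (r * eta * x ^+ 3 * m) * (d * s + W / 2 * N) - 2 * (L / m) * N
  + 5 * r * eta * x ^+ 2 / (kap * n) * L * twd + 3 / 32 * (L / m) * N
  - eta * x ^+ 4 * L * s + 4 * eta * x ^+ 3 * m * (N / L)
  + 4 * eta * m * x ^+ 3 * (s + ib * (N / L) + 2 * (N / L))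
  + c * x ^+ 3 * (2 * ib * N + 2 * (eta * m * x ^+ 4) * (s + ib * (N / L) + 2 * (N / L)))).
Proof.
move=> i0 im n0 em enu ee1 ee2 L0 L1 N0 s0 S0 r0 e0 x0 x1 k0 k1 n1 re c0 ib0 eG Ginv GL
  hdn hdtw hdwl hwl wl0 etw hgm de0 hde hph ecl hcs.
have m0 : 0 < m by rewrite em exprn_gt0.
have nu0 : 0 < nu by rewrite enu divr_gt0.
have e10 : 0 < e1 by rewrite ee1 !mulr_gt0// exprn_gt0.
have e20 : 0 < e2 by rewrite ee2 !mulr_gt0// exprn_gt0.
have G0 : 0 <= G by rewrite eG.
have tw0 : 0 <= twd by rewrite etw.
have e1le : e1 <= 16^-1.
  have : (r * eta) * (x ^+ 3 * (i3 * m)) <= 16^-1 * 1.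
    apply: ler_pM => //; [by rewrite mulr_ge0 ?ltW|by clear -x0 i0 m0; nonneg|].
    by rewrite mulr_ile1 ?exprn_ile1// ?exprn_ge0 ?mulr_ge0 ?ltW.
  by rewrite ee1; clear; lra.
have q1 : nu * (2 * (L * N)) <= nu * dn by rewrite ler_pM2l.
have e1' : nu * (2 * (L * N)) = i3 * (2 * (L / m) * N) by rewrite enu; ring.
have q2 : nu * (e1 * g * dtw) <= nu * (e1 * G) * (2 * L * twd + N / 2 + S / 4).
  have -> : nu * (e1 * g * dtw) = (nu * e1) * (g * dtw) by ring.
  have -> : nu * (e1 * G) * (2 * L * twd + N / 2 + S / 4) =
     (nu * e1) * (G * (2 * L * twd + N / 2 + S / 4)) by ring.
  rewrite ler_pM2l ?mulr_gt0//; apply: le_trans (ler_norm _) _.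
  rewrite normrM -eG ler_wpM2l//.
  have -> : dtw = 2 * L * tw + (dtw - 2 * L * tw) by ring.
  apply: le_trans (ler_normD _ _) _.
  have -> : `|2 * L * tw| = 2 * L * twd by rewrite normrM -etw ger0_norm// mulr_ge0// ltW.
  by rewrite -addrA lerD2l.
have q3 : - (nu * (e2 * dwl)) <= i3 * (- (eta * x ^+ 4 * L * s) + eta * x ^+ 4 * (S / L)).
  have -> : nu * (e2 * dwl) = (i3 * (eta * x ^+ 4)) * dwl.
    by rewrite enu ee2; clear -m0; field; rewrite gt_eqF.
  have p0 : 0 <= i3 * (eta * x ^+ 4) by clear -i0 e0 x0; nonneg.
  by have := ler_wpM2l p0 hdwl; clear; lra.
have q4 : - (gm * tw) <= 3 * r * eta * x ^+ 2 / n * i3 * L * twd.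
  apply: le_trans (ler_norm _) _; rewrite normrN normrM -etw.
  by rewrite ler_wpM2r.
have q5 : de2 * wl <= i3 * (4 * eta * m * x ^+ 3) * (s + ib * (N / L) + S / (2 * L)).
  by apply: ler_pM.
have q6 : i3 * (c * x ^+ 3) * ph <=
   i3 * (c * x ^+ 3) * (2 * ib * N + 2 * (e2 * (s + ib * (N / L) + S / (2 * L)))).
  apply: ler_wpM2l; first by clear -i0 c0 x0; nonneg.
  by apply: le_trans hph _; rewrite lerD2l ler_pM2l// ler_pM2l.
have q7 := ler_wpM2r N0 hcs.
have q8 : nu * (e1 * G) * (2 * L * twd) + 3 * r * eta * x ^+ 2 / n * i3 * L * twd <=
   i3 * (5 * r * eta * x ^+ 2 / (kap * n) * L * twd).
  have p0 : 0 <= nu * (2 * L * twd) by clear -nu0 L0 tw0; nonneg.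
  have h1 := ler_wpM2l p0 Ginv.
  have h2 : nu * (2 * L * twd) * (r * eta * x ^+ 2 * n / kap) =
     2 * (i3 * (r * eta * x ^+ 2 / (kap * n) * L * twd)).
    by rewrite enu em; clear -n0 k0; field; rewrite !gt_eqF.
  have h3 : 3 * r * eta * x ^+ 2 / n * i3 * L * twd =
     kap * (3 * (i3 * (r * eta * x ^+ 2 / (kap * n) * L * twd))).
    by clear -n0 k0; field; rewrite !gt_eqF.
  have p1 : 0 <= 3 * (i3 * (r * eta * x ^+ 2 / (kap * n) * L * twd)).
    by clear -i0 r0 e0 x0 k0 n0 L0 tw0; nonneg.
  have h4 := ler_wpM2r p1 k1.
  by rewrite h3; rewrite h2 in h1; clear -h1 h4; lra.
have q9 : nu * (e1 * G) * (N / 2) + nu * (e1 * L) * N <= i3 * (3 / 32 * (L / m) * N).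
  have p0 : 0 <= nu * L * N by clear -nu0 L0 N0; nonneg.
  have h1 := ler_wpM2l p0 e1le.
  have p1 : 0 <= nu * e1 * N by clear -nu0 e10 N0; nonneg.
  have h2 := ler_wpM2l p1 GL.
  have -> : i3 * (3 / 32 * (L / m) * N) = 3 / 32 * (nu * L * N) by rewrite enu; ring.
  by clear -h1 h2; lra.
have q10 : i3 * (eta * x ^+ 4 * (N / L)) <= i3 * (eta * x ^+ 3 * m * (N / L)).
  have p0 : 0 <= i3 * (eta * x ^+ 3 * (N / L)) by clear -i0 e0 x0 N0 L0; nonneg.
  have xm : x <= m by apply: le_trans x1 _; rewrite em exprn_ege1.
  by have := ler_wpM2l p0 xm; clear; lra.
have eS : S / (2 * L) = 2^-1 * (S / L) by clear -L0; field; rewrite gt_eqF.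
rewrite eS in q5 q6.
have ee : - A * e1 * (d * s + W / 2 * N) =
   i3 * (- A * (r * eta * x ^+ 3 * m) * (d * s + W / 2 * N)) by rewrite ee1; ring.
rewrite ee; move: q5 q6 q7 q9 q8 q4 q3 q2 q1 q10; rewrite ecl e1' ee2.
by clear; lra.
Qed.

End Bookkeeping.

Section LocalDecay.
Context {R : rcfType}.
Implicit Types (a ib n kap eta r M Q c x : R) (X Y : int -> R) (l : int).

(** The transport of the energy and of [well] is a divergence, and that of the
    escape term is one up to its gains. The dissipation leaves errors at the two
    neighbours of l, which [subdiv_shift] brings back to l, and [hardy] supplies the
    control of |q|^2 that is missing near l = 0. *)
Lemma local_decay a ib n kap eta r M Q c : admissible a ib n kap eta r M Q c ->
  exists2 K, 0 <= K &
  forall x A X Y (dG : int -> R) de2, 0 < x -> x <= 1 -> 2^-1 * a <= A -> A <= a ->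
  (forall l, `|dG l| <= 3 * r * eta * x ^+ 2 / n * (n ^+ 3)^-1 * `|l%:~R|) ->
  0 <= de2 -> de2 <= (n ^+ 3)^-1 * (4 * eta * n ^+ 2 * x ^+ 3) ->
  subdiv K (nrm X Y) (fun l =>
    ddensity (bsym a) (esc (sg n kap x)) dG (twist_coef n eta r x) (well_coef n eta x) de2 X Y
      (fieldX a (n ^+ 5)^-1 A X Y) (fieldY a (n ^+ 5)^-1 A X Y) l
    + (n ^+ 3)^-1 * (c * x ^+ 3) * phi a n kap eta r x X Y l).
Proof.
move=> ad; have [a1 hib n1 k0 k1 e0 c0 cib Q17 MQ rM rQ rib hk re] := ad.
have [[ib1 Q0 M0 r0] [kle ele cle n0 cle2]] := parameter_signs ad.
set m := n ^+ 2; set i3 := (n ^+ 3)^-1; set nu := (n ^+ 5)^-1.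
have m1 : 1 <= m by rewrite /m exprn_ege1.
have m0 : 0 < m := lt_le_trans ltr01 m1.
have i0 : 0 < i3 by rewrite invr_gt0 exprn_gt0.
have im : i3 * m <= 1.
  by rewrite /i3 /m mulrC ler_pdivrMr ?exprn_gt0// mul1r ler_weXn2l.
have enu : nu = i3 / m by rewrite /nu /i3 /m; clear -n0; field; rewrite gt_eqF.
have nu0 : 0 < nu by rewrite invr_gt0 exprn_gt0.
have nu1 : nu <= 1 by rewrite invf_le1 ?exprn_gt0// exprn_ege1.
have i31 : i3 <= 1 by rewrite invf_le1 ?exprn_gt0// exprn_ege1.
have a0 : 0 < a := lt_trans ltr01 a1.
pose B1 := r * eta * n / kap; pose B2 := eta * m.
pose B3 := B1 + (eta + 2 * eta * m + c * (eta * m)).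
have B10 : 0 <= B1 by rewrite /B1; clear -r0 e0 n0 k0; nonneg.
have B20 : 0 <= B2 by rewrite /B2; clear -e0 m0; nonneg.
have B30 : 0 <= B3 by rewrite /B3; clear -B10 e0 m0 c0; nonneg.
exists (a * 1 + a * (2 * B1) + a * B2 * 4 + 2 * B3 + 4^-1 * M * eta * 1 * 16).
  by clear -a0 B10 B20 B30 M0 e0; nonneg.
move=> x A X Y dG de2 x0 x1 A2 Aa hdG de0 hde.
set e1 := twist_coef n eta r x; set e2 := well_coef n eta x; set G := esc (sg n kap x); set b := bsym a.
have b01 l : 0 <= b l <= 1.
  by apply/andP; split; [exact: bsym_ge0 (ltW a1)|exact: bsym_le1].
have s0 : 0 < sg n kap x by rewrite divr_gt0 ?mulr_gt0.
have e10 : 0 < e1 by rewrite /e1 /twist_coef divr_gt0// !mulr_gt0// exprn_gt0.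
have e20 : 0 < e2 by rewrite /e2 /well_coef !mulr_gt0// exprn_gt0.
have A0 : 0 <= A by clear -A2 a0; lra.
have xk k : x ^+ k <= 1 by apply: exprn_ile1 => //; exact: ltW.
have L1 l : 1 <= lam a l.
  by apply: le_trans (ltW a1) (lam_gea _ (ltW a0)).
have L0 l : 0 < lam a l := lt_le_trans ltr01 (L1 l).
have eG l : e1 * `|G l| <= r * eta * x ^+ 2 * n / kap := twist_coef_esc_le l ad x0.
have eGB l : e1 * `|G l| <= B1.
  apply: le_trans (eG l) _; rewrite /B1.
  have p0 : 0 <= r * eta * n / kap by clear -r0 e0 n0 k0; nonneg.
  by have := ler_wpM2l p0 (xk 2%N); clear; lra.
have GL l : `|G l| <= lam a l by apply: le_trans (esc_le _ (ltW s0)) (lam_gel _ _).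
pose w := eta * x ^+ 4 + 2 * eta * m * x ^+ 3 + c * x ^+ 3 * e2.
pose cl l := nu * (e1 * `|G l|) / 4 + i3 * w / lam a l.
have w0 : 0 <= w by rewrite /w; clear -e0 m0 x0 c0 e20; nonneg.
have wB : w <= eta + 2 * eta * m + c * (eta * m).
  rewrite /w; have h1 := ler_wpM2l (ltW e0) (xk 4%N).
  have p1 : 0 <= 2 * eta * m by clear -e0 m0; nonneg.
  have h2 := ler_wpM2l p1 (xk 3%N).
  have h3 : c * x ^+ 3 * e2 <= c * (eta * m).
    have -> : c * x ^+ 3 * e2 = c * (eta * m) * x ^+ 7 by rewrite /e2 /well_coef /m; ring.
    by rewrite ler_piMr// mulr_ge0// mulr_ge0// ltW.
  by clear -h1 h2 h3; lra.
have clB l : `|cl l| <= B3.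
  rewrite ger0_norm; last first.
    by rewrite /cl; have := L0 l; have := normr_ge0 (G l); clear -nu0 e10 i0 w0 => *; nonneg.
  have h1 : nu * (e1 * `|G l|) <= 1 * B1.
    by apply: ler_pM => //; [exact: ltW|rewrite mulr_ge0// ltW].
  have h2 : i3 * w / lam a l <= w.
    by rewrite ler_pdivrMr// mulrC ler_wpM2l// (le_trans i31).
  by rewrite /cl /B3; clear -h1 h2 wB B10; lra.
(* The divergences: of the energy, of the escape term, of [well], the shift of
   the neighbouring masses to l, and the Hardy inequality. *)
pose F1 l := A * (current X Y l - current X Y (l - 1)).
pose F2 l := - (A * e1 * (twist_flux b G X Y (l + 1) - twist_flux b G X Y l)).
pose F3 l := A * e2 * (well_flux b X Y (l + 1) - well_flux b X Y l).
pose F4 l := cl l * (nrm X Y (l - 1) + nrm X Y (l + 1)) - (cl (l - 1) + cl (l + 1)) * nrm X Y l.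
pose mu := 4^-1 * M * eta * (i3 * x ^+ 3 * m).
pose F5 l := mu * (hweight (8 * a) l%:~R * nrm X Y l - 4 * snrm X Y l).
have nb l : 0 <= nbh (nrm X Y) l.
  by apply: le_trans (nrm_ge0 X Y l) _; have [] := nbh_ge X Y l.
have D1 : subdiv (a * 1) (nrm X Y) F1.
  apply: (@subdivE _ _ _ _ (fun l => A * current X Y (l - 1))) => l.
    rewrite -mulrA; apply: norm_coef_le; first by rewrite ger0_norm.
    have [_ n2 n3 _ _] := nbh_ge X Y l; have := current_le X Y (l - 1).
    by rewrite shiftE mul1r; clear -n2 n3; lra.
  by rewrite shiftE /F1 mulrBr.
have D2 : subdiv (a * (2 * B1)) (nrm X Y) F2.
  apply: (@subdivE _ _ _ _ (fun l => - (A * (e1 * twist_flux b G X Y l)))) => l.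
    rewrite normrN -[leRHS]mulrA; apply: norm_coef_le; first by rewrite ger0_norm.
    have -> : e1 * twist_flux b G X Y l = twist_flux b (fun l => e1 * G l) X Y l.
      by rewrite /twist_flux; ring.
    by apply: twist_flux_le => // j; rewrite normrM (gtr0_norm e10).
  by rewrite /F2; ring.
have D3 : subdiv (a * B2 * 4) (nrm X Y) F3.
  apply: (@subdivE _ _ _ _ (fun l => A * e2 * well_flux b X Y l)) => l.
    rewrite -[leRHS]mulrA; apply: norm_coef_le; last exact: well_flux_le.
    rewrite (ger0_norm (mulr_ge0 A0 (ltW e20))); apply: ler_pM => //; first exact: ltW.
    by rewrite /e2 /well_coef /B2 ler_piMr// ltW// mulr_gt0.
  by rewrite -mulrBr.
have D4 : subdiv (2 * B3) (nrm X Y) F4 by exact: subdiv_shift.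
have D5 : subdiv (4^-1 * M * eta * 1 * 16) (nrm X Y) F5.
  have K8 : 8 <= 8 * a by clear -a1; lra.
  have mu0 : 0 <= mu by rewrite /mu; clear -M0 e0 i0 x0 m0; nonneg.
  have [f fb fd] := subdivZ mu0 (hardy X Y K8); exists f => // l.
  apply: le_trans (fb l) _; rewrite ler_wpM2r// ler_wpM2r//.
  rewrite /mu ler_wpM2l//; first by clear -M0 e0; nonneg.
  have -> : i3 * x ^+ 3 * m = x ^+ 3 * (i3 * m) by ring.
  by rewrite mulr_ile1// ?exprn_ge0 ?mulr_ge0 ?ltW.
apply: subdiv_le (subdivD (subdivD (subdivD (subdivD D1 D2) D3) D4) D5) => l.
rewrite ddensity_field ?gt_eqF ?bsym_gt0//.
have Ll := L0 l; have N0 := nrm_ge0 X Y l; have sn0 := snrm_ge0 X Y l.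
have S0 : 0 <= nrm X Y (l - 1) + nrm X Y (l + 1) by rewrite addr_ge0// nrm_ge0.
pose d := b l * ((G (l + 1) - G (l - 1)) / 2).
have hcs : cl (l - 1) + cl (l + 1) <= nu * (e1 * lam a l) + 4 * (i3 * w / lam a l).
  have gm : `|G (l - 1)| <= 2 * lam a l := le_trans (GL _) (lam_le2m l (ltW a1)).
  have gp : `|G (l + 1)| <= 2 * lam a l := le_trans (GL _) (lam_le2 l (ltW a1)).
  have ne : 0 <= nu * e1 by rewrite mulr_ge0 ?ltW.
  have h1 := ler_wpM2l ne gm; have h2 := ler_wpM2l ne gp.
  have h3 : (lam a (l - 1))^-1 <= 2 / lam a l.
    rewrite ler_pdivlMr// mulrC ler_pdivrMr//.
    by have := lam_le2 (l - 1) (ltW a1); rewrite subrK.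
  have h4 : (lam a (l + 1))^-1 <= 2 / lam a l.
    rewrite ler_pdivlMr// mulrC ler_pdivrMr//.
    by have := lam_le2m (l + 1) (ltW a1); rewrite addrK.
  have iw : 0 <= i3 * w by rewrite mulr_ge0// ltW.
  have h5 := ler_wpM2l iw h3; have h6 := ler_wpM2l iw h4.
  by rewrite /cl; clear -h1 h2 h5 h6; lra.
set LX : int -> R := fun l => lam a l * X l; set LY : int -> R := fun l => lam a l * Y l.
have hdn : 2 * (lam a l * nrm X Y l) <= (b l)^-1 * dnrm X Y LX LY l.
  have -> : dnrm X Y LX LY l = 2 * (lam a l * nrm X Y l).
    by rewrite /dnrm /nrm /LX /LY; ring.
  rewrite ler_peMl ?mulr_ge0// ?invf_ge1 ?bsym_gt0 ?bsym_le1//; exact: ltW.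
have hwl := well_le a1 X Y (hib l); have hwl0 := le_trans sn0 (well_ge a1 X Y l).
have hgm : `|dG l| <= 3 * r * eta * x ^+ 2 / n * i3 * lam a l.
  apply: le_trans (hdG l) _; rewrite ler_wpM2l ?lam_gel//.
  by clear -r0 e0 n0 x0 i0; nonneg.
have key := @collect_terms R i3 nu e1 e2 de2 (dG l) (G l) `|G l| (nrm X Y l) (snrm X Y l)
  (nrm X Y (l - 1) + nrm X Y (l + 1)) (lam a l) m n x ib kap eta r c A d (Wpot b G l)
  `|twist X Y l| ((b l)^-1 * dnrm X Y LX LY l) (dtwist X Y LX LY l)
  (dwell b X Y LX LY l) (twist X Y l) (well b X Y l) (phi a n kap eta r x X Y l)
  (cl l) (cl (l - 1) + cl (l + 1)) i0 im n0 erefl enu.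
have ee1 : e1 = i3 * (r * eta * x ^+ 3 * m).
  by rewrite /e1 /twist_coef /i3 /m; clear -n0; field; rewrite gt_eqF.
have {}key := key ee1 erefl Ll (L1 l) N0 sn0 S0 r0 e0 x0 x1 k0 kle n1 re c0
  (le_trans ler01 ib1) erefl (eG l) (GL l) hdn (diss_twist a X Y l) (diss_well a1 X Y l)
  hwl hwl0 erefl hgm de0 hde (phi_le X Y l ad (ltW x0)) erefl hcs.
have ht th (th0 : 0 < th) := twist_le X Y l th0.
have [htau _] := young_tau Ll x0 n0 k0 e0 r0 hk sn0 ht.
have hpot := potential_key l (ltW a1) Q0 MQ rM rQ k0 kle e0 re m1 x0 x1 A2 Aa.
have hkin : (6 + M) * eta * x ^+ 3 * m <=
    2^-1 * eta * x ^+ 4 * lam a l + r * eta * x ^+ 3 * m * A * d.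
  have [sl0 sl9] := @esc_slope _ (sg n kap x) l (ltW s0).
  have ibV : ib^-1 <= b l by rewrite -[b l]invrK lef_pV2 ?posrE ?invr_gt0 ?bsym_gt0// (lt_le_trans ltr01).
  have b0 : 0 < b l := bsym_gt0 l a1.
  apply: (@kinetic_key R a ib^-1 M r kap eta m x A (lam a l) `|l%:~R| d) => //.
  - exact: ltW.
  - by rewrite invr_gt0 (lt_le_trans ltr01).
  - exact: lam_gel.
  - by rewrite /d mulr_ge0// ?divr_ge0// ltW.
  - move=> sy; have sg1 : sg n kap x <= 1.
      rewrite /sg ler_pdivrMr// mul1r; apply: le_trans m1.
      by apply: mulr_ile1 => //; exact: ltW.
    rewrite /d; have h9 := sl9 sg1 sy.
    by apply: ler_pM => //; rewrite invr_ge0// (le_trans ler01 ib1).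
have fc := pointwise_balance N0 sn0 Ll m1 (ltW x0) x1 e0 ele c0 cib
  (le_trans cle2 (le_trans ele _)) ib1 Q17 hpot hkin htau.
have {}fc := ler_wpM2l (ltW i0) (fc ltac:(clear; lra)).
have e5 : i3 * (4^-1 * M * eta * x ^+ 3 * m *
   (hweight (8 * a) l%:~R * nrm X Y l - 4 * snrm X Y l)) = F5 l by rewrite /F5 /mu; ring.
rewrite e5 in fc; have {fc}key := le_trans key fc.
rewrite /F1 /F2 /F3 /F4; move: key; rewrite -/b -/LX -/LY -/d; clear.
move: (F5 l) => f5.
set t1 := nrm X Y (l - 1) + _; clear.
move: (A * (current _ _ _ - _)) => u1; move: (twist_flux _ _ _ _ (l + 1) - _) => u2.
move: (A * e2 * _) => u3; lra.
Qed.

End LocalDecay.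

(** * Sums over boxes and integration in time *)

Section Boxes.
Context {R : realFieldType}.
Implicit Types (F f n : int -> R) (M N : nat).

Fixpoint box M : seq int :=
  if M is M'.+1 then [:: Posz M, - Posz M & box M'] else [:: 0].

Lemma mem_box M (l : int) : (l \in box M) = (`|l| <= M)%N.
Proof.
elim: M => [|M IH]; first by rewrite inE leqn0 absz_eq0.
by rewrite /= !inE IH; lia.
Qed.

Lemma uniq_box M : uniq (box M).
Proof.
elim: M => //= M IH; rewrite inE !mem_box IH andbT.
by apply/andP; split; lia.
Qed.

Lemma ler_sum_uniq (T : eqType) (s t : seq T) (F : T -> R) : uniq s -> uniq t ->
  {subset s <= t} -> (forall i, 0 <= F i) -> \sum_(i <- s) F i <= \sum_(i <- t) F i.
Proof.
move=> us ut st F0; rewrite [leRHS](bigID (mem s))/=.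
have -> : \sum_(i <- t | i \in s) F i = \sum_(i <- s) F i.
  rewrite -big_filter; apply: perm_big; apply: uniq_perm => //.
    exact: filter_uniq.
  by move=> i; rewrite mem_filter andb_idr//; exact: st.
by rewrite lerDl sumr_ge0.
Qed.

Lemma sum_box_le M N F : (forall l, 0 <= F l) -> (M <= N)%N ->
  \sum_(l <- box M) F l <= \sum_(l <- box N) F l.
Proof.
move=> F0 MN; apply: ler_sum_uniq => //; try exact: uniq_box.
by move=> l; rewrite !mem_box => /leq_trans; apply.
Qed.

Lemma sum_uniq_le_box (s : seq int) F (S : R) : uniq s -> (forall l, 0 <= F l) ->
  (forall M, \sum_(l <- box M) F l <= S) -> \sum_(l <- s) F l <= S.
Proof.
move=> us F0 hS; pose M := \max_(l <- s) `|l|%N.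
apply: le_trans (hS M); apply: ler_sum_uniq => //; first exact: uniq_box.
move=> l ls; rewrite mem_box /M (big_rem l)//=; exact: leq_maxl.
Qed.

Lemma sum_shift_le (c : int) F (S : R) N : (forall l, 0 <= F l) ->
  (forall M, \sum_(l <- box M) F l <= S) ->
  \sum_(i < N) F (Posz i + c) <= S /\ \sum_(i < N) F (- Posz i + c) <= S.
Proof.
move=> F0 hS; have e (g : nat -> int) : injective g -> \sum_(i < N) F (g i) <= S.
  move=> gi; rewrite -(big_mkord xpredT (fun i => F (g i))) -(big_map g xpredT F).
  by apply: sum_uniq_le_box => //; rewrite map_inj_uniq// iota_uniq.
by split; [apply: (e (fun i => Posz i + c))|apply: (e (fun i => - Posz i + c))] => i j; lia.
Qed.

Lemma telescope_box f M :
  \sum_(l <- box M) (f (l + 1) - f l) = f (Posz M + 1) - f (- Posz M).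
Proof.
elim: M => [|M IH]; first by rewrite /= big_seq1 oppr0.
rewrite /= !big_cons IH.
have -> : - Posz M.+1 + 1 = - Posz M by lia.
have -> : Posz M + 1 = Posz M.+1 by lia.
by ring.
Qed.

(** The flux through the boundary of one box has no sign. But different boxes
    have disjoint boundaries, so that the total over all boxes of size less than N
    is bounded independently of N. *)
Lemma cesaro_flux K n F (S : R) N : 0 <= K -> (forall l, 0 <= n l) ->
  (forall M, \sum_(l <- box M) n l <= S) -> subdiv K n F ->
  \sum_(M < N) \sum_(l <- box M) F l <= K * (10 * S).
Proof.
move=> K0 n0 hS [f fb fd].
have nb0 l : 0 <= nbh n l by rewrite /nbh !addr_ge0.
have h1 : \sum_(M < N) \sum_(l <- box M) F l <=
    \sum_(M < N) (K * nbh n (Posz M + 1) + K * nbh n (- Posz M)).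
  apply: ler_sum => M _; apply: (@le_trans _ _ (\sum_(l <- box M) (f (l + 1) - f l))).
    by apply: ler_sum => l _.
  rewrite telescope_box; apply: le_trans (ler_norm _) _.
  by apply: le_trans (ler_normB _ _) _; apply: lerD.
apply: le_trans h1 _; rewrite big_split/= -!mulr_sumr -mulrDr ler_wpM2l//.
have sh c : \sum_(i < N) n (Posz i + c) <= S /\ \sum_(i < N) n (- Posz i + c) <= S.
  exact: sum_shift_le.
have e1 : \sum_(i < N) nbh n (Posz i + 1) <= 5 * S.
  rewrite /nbh !big_split/=.
  under eq_bigr do rewrite -addrA. under [X in _ + X + _ + _ + _]eq_bigr do rewrite -addrA.
  under [X in _ + _ + X]eq_bigr do rewrite -addrA.
  under [X in _ + X + _]eq_bigr do rewrite -addrA.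
  have := (sh (1 - 2)).1; have := (sh (1 - 1)).1; have := (sh 1).1.
  have := (sh (1 + 1)).1; have := (sh (1 + 2)).1.
  by move=> *; lra.
have e2 : \sum_(i < N) nbh n (- Posz i) <= 5 * S.
  rewrite /nbh !big_split/=.
  have s0 : \sum_(i < N) n (- Posz i) <= S.
    by have := (sh 0).2; under eq_bigr do rewrite addr0.
  have := (sh (- 2)).2; have := (sh (- 1)).2; have := (sh 1).2; have := (sh 2).2.
  by move=> *; lra.
lra.
Qed.

End Boxes.

Section Time.
Context {R : realType}.

Lemma is_derive_bigsum (T : Type) (s : seq T) (f : T -> R -> R) (df : T -> R) (t : R) :
  (forall i, is_derive t (1 : R) (f i) (df i)) ->
  is_derive t (1 : R) (fun x => \sum_(i <- s) f i x) (\sum_(i <- s) df i).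
Proof.
move=> h; elim: s => [|i s IH].
  rewrite big_nil (_ : (fun x => _) = cst 0); first exact: is_derive_cst.
  by apply/funext => x; rewrite big_nil.
rewrite big_cons (_ : (fun x => _) = f i \+ (fun x => \sum_(i <- s) f i x)).
  exact: is_deriveD.
by apply/funext => x; rewrite big_cons.
Qed.

Lemma within_continuous_bigsum (T : Type) (s : seq T) (f : T -> R -> R) (A : set R) :
  (forall i, {within A, continuous (f i)}) ->
  {within A, continuous (fun x => \sum_(i <- s) f i x)}.
Proof.
move=> h; elim: s => [|i s IH].
  rewrite (_ : (fun x => _) = cst 0); first by move=> ?; exact: cvg_cst.
  by apply/funext => x; rewrite big_nil.
rewrite (_ : (fun x => _) = f i \+ (fun x => \sum_(i <- s) f i x)).
  by move=> x; apply: cvgD; [exact: h|exact: IH].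
by apply/funext => x; rewrite big_cons.
Qed.

(** Integrate in time the sums over all boxes of size less than N: the boundary
    contributions stay bounded, whereas a gap between the sum over a fixed box and B
    would be counted about N times. *)
Lemma integrate_flux (T S B K : R) (phi dphi n : R -> int -> R) :
  0 < T -> 0 <= K ->
  (forall l, {within `[0, T], continuous (phi^~ l)}) ->
  (forall t l, 0 < t < T -> is_derive t 1 (phi^~ l) (dphi t l)) ->
  (forall t l, 0 <= n t l) ->
  (forall t M, 0 < t < T -> \sum_(l <- box M) n t l <= S) ->
  (forall t, 0 < t < T -> subdiv K (n t) (dphi t)) ->
  (forall l, 0 <= phi 0 l) -> (forall l, 0 <= phi T l) ->
  (forall M, \sum_(l <- box M) phi 0 l <= B) ->
  forall M, \sum_(l <- box M) phi T l <= B.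
Proof.
move=> T0 K0 cphi dphiE n0 nS sd p0 pT hB M.
pose g N t := \sum_(M <- iota 0 N) \sum_(l <- box M) phi t l.
pose dg N t := \sum_(M <- iota 0 N) \sum_(l <- box M) dphi t l.
pose C := K * (10 * S) * T.
have bound N : g N T <= g N 0 + C.
  have [c /[!in_itv]/= cT e] : exists2 c, c \in `]0, T[%R & g N T - g N 0 = dg N c * (T - 0).
    apply: MVT => // [x /[!in_itv]/= xT|].
      by apply: is_derive_bigsum => M'; apply: is_derive_bigsum => l; exact: dphiE.
    by apply: within_continuous_bigsum => M'; exact: within_continuous_bigsum.
  have : dg N c <= K * (10 * S).
    rewrite /dg -[N in iota 0 N]subn0 -/(index_iota 0 N) big_mkord.
    by apply: cesaro_flux (n0 c) (fun M' => nS c M' cT) (sd c cT).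
  move=> /(ler_wpM2r (ltW T0)); rewrite subr0 in e; rewrite /C => h.
  by move: e h; lra.
have low N : (N%:R - M%:R) * \sum_(l <- box M) phi T l <= N%:R * B + C.
  have h0 : g N 0 <= N%:R * B.
    rewrite /g -[N in iota 0 N]subn0 -/(index_iota 0 N) big_mkord.
    apply: (@le_trans _ _ (\sum_(i < N) B)); first by apply: ler_sum => i _; exact: hB.
    by rewrite sumr_const card_ord mulr_natl.
  apply: (@le_trans _ _ (g N T)); last by have := bound N; move: h0; lra.
  have sM : 0 <= \sum_(l <- box M) phi T l by apply: sumr_ge0.
  have [NM|MN] := leqP N M.
    apply: (@le_trans _ _ 0).
      by rewrite mulr_le0_ge0// subr_le0 ler_nat.
    by rewrite /g; do 2![apply: sumr_ge0 => ? _].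
  rewrite /g -(subnKC (ltnW MN)) iotaD big_cat/= natrD addrAC subrr add0r.
  apply: (@le_trans _ _ (\sum_(i <- iota (0 + M) (N - M)) \sum_(l <- box M) phi T l)).
    by rewrite big_const_seq count_predT size_iota iter_addr addr0 mulr_natl.
  apply: (@le_trans _ _ (\sum_(i <- iota (0 + M) (N - M)) \sum_(l <- box i) phi T l)).
    rewrite big_seq [leRHS]big_seq; apply: ler_sum => i; rewrite mem_iota => /andP[Mi _].
    by apply: sum_box_le.
  by rewrite lerDr; do 2![apply: sumr_ge0 => ? _].
rewrite leNgt; apply/negP => hlt.
set beta := \sum_(l <- box M) phi T l in low hlt.
(* from this N on, N - M copies of the gap beat the boundary terms *)
pose N := (Num.truncn ((`|C| + M%:R * `|beta|) / (beta - B))).+1.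
have hN : (`|C| + M%:R * `|beta|) / (beta - B) < N%:R by apply: truncnS_gt.
rewrite ltr_pdivrMr ?subr_gt0// in hN.
have := low N; have := ler_norm C.
have := ler_wpM2l (ler0n R M) (ler_norm beta).
by move: hN; lra.
Qed.

End Time.

(** * Weights depending on time *)

Section Derivatives.
Context {R : realType}.
Implicit Types (f g : R -> R) (t df dg : R).

Lemma derD f g t df dg : is_derive t (1:R) f df -> is_derive t (1:R) g dg ->
  is_derive t (1:R) (fun s => f s + g s) (df + dg).
Proof. by move=> ? ?; apply: is_deriveD. Qed.

Lemma derB f g t df dg : is_derive t (1:R) f df -> is_derive t (1:R) g dg ->
  is_derive t (1:R) (fun s => f s - g s) (df - dg).
Proof. by move=> ? ?; apply: is_deriveB. Qed.

Lemma derM f g t df dg : is_derive t (1:R) f df -> is_derive t (1:R) g dg ->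
  is_derive t (1:R) (fun s => f s * g s) (df * g t + f t * dg).
Proof.
move=> hf hg; have h : is_derive t (1:R) (f * g) (f t *: dg + g t *: df).
  exact: is_deriveM.
by apply: (is_derive_eq h); rewrite /GRing.scale/= addrC mulrC.
Qed.

Lemma der_cst (c : R) t : is_derive t (1:R) (fun=> c) 0.
Proof. exact: is_derive_cst. Qed.

Lemma derX f t df n : is_derive t (1:R) f df ->
  is_derive t (1:R) (fun s => f s ^+ n.+1) (n.+1%:R * f t ^+ n * df).
Proof.
move=> hf; elim: n => [|n IH].
  by apply: (is_derive_eq hf); rewrite expr0 !mul1r.
rewrite (_ : (fun s => f s ^+ n.+2) = (fun s => f s * f s ^+ n.+1)); last first.
  by apply/funext => s; rewrite exprS.
apply: (is_derive_eq (derM hf IH)).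
by rewrite -[n.+2]addn1 natrD exprS; ring.
Qed.

Lemma derV f t df : is_derive t (1:R) f df -> f t != 0 ->
  is_derive t (1:R) (fun s => (f s)^-1) (- df / f t ^+ 2).
Proof.
move=> hf f0; have d := @ex_derive _ _ _ _ _ _ _ hf.
apply: DeriveDef; first exact: derivableV.
by rewrite deriveV// derive_val /GRing.scale/= mulNr mulrC -mulNr.
Qed.

End Derivatives.

Section Ramp.
Context {R : realType}.
Implicit Types (a n kap eta r t tsc : R) (l : int).

(** Time measured in units of [tsc] and saturating at 1. *)
Definition ramp tsc t : R := t / (tsc + t).

Definition dramp tsc t : R := tsc / (tsc + t) ^+ 2.

Lemma ramp_derive tsc t : 0 < tsc -> 0 <= t -> is_derive t (1:R) (ramp tsc) (dramp tsc t).
Proof.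
move=> tsc0 t0; have Tt : tsc + t != 0 by rewrite gt_eqF// ltr_pwDl.
have h : is_derive t (1:R) (fun s => tsc + s) 1.
  by apply: (is_derive_eq (derD (der_cst tsc t) (is_derive_id t (1:R)))); rewrite add0r.
apply: (is_derive_eq (derM (is_derive_id t (1:R)) (derV h Tt))).
by rewrite /dramp; field.
Qed.

Lemma ramp_bounds tsc t : 0 < tsc -> 0 < t -> [/\ 0 < ramp tsc t, ramp tsc t <= 1,
  0 <= dramp tsc t, dramp tsc t <= tsc^-1 & t * dramp tsc t <= ramp tsc t].
Proof.
move=> tsc0 t0; have Tt : 0 < tsc + t by rewrite addr_gt0.
split.
- by rewrite divr_gt0.
- by rewrite ler_pdivrMr// mul1r lerDr ltW.
- by rewrite divr_ge0 ?exprn_ge0// ltW.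
- rewrite /dramp ler_pdivrMr ?exprn_gt0// mulrC ler_pdivlMr// -expr2.
  by rewrite ler_pXn2r// ?nnegrE ?(ltW tsc0) ?(ltW Tt)// lerDl ltW.
- rewrite /ramp /dramp mulrA ler_pdivrMr ?exprn_gt0// expr2 mulrA divfK ?gt_eqF//.
  by rewrite ler_wpM2l ?(ltW t0)// lerDl ltW.
Qed.

(** The time derivative of the weighted escape function, when x moves at speed dx. *)
Definition esc_rate n kap eta r (x dx : R) l : R :=
  r * eta / n * dx * x ^+ 2 *
  (l%:~R * (3 + 2 * (sg n kap x * `|l%:~R|)) / (1 + sg n kap x * `|l%:~R|) ^+ 2).

Lemma esc_rate_le n kap eta r (x dx i3 : R) l : 0 < n -> 0 < r -> 0 < eta -> 0 <= sg n kap x ->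
  0 <= dx -> dx <= i3 ->
  `|esc_rate n kap eta r x dx l| <= 3 * r * eta * x ^+ 2 / n * i3 * `|l%:~R|.
Proof.
move=> n0 r0 e0 s0 d0 di.
have z0 : 0 <= sg n kap x * `|l%:~R| by rewrite mulr_ge0.
rewrite /esc_rate; move: (sg n kap x * _) z0 => z z0.
have D0 : 0 < (1 + z) ^+ 2 by rewrite exprn_gt0//; lra.
have c0 : 0 <= r * eta / n * x ^+ 2 by clear -r0 e0 n0; nonneg.
have -> : `|r * eta / n * dx * x ^+ 2 * (l%:~R * (3 + 2 * z) / (1 + z) ^+ 2)| =
   (r * eta / n * x ^+ 2) * (dx * ((3 + 2 * z) / (1 + z) ^+ 2) * `|l%:~R|).
  rewrite -[RHS]ger0_norm; last first.
    apply: mulr_ge0 => //; apply: mulr_ge0 => //; apply: mulr_ge0 => //.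
    by apply: divr_ge0; [lra|exact: ltW].
  by rewrite !normrM normr_id -!normrM; congr `|_|; ring.
have -> : 3 * r * eta * x ^+ 2 / n * i3 * `|l%:~R| = (r * eta / n * x ^+ 2) * (i3 * 3 * `|l%:~R|).
  by ring.
apply: ler_wpM2l => //; apply: ler_wpM2r => //; apply: ler_pM => //.
  by apply: divr_ge0; [lra|exact: ltW].
rewrite ler_pdivrMr//; have := mulr_ge0 z0 z0; lra.
Qed.

Lemma esc_coef_derive n kap eta r tsc t l : 0 < n -> 0 < kap -> 0 < tsc -> 0 <= t ->
  is_derive t (1:R) (fun s => twist_coef n eta r (ramp tsc s) * esc (sg n kap (ramp tsc s)) l)
    (esc_rate n kap eta r (ramp tsc t) (dramp tsc t) l).
Proof.
move=> n0 k0 tsc0 t0; have hx := ramp_derive tsc0 t0.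
have r0 : 0 <= ramp tsc t by rewrite divr_ge0// addr_ge0// ltW.
have D0 : 1 + (kap * ramp tsc t / n ^+ 2) * `|l%:~R| != 0.
  rewrite gt_eqF// ltr_pwDl// mulr_ge0//; clear -n0 k0 r0; nonneg.
have hs : is_derive t (1:R) (fun s => 1 + (kap * ramp tsc s / n ^+ 2) * `|l%:~R|)
    ((kap * dramp tsc t / n ^+ 2) * `|l%:~R|).
  apply: (is_derive_eq (derD (der_cst 1 t) (derM (derM (derM (der_cst kap t) hx)
     (der_cst (n ^+ 2)^-1 t)) (der_cst `|l%:~R| t)))).
  by rewrite /=; ring.
have h := derM (derM (derM (der_cst (r * eta) t) (derX 2 hx)) (der_cst n^-1 t))
               (derM (der_cst l%:~R t) (derV hs D0)).
apply: (is_derive_eq h); rewrite /esc_rate /sg.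
move: (ramp tsc t) (dramp tsc t) D0 => x dx; move: `|l%:~R| => y D0.
have nz : n != 0 by rewrite gt_eqF.
have D1 : n ^+ 2 + kap * x * y != 0.
  have -> : n ^+ 2 + kap * x * y = n ^+ 2 * (1 + kap * x / n ^+ 2 * y) by field.
  by rewrite mulf_neq0// expf_neq0.
by field; rewrite nz.
Qed.

Lemma phi_derive a n kap eta r tsc t (X Y : R -> int -> R) (U V : int -> R) l :
  0 < n -> 0 < kap -> 0 < tsc -> 0 <= t ->
  (forall l, is_derive t (1:R) (X^~ l) (U l)) -> (forall l, is_derive t (1:R) (Y^~ l) (V l)) ->
  is_derive t (1:R) (fun s => phi a n kap eta r (ramp tsc s) (X s) (Y s) l)
    (ddensity (bsym a) (esc (sg n kap (ramp tsc t))) (esc_rate n kap eta r (ramp tsc t) (dramp tsc t))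
       (twist_coef n eta r (ramp tsc t)) (well_coef n eta (ramp tsc t))
       (4 * eta * n ^+ 2 * ramp tsc t ^+ 3 * dramp tsc t) (X t) (Y t) U V l).
Proof.
move=> n0 k0 tsc0 t0 hX hY; have hx := ramp_derive tsc0 t0.
have hE := esc_coef_derive eta r l n0 k0 tsc0 t0.
have h2 : is_derive t (1:R) (fun s => well_coef n eta (ramp tsc s))
    (4 * eta * n ^+ 2 * ramp tsc t ^+ 3 * dramp tsc t).
  by apply: (is_derive_eq (derM (der_cst (eta * n ^+ 2) t) (derX 3 hx))) => /=; ring.
have hdif (Z : R -> int -> R) W : (forall l, is_derive t (1:R) (Z^~ l) (W l)) ->
    is_derive t (1:R) (fun s => dif (Z s) l) (dif W l).
  move=> hZ; apply: (is_derive_eq (derM (derB (hZ (l - 1)) (hZ (l + 1))) (der_cst 2^-1 t))).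
  by rewrite /dif mulr0 addr0.
have havg (Z : R -> int -> R) W : (forall l, is_derive t (1:R) (Z^~ l) (W l)) ->
    is_derive t (1:R) (fun s => avg (Z s) l) (avg W l).
  move=> hZ; apply: (is_derive_eq (derM (derD (hZ (l - 1)) (hZ (l + 1))) (der_cst 2^-1 t))).
  by rewrite /avg mulr0 addr0.
have hn : is_derive t (1:R) (fun s => nrm (X s) (Y s) l) (dnrm (X t) (Y t) U V l).
  by apply: (is_derive_eq (derD (derX 1 (hX l)) (derX 1 (hY l)))); rewrite /dnrm !expr1; ring.
have hsn : is_derive t (1:R) (fun s => snrm (X s) (Y s) l) (dsnrm (X t) (Y t) U V l).
  apply: (is_derive_eq (derD (derX 1 (hdif _ _ hX)) (derX 1 (hdif _ _ hY)))).
  by rewrite /dsnrm !expr1; ring.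
have hmn : is_derive t (1:R) (fun s => mnrm (X s) (Y s) l) (dmnrm (X t) (Y t) U V l).
  apply: (is_derive_eq (derD (derX 1 (havg _ _ hX)) (derX 1 (havg _ _ hY)))).
  by rewrite /dmnrm !expr1; ring.
have htw : is_derive t (1:R) (fun s => twist (X s) (Y s) l) (dtwist (X t) (Y t) U V l).
  apply: (is_derive_eq (derB (derM (hX l) (hdif _ _ hY)) (derM (hY l) (hdif _ _ hX)))).
  by rewrite /dtwist; ring.
have hw : is_derive t (1:R) (fun s => well (bsym a) (X s) (Y s) l) (dwell (bsym a) (X t) (Y t) U V l).
  apply: (is_derive_eq (derD (derB (derD hsn (derM (der_cst (bsym a l)^-1 t) hn)) hn)
     (derM (der_cst (1 - bsym a l) t) hmn))).
  by rewrite /dwell; ring.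
apply: (is_derive_eq (derD (derB (derM (der_cst (bsym a l)^-1 t) hn) (derM hE htw)) (derM h2 hw))).
by rewrite /ddensity; ring.
Qed.

End Ramp.

(** * Decay of finitely many modes *)

Section Modes.
Context {R : realType}.

Lemma subdiv_cst_le (K1 K2 : R) n1 n2 F : K1 <= K2 -> 0 <= K2 -> (forall l, 0 <= n1 l) ->
  (forall l, n1 l <= n2 l) -> subdiv K1 n1 F -> subdiv K2 n2 F.
Proof.
move=> K12 K20 p n12 [f fb fd]; exists f => // l; apply: le_trans (fb l) _.
have b0 : 0 <= nbh n1 l by rewrite /nbh !addr_ge0.
apply: (@le_trans _ _ (K2 * nbh n1 l)); first exact: ler_wpM2r.
by apply: ler_wpM2l => //; rewrite /nbh !lerD.
Qed.

Lemma subdiv_sum (T : Type) (s : seq T) (K : T -> R) (n F : T -> int -> R) :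
  (forall k, 0 <= K k) -> (forall k l, 0 <= n k l) ->
  (forall k, subdiv (K k) (n k) (F k)) ->
  subdiv (\sum_(k <- s) K k) (fun l => \sum_(k <- s) n k l) (fun l => \sum_(k <- s) F k l).
Proof.
move=> K0 n0 h; elim: s => [|k s IH].
  exists (fun=> 0) => l; last by rewrite big_nil subrr.
  by rewrite normr0 big_nil mul0r.
have sK : 0 <= \sum_(j <- s) K j by apply: sumr_ge0.
have sn l : 0 <= \sum_(j <- s) n j l by apply: sumr_ge0.
have h1 : subdiv (K k) (fun l => \sum_(j <- k :: s) n j l) (F k).
  by apply: (subdiv_cst_le (lexx _) (K0 k) (n0 k) _ (h k)) => l; rewrite big_cons lerDl.
have h2 : subdiv (\sum_(j <- s) K j) (fun l => \sum_(j <- k :: s) n j l)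
    (fun l => \sum_(j <- s) F j l).
  by apply: (subdiv_cst_le (lexx _) sK sn _ IH) => l; rewrite big_cons lerDr.
by rewrite big_cons; apply: subdiv_le (subdivD h1 h2) => l; rewrite big_cons.
Qed.

Lemma within_contD (A : set R) (f g : R -> R) : {within A, continuous f} -> {within A, continuous g} ->
  {within A, continuous (fun s => f s + g s)}.
Proof. by move=> hf hg x; apply: cvgD; [exact: hf|exact: hg]. Qed.

Lemma within_contB (A : set R) (f g : R -> R) : {within A, continuous f} -> {within A, continuous g} ->
  {within A, continuous (fun s => f s - g s)}.
Proof. by move=> hf hg x; apply: cvgB; [exact: hf|exact: hg]. Qed.

Lemma within_contM (A : set R) (f g : R -> R) : {within A, continuous f} -> {within A, continuous g} ->
  {within A, continuous (fun s => f s * g s)}.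
Proof. by move=> hf hg x; apply: cvgM; [exact: hf|exact: hg]. Qed.

Lemma within_cont_cst (A : set R) (c : R) : {within A, continuous (fun=> c)}.
Proof. by move=> x; exact: cvg_cst. Qed.

Lemma within_cont_sqr (A : set R) (f : R -> R) : {within A, continuous f} ->
  {within A, continuous (fun s => f s ^+ 2)}.
Proof. by move=> hf; apply: within_contM. Qed.

Lemma is_derive_within_cont (T : R) (f df : R -> R) :
  (forall s : R, 0 <= s -> is_derive s (1:R) f (df s)) ->
  {within `[0, T], continuous f}.
Proof.
move=> h; apply: derivable_within_continuous => x /[!in_itv]/= /andP[x0 _].
exact: (@ex_derive _ _ _ _ _ _ _ (h x x0)).
Qed.

Lemma phi_continuous a n kap eta r tsc T (X Y : R -> int -> R) l :
  0 < n -> 0 < kap -> 0 < tsc ->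
  (forall l, {within `[0, T], continuous (X^~ l)}) ->
  (forall l, {within `[0, T], continuous (Y^~ l)}) ->
  {within `[0, T], continuous (fun s => phi a n kap eta r (ramp tsc s) (X s) (Y s) l)}.
Proof.
move=> n0 k0 t0 hX hY.
have hE : {within `[0, T], continuous
    (fun s => twist_coef n eta r (ramp tsc s) * esc (sg n kap (ramp tsc s)) l)}.
  by apply: is_derive_within_cont => s s0; exact: esc_coef_derive.
have h2 : {within `[0, T], continuous (fun s => well_coef n eta (ramp tsc s))}.
  apply: is_derive_within_cont => s s0.
  exact: (derM (der_cst (eta * n ^+ 2) s) (derX 3 (ramp_derive t0 s0))).
have hdif (Z : R -> int -> R) : (forall l, {within `[0, T], continuous (Z^~ l)}) ->
    {within `[0, T], continuous (fun s => dif (Z s) l)}.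
  by move=> hZ; apply: within_contM (@within_cont_cst _ _); apply: within_contB.
have havg (Z : R -> int -> R) : (forall l, {within `[0, T], continuous (Z^~ l)}) ->
    {within `[0, T], continuous (fun s => avg (Z s) l)}.
  by move=> hZ; apply: within_contM (@within_cont_cst _ _); apply: within_contD.
have hn : {within `[0, T], continuous (fun s => nrm (X s) (Y s) l)}.
  by apply: within_contD; apply: within_cont_sqr.
have htw : {within `[0, T], continuous (fun s => twist (X s) (Y s) l)}.
  by apply: within_contB; apply: within_contM => //; exact: hdif.
have hsn : {within `[0, T], continuous (fun s => snrm (X s) (Y s) l)}.
  by apply: within_contD; apply: within_cont_sqr; exact: hdif.
have hmn : {within `[0, T], continuous (fun s => mnrm (X s) (Y s) l)}.
  by apply: within_contD; apply: within_cont_sqr; exact: havg.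
apply: within_contD; first by apply: within_contB; apply: within_contM => //; exact: within_cont_cst.
apply: within_contM => //; apply: within_contD; last by apply: within_contM => //; exact: within_cont_cst.
by apply: within_contB => //; apply: within_contD => //; apply: within_contM => //; exact: within_cont_cst.
Qed.

(** The functional is multiplied by the exponential of c/4 n^-3 t x^3. As t x' <= x
    along the ramp, its logarithmic derivative is at most the rate c x^3 n^-3 of
    [local_decay]. At time 0 the functional is the energy. Finitely many modes are
    treated at once because the bounds S and B are known for their sum only. *)
Lemma modes_decay (I : Type) (ks : seq I) (a : I -> R) ib n kap eta r M Q c
    (X Y : I -> R -> int -> R) (tau S B : R) :
  (forall k, admissible (a k) ib n kap eta r M Q c) -> 0 < tau ->
  (forall s : R, 0 < s < tau -> 2^-1 <= expR (- (n ^+ 5)^-1 * s)) ->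
  (forall k (s : R) l, 0 < s < tau -> is_derive s (1:R) (fun s => X k s l)
     (fieldX (a k) (n ^+ 5)^-1 (a k * expR (- (n ^+ 5)^-1 * s)) (X k s) (Y k s) l)) ->
  (forall k (s : R) l, 0 < s < tau -> is_derive s (1:R) (fun s => Y k s l)
     (fieldY (a k) (n ^+ 5)^-1 (a k * expR (- (n ^+ 5)^-1 * s)) (X k s) (Y k s) l)) ->
  (forall k l, {within `[0, tau], continuous (fun s => X k s l)}) ->
  (forall k l, {within `[0, tau], continuous (fun s => Y k s l)}) ->
  (forall (s : R) N, 0 < s < tau ->
    \sum_(l <- box N) \sum_(k <- ks) nrm (X k s) (Y k s) l <= S) ->
  (forall N, \sum_(l <- box N) \sum_(k <- ks)
    (bsym (a k) l)^-1 * nrm (X k 0) (Y k 0) l <= B) ->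
  forall N, \sum_(l <- box N) \sum_(k <- ks) nrm (X k tau) (Y k tau) l <=
    2 * expR (- (c / 4 * (n ^+ 3)^-1 * (tau * ramp (n ^+ 3) tau ^+ 3))) * B.
Proof.
move=> ad tau0 he dX dY cX cY hS hB.
case: ks hS hB => [|k0 ks0] hS hB.
  move=> N; under eq_bigr do rewrite big_nil.
  have := hB 0%N; rewrite big_seq1 big_nil big1// => B0.
  by rewrite mulr_ge0// mulr_ge0// expR_ge0.
set ks := k0 :: ks0 in hS hB *.
have adk := ad k0; have n1 := ad_n adk; have c0 := ad_c adk.
have [[ib1 Q0 M0 r0] [kle ele cle n0 cle2]] := parameter_signs adk.
have kp := ad_kap adk; have e0 := ad_eta adk.
set t0 := n ^+ 3; set nu := (n ^+ 5)^-1.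
have t00 : 0 < t0 by rewrite exprn_gt0.
set i3 := t0^-1; have i30 : 0 < i3 by rewrite invr_gt0.
pose al (s : R) := c / 4 * i3 * (s * ramp t0 s ^+ 3).
pose dal (s : R) := c / 4 * i3 * (ramp t0 s ^+ 3 + s * (3 * ramp t0 s ^+ 2 * dramp t0 s)).
have alE (s : R) : 0 <= s -> is_derive s (1:R) al (dal s).
  move=> s0; apply: (is_derive_eq (derM (der_cst (c / 4 * i3) s)
    (derM (is_derive_id s (1:R)) (derX 2 (ramp_derive t00 s0))))).
  by rewrite /dal mul0r add0r mul1r.
pose P (s : R) l := \sum_(k <- ks) phi (a k) n kap eta r (ramp t0 s) (X k s) (Y k s) l.
pose dP (s : R) l := \sum_(k <- ks)
   ddensity (bsym (a k)) (esc (sg n kap (ramp t0 s))) (esc_rate n kap eta r (ramp t0 s) (dramp t0 s))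
       (twist_coef n eta r (ramp t0 s)) (well_coef n eta (ramp t0 s))
       (4 * eta * n ^+ 2 * ramp t0 s ^+ 3 * dramp t0 s) (X k s) (Y k s)
       (fieldX (a k) nu (a k * expR (- nu * s)) (X k s) (Y k s))
       (fieldY (a k) nu (a k * expR (- nu * s)) (X k s) (Y k s)) l.
have ramp0 (s : R) : 0 <= s -> 0 <= ramp t0 s by move=> s0; rewrite divr_ge0// addr_ge0// ltW.
have Pge (s : R) l : 0 <= s -> 2^-1 * \sum_(k <- ks) nrm (X k s) (Y k s) l <= P s l.
  move=> s0; rewrite mulr_sumr; apply: ler_sum => k _.
  exact: phi_ge (ad k) (ramp0 s s0).
have N0 s l : 0 <= \sum_(k <- ks) nrm (X k s) (Y k s) l.
  by apply: sumr_ge0 => k _; exact: nrm_ge0.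
have P0 (s : R) l : 0 <= s -> 0 <= P s l.
  by move=> s0; apply: le_trans (Pge s l s0); rewrite mulr_ge0.
pose K k := s2val (cid2 (local_decay (ad k))).
have K0 k : 0 <= K k by exact: (s2valP (cid2 (local_decay (ad k)))).
have hK k := s2valP' (cid2 (local_decay (ad k))).
have SK : 0 <= \sum_(k <- ks) K k by apply: sumr_ge0.
have res := @integrate_flux R tau S B (expR (c / 4 * i3 * tau) * \sum_(k <- ks) K k)
  (fun s l => expR (al s) * P s l)
  (fun s l => expR (al s) * dal s * P s l + expR (al s) * dP s l)
  (fun s l => \sum_(k <- ks) nrm (X k s) (Y k s) l) tau0.
have {res}main : forall N, \sum_(l <- box N) expR (al tau) * P tau l <= B.
  apply: res.
  - by rewrite mulr_ge0// expR_ge0.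
  - move=> l; apply: within_contM.
      apply: (@is_derive_within_cont _ _ (fun s => expR (al s) * dal s)) => s s0.
      have h := @is_derive1_comp R expR al s (expR (al s)) (dal s).
      exact: (h (is_derive_expR _) (alE s s0)).
    by apply: within_continuous_bigsum => k; exact: phi_continuous.
  - move=> s l /andP[s0 st].
    have h := @is_derive1_comp R expR al s (expR (al s)) (dal s).
    have {}h := h (is_derive_expR _) (alE s (ltW s0)).
    have hP : is_derive s (1:R) (P^~ l) (dP s l).
      by apply: is_derive_bigsum => k; apply: phi_derive => //; [exact: ltW|
        move=> j; apply: dX; rewrite s0 st|move=> j; apply: dY; rewrite s0 st].
    exact: (derM h hP).
  - by [].
  - by move=> s N st; exact: hS.
  - move=> s st; have /andP[s0 sT] := st.
    have [x0 x1 dx0 dx1 dx2] := ramp_bounds t00 s0.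
    have eal : expR (al s) <= expR (c / 4 * i3 * tau).
      rewrite ler_expR /al ler_wpM2l//; first by clear -c0 i30; nonneg.
      apply: (@le_trans _ _ (s * 1)); last by rewrite mulr1 ltW.
      by rewrite ler_wpM2l ?(ltW s0)// exprn_ile1// ltW.
    have sd : subdiv (\sum_(k <- ks) K k) (fun l => \sum_(k <- ks) nrm (X k s) (Y k s) l)
      (fun l => \sum_(k <- ks) (ddensity (bsym (a k)) (esc (sg n kap (ramp t0 s)))
         (esc_rate n kap eta r (ramp t0 s) (dramp t0 s))
         (twist_coef n eta r (ramp t0 s)) (well_coef n eta (ramp t0 s))
         (4 * eta * n ^+ 2 * ramp t0 s ^+ 3 * dramp t0 s) (X k s) (Y k s)
         (fieldX (a k) nu (a k * expR (- nu * s)) (X k s) (Y k s))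
         (fieldY (a k) nu (a k * expR (- nu * s)) (X k s) (Y k s)) l
       + i3 * (c * ramp t0 s ^+ 3) * phi (a k) n kap eta r (ramp t0 s) (X k s) (Y k s) l)).
      apply: subdiv_sum => // [k l|k]; first exact: nrm_ge0.
      have a0 : 0 < a k := lt_trans ltr01 (ad_a (ad k)).
      apply: hK => //.
      - by rewrite mulrC ler_pM2l// he.
      - rewrite ler_piMr ?(ltW a0)// -expR0 ler_expR mulNr oppr_le0 mulr_ge0 ?(ltW s0)//.
        by rewrite invr_ge0 exprn_ge0// ltW.
      - move=> l; apply: esc_rate_le => //.
        by clear -kp x0 n0; rewrite /sg; nonneg.
      - by clear -e0 n0 x0 dx0; nonneg.
      - by rewrite [leRHS]mulrC ler_wpM2l//; clear -e0 n0 x0; nonneg.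
    have {}sd := subdivZ (expR_ge0 (al s)) sd.
    apply: (subdiv_cst_le _ _ (N0 s) (fun l => lexx _)); last first.
    + apply: subdiv_le sd.
      * move=> l; rewrite -mulrA -mulrDr ler_wpM2l ?expR_ge0//.
        rewrite big_split/= -/(dP s l) -mulr_sumr -/(P s l) [leLHS]addrC lerD2l ler_wpM2r ?P0 ?(ltW s0)//.
        have -> : i3 * (c * ramp t0 s ^+ 3) = c / 4 * i3 * (ramp t0 s ^+ 3 + 3 * ramp t0 s ^+ 2 * ramp t0 s).
          by field.
        rewrite /dal ler_wpM2l//; first by clear -c0 i30; nonneg.
        rewrite lerD2l.
        have -> : s * (3 * ramp t0 s ^+ 2 * dramp t0 s) = 3 * ramp t0 s ^+ 2 * (s * dramp t0 s) by ring.
        by rewrite ler_wpM2l//; clear -x0; nonneg.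
    + by rewrite mulr_ge0// expR_ge0.
    + exact: ler_wpM2r.
  - by move=> l; rewrite mulr_ge0 ?expR_ge0// P0.
  - by move=> l; rewrite mulr_ge0 ?expR_ge0// P0// ltW.
  - move=> N; have x00 : ramp t0 0 = 0 by rewrite /ramp mul0r.
    apply: le_trans (hB N); apply: ler_sum => l _.
    rewrite /al mul0r mulr0 expR0 mul1r /P x00; apply: ler_sum => k _.
    by rewrite /phi /density /twist_coef /well_coef !expr0n/= !(mulr0, mul0r) subr0 addr0.
move=> N; have := main N; rewrite -mulr_sumr => h.
have h2 : \sum_(l <- box N) \sum_(k <- ks) nrm (X k tau) (Y k tau) l <=
    2 * \sum_(l <- box N) P tau l.
  rewrite mulr_sumr; apply: ler_sum => l _.
  by have := Pge tau l (ltW tau0); lra.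
apply: le_trans h2 _; rewrite -mulrA ler_pM2l// expRN -/(al tau).
by rewrite mulrC ler_pdivlMr ?expR_gt0// mulrC.
Qed.

End Modes.

(** * Square integrable functions on a finite measure space *)

Section L2.
Context d (T : measurableType d) (R : realType).
Variable mu : {finite_measure set T -> \bar R}.
Implicit Types (f g h p : T -> R) (A : set T).

Definition intg f := mu.-integrable setT (EFin \o f).

Definition sqint f := measurable_fun setT f /\ intg (fun z => f z ^+ 2).

Definition bmeas f := measurable_fun setT f /\ exists C, forall z, `|f z| <= C.

Definition ip f g := \int[mu]_z (f z * g z).

Definition dist2 f g := \int[mu]_z (f z - g z) ^+ 2.

Lemma intg_bmeas f : bmeas f -> intg f.
Proof.
move=> [mf [C fC]]; apply: measurable_bounded_integrable => //.
  by rewrite ltey_eq fin_num_measure.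
by exists C; split => [|M CM z _ /=]; [exact: num_real|exact: le_trans (fC z) (ltW CM)].
Qed.

Lemma intgD f g : intg f -> intg g -> intg (fun z => f z + g z).
Proof. by move=> hf hg; apply: eq_integrable (integrableD measurableT hf hg). Qed.

Lemma intgZ c f : intg f -> intg (fun z => c * f z).
Proof. by move=> hf; apply: eq_integrable (integrableZl measurableT c hf). Qed.

Lemma intg_le f g : measurable_fun setT f -> (forall z, `|f z| <= g z) -> intg g -> intg f.
Proof.
move=> mf fg; apply: le_integrable => //; first exact/measurable_EFinP.
by move=> z _ /=; rewrite lee_fin (le_trans (fg z))// ler_norm.
Qed.

Lemma intg_mul f g : sqint f -> sqint g -> intg (fun z => f z * g z).
Proof.
move=> [mf f2] [mg g2]; apply: (@intg_le _ (fun z => f z ^+ 2 + g z ^+ 2)).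
- exact: measurable_funM.
- move=> z; rewrite ler_norml; have := sqr_ge0 (f z - g z); have := sqr_ge0 (f z + g z).
  by have := sqr_ge0 (f z); have := sqr_ge0 (g z) => ? ? ? ?; apply/andP; split; lra.
- exact: intgD.
Qed.

Lemma sqint_bmeas f : bmeas f -> sqint f.
Proof.
move=> [mf [C fC]]; split=> //; apply: intg_bmeas; split.
  exact: measurable_funX.
by exists (C ^+ 2) => z; rewrite normrX ler_pXn2r// nnegrE// (le_trans _ (fC z)).
Qed.

Lemma sqintD f g : sqint f -> sqint g -> sqint (fun z => f z + g z).
Proof.
move=> hf hg; have [mf f2] := hf; have [mg g2] := hg; split.
  exact: measurable_funD.
have := intgD (intgD f2 (intgZ 2 (intg_mul hf hg))) g2.
by apply: eq_integrable => // z _ /=; congr EFin; ring.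
Qed.

Lemma sqintZ c f : sqint f -> sqint (fun z => c * f z).
Proof.
move=> [mf f2]; split; first exact: measurable_funM.
by apply: eq_integrable (intgZ (c ^+ 2) f2) => // z _ /=; congr EFin; ring.
Qed.

Lemma sqintB f g : sqint f -> sqint g -> sqint (fun z => f z - g z).
Proof.
move=> hf hg; have := sqintD hf (sqintZ (- 1) hg).
by congr sqint; apply/funext => z; rewrite mulN1r.
Qed.

Lemma ipD f g h : sqint f -> sqint g -> sqint h -> ip (fun z => f z + g z) h = ip f h + ip g h.
Proof.
move=> hf hg hh; rewrite /ip -RintegralD//; try exact: intg_mul.
by apply: eq_Rintegral => z _; rewrite mulrDl.
Qed.

Lemma ipZ c f h : sqint f -> sqint h -> ip (fun z => c * f z) h = c * ip f h.
Proof.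
move=> hf hh; rewrite /ip -RintegralZl//; last exact: intg_mul.
by apply: eq_Rintegral => z _; rewrite mulrA.
Qed.

Lemma ipC f h : ip f h = ip h f.
Proof. by apply: eq_Rintegral => z _; rewrite mulrC. Qed.

Lemma ip_ge0 f : 0 <= ip f f.
Proof. by apply: Rintegral_ge0 => z _; rewrite -expr2 sqr_ge0. Qed.

Lemma dist2E f g : sqint f -> sqint g -> dist2 f g = ip f f - 2 * ip f g + ip g g.
Proof.
move=> hf hg; rewrite /ip -RintegralZl//; last exact: intg_mul.
rewrite -RintegralB//; [|exact: intg_mul|exact: intgZ (intg_mul _ _)].
rewrite -RintegralD//; last exact: intg_mul.
  by apply: eq_Rintegral => z _; ring.
have := intgD (intg_mul hf hf) (intgZ (- 2) (intg_mul hf hg)).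
by apply: eq_integrable => // z _ /=; congr EFin; ring.
Qed.

Lemma dist2_le f g h : sqint f -> sqint g -> sqint h ->
  dist2 f h <= 2 * dist2 f g + 2 * dist2 g h.
Proof.
move=> hf hg hh.
have i1 : intg (fun z => (f z - g z) ^+ 2) := (sqintB hf hg).2.
have i2 : intg (fun z => (g z - h z) ^+ 2) := (sqintB hg hh).2.
rewrite /dist2 -!RintegralZl// -RintegralD//; try exact: intgZ.
apply: le_Rintegral => //; first exact: (sqintB hf hh).2.
  exact: intgD (intgZ _ i1) (intgZ _ i2).
by move=> z _; have := sqr_ge0 (f z - g z - (g z - h z)); lra.
Qed.

Lemma dominated_dist2 (f : T -> R) (f_ : nat -> T -> R) (G : T -> R) :
  (forall n, measurable_fun setT (f_ n)) -> measurable_fun setT f ->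
  (forall z, f_ n z @[n --> \oo] --> f z) -> intg G ->
  (forall n z, (f z - f_ n z) ^+ 2 <= G z) ->
  forall e, 0 < e -> exists n, dist2 f (f_ n) <= e.
Proof.
move=> mf_ mf cf iG fG e e0.
pose u n z := ((f z - f_ n z) ^+ 2)%:E.
have [] := @dominated_convergence _ T R mu setT measurableT u (cst 0%E) (EFin \o G).
- by move=> n; apply/measurable_EFinP; apply: measurable_funX; exact: measurable_funB.
- exact: measurable_cst.
- apply: aeW => z _; apply: cvg_EFin; first by apply: nearW.
  have -> : (0 : R) = (f z - f z) ^+ 2 by rewrite subrr expr0n.
  by apply: cvgM; apply: cvgB => //; exact: cvg_cst.
- exact: iG.
- by apply: aeW => z n _; rewrite /u /= lee_fin ger0_norm ?sqr_ge0// fG.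
move=> _ _ h.
rewrite integral0 in h.
have iu n : intg (fun z => (f z - f_ n z) ^+ 2).
  apply: (@intg_le _ G) => //; first by apply: measurable_funX; exact: measurable_funB.
  by move=> z; rewrite ger0_norm ?sqr_ge0.
have : \forall n \near \oo, ((\int[mu]_z u n z) < e%:E)%E.
  move/fine_cvgP : h => [_ h].
  have : \forall n \near \oo, fine (\int[mu]_z u n z) < e.
    by apply: cvgr_lt h _ _.
  move=> [N _ hN]; exists N => // n /hN /=.
  rewrite -lte_fin fineK//; exact: integrable_fin_num (iu n).
move=> [N _ hN]; exists N; have := hN N (leqnn N).
rewrite /dist2 /Rintegral => /ltW h2; rewrite -lee_fin fineK//.
exact: integrable_fin_num (iu N).
Qed.

End L2.

(** * Density of an algebra of bounded functions *)

Section Smoothstep.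
Context {R : realType}.

(** Its iterates converge on [0, 1] to the step at 1/2, so that polynomials in a
    function approximate the indicators of its superlevel sets. *)
Definition smoothstep (t : R) := 3 * t ^+ 2 - 2 * t ^+ 3.

Lemma smoothstep_bounds n t : 0 <= t <= 1 -> 0 <= iter n smoothstep t <= 1.
Proof.
move=> t01; elim: n => //= n; move: (iter n _ _) => x /andP[x0 x1].
rewrite /smoothstep; apply/andP; split.
  have -> : 3 * x ^+ 2 - 2 * x ^+ 3 = x ^+ 2 * (3 - 2 * x) by ring.
  by rewrite mulr_ge0 ?sqr_ge0//; lra.
rewrite -subr_ge0; have -> : 1 - (3 * x ^+ 2 - 2 * x ^+ 3) = (1 - x) ^+ 2 * (1 + 2 * x) by ring.
by rewrite mulr_ge0 ?sqr_ge0//; lra.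
Qed.

Lemma smoothstep_sym n t : iter n smoothstep (1 - t) = 1 - iter n smoothstep t.
Proof. by elim: n => //= n ->; rewrite /smoothstep; ring. Qed.

Lemma smoothstep_half n : iter n smoothstep 2^-1 = 2^-1.
Proof. by elim: n => //= n ->; rewrite /smoothstep; field. Qed.

Lemma smoothstep_cvg0 t : 0 <= t < 2^-1 -> iter n smoothstep t @[n --> \oo] --> (0 : R).
Proof.
move=> /andP[t0 t1]; pose rho := t * (3 - 2 * t).
have rho1 : `|rho| < 1.
  rewrite ger0_norm; last by rewrite /rho mulr_ge0//; lra.
  have : 0 < (1 - t) * (1 - 2 * t) by rewrite mulr_gt0//; lra.
  by rewrite /rho; lra.
have rho0 : 0 <= rho by rewrite /rho mulr_ge0//; lra.
have h n : 0 <= iter n smoothstep t <= t /\ iter n smoothstep t <= t * rho ^+ n.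
  elim: n => [|n] /=; first by rewrite t0 lexx expr0 mulr1.
  move: (iter n _ _) => x [/andP[x0 xt] xr].
  have e : smoothstep x = x * (x * (3 - 2 * x)) by rewrite /smoothstep; ring.
  have xx : 0 <= x * (3 - 2 * x) by rewrite mulr_ge0//; lra.
  have xrho : x * (3 - 2 * x) <= rho.
    have : 0 <= (t - x) * (3 - 2 * t - 2 * x) by rewrite mulr_ge0//; lra.
    by rewrite /rho; lra.
  have r1 : rho <= 1 by apply: ltW; move: rho1; rewrite ger0_norm.
  split.
    rewrite e mulr_ge0//=; apply: le_trans xt; rewrite ler_piMr//.
    exact: le_trans xrho r1.
  by rewrite e exprSr [leRHS]mulrA; apply: ler_pM.
apply: (@squeeze_cvgr _ _ _ _ (fun=> 0) (fun n => t * rho ^+ n)).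
- by apply: nearW => n; have [/andP[-> _] ->] := h n.
- exact: cvg_cst.
- rewrite -[0](mulr0 t); apply: cvgM; [exact: cvg_cst|exact: cvg_expr].
Qed.

Lemma smoothstep_cvg t : 0 <= t <= 1 ->
  iter n smoothstep t @[n --> \oo] -->
    (if t < 2^-1 then 0 else if t == 2^-1 then 2^-1 else 1 : R).
Proof.
move=> /andP[t0 t1]; case: ltgtP => [lt|gt|->].
- by apply: smoothstep_cvg0; rewrite t0.
- have e : (fun n => iter n smoothstep t) = (fun n => 1 - iter n smoothstep (1 - t)).
    by apply/funext => n; rewrite smoothstep_sym opprB addrC subrK.
  rewrite e -[X in _ --> X]subr0; apply: cvgB; first exact: cvg_cst.
  by apply: smoothstep_cvg0; lra.
- by under eq_fun do rewrite smoothstep_half; exact: cvg_cst.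
Qed.

End Smoothstep.

Section Density.
Context d (T : measurableType d) (R : realType).
Variable mu : {finite_measure set T -> \bar R}.
Variable S : set (T -> R).
Hypothesis S_bmeas : forall p, S p -> bmeas p.
Hypothesis S1 : S (cst 1).
Hypothesis SD : forall p q, S p -> S q -> S (fun z => p z + q z).
Hypothesis SZ : forall c p, S p -> S (fun z => c * p z).
Hypothesis SM : forall p q, S p -> S q -> S (fun z => p z * q z).
Implicit Types (f g h p q : T -> R) (A : set T).

Definition approximable f := forall e, 0 < e -> exists2 p, S p & dist2 mu f p <= e.

(** Boundedness is what makes approximability stable under products. *)
Definition bapprox f := bmeas f /\ approximable f.

Lemma approx_trans f : sqint mu f ->
  (forall e, 0 < e -> exists g, [/\ sqint mu g, approximable g & dist2 mu f g <= e]) ->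
  approximable f.
Proof.
move=> hf h e e0; have e4 : 0 < e / 4 by lra.
have [g [hg ag fg]] := h _ e4; have [p Sp gp] := ag _ e4.
exists p => //; apply: le_trans (dist2_le hf hg _) _; first exact: sqint_bmeas (S_bmeas Sp).
by lra.
Qed.

Lemma bapprox_S p : S p -> bapprox p.
Proof.
move=> Sp; split; first exact: S_bmeas.
move=> e e0; exists p => //; rewrite /dist2.
under eq_Rintegral do rewrite subrr expr0n/=.
by rewrite Rintegral_cst// mul0r ltW.
Qed.

Lemma bmeasD f g : bmeas f -> bmeas g -> bmeas (fun z => f z + g z).
Proof.
move=> [mf [C hC]] [mg [D hD]]; split; first exact: measurable_funD.
by exists (C + D) => z; rewrite (le_trans (ler_normD _ _))// lerD.
Qed.

Lemma bmeasM f g : bmeas f -> bmeas g -> bmeas (fun z => f z * g z).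
Proof.
move=> [mf [C hC]] [mg [D hD]]; split; first exact: measurable_funM.
by exists (C * D) => z; rewrite normrM ler_pM.
Qed.

Lemma bmeas_cst c : bmeas (cst c : T -> R).
Proof. by split; [exact: measurable_cst|exists `|c|]. Qed.

Lemma share_gt0 (x : R) : 0 < 4 * (x ^+ 2 + 1).
Proof. by have := sqr_ge0 x; lra. Qed.

Lemma share_le (x e : R) : 0 < e -> 2 * x ^+ 2 * (e / (4 * (x ^+ 2 + 1))) <= e / 2.
Proof. by move=> e0; rewrite mulrA ler_pdivrMr ?share_gt0//; lra. Qed.

(** f g - p q = f (g - q) + q (f - p): the polynomial q is chosen first, and p
    according to the bound of q. *)
Lemma bapproxM f g : bapprox f -> bapprox g -> bapprox (fun z => f z * g z).
Proof.
move=> [bf af] [bg ag]; split; first exact: bmeasM.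
move=> e e0; have [_ [C hC]] := bf.
have C2 := share_gt0 C.
have [q Sq gq] := ag _ (divr_gt0 e0 C2).
have [mq [D hD]] := S_bmeas Sq.
have D2 := share_gt0 D.
have [p Sp fp] := af _ (divr_gt0 e0 D2).
exists (fun z => p z * q z); first exact: SM.
have hq := sqint_bmeas mu (S_bmeas Sq); have hp := sqint_bmeas mu (S_bmeas Sp).
have hf := sqint_bmeas mu bf; have hg := sqint_bmeas mu bg.
have i1 := (sqintB hg hq).2; have i2 := (sqintB hf hp).2.
apply: (@le_trans _ _ (2 * C ^+ 2 * dist2 mu g q + 2 * D ^+ 2 * dist2 mu f p)).
  rewrite /dist2 -!RintegralZl// -RintegralD//; try exact: intgZ.
  apply: le_Rintegral => //.
  - exact: (sqintB (sqint_bmeas mu (bmeasM bf bg))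
      (sqint_bmeas mu (bmeasM (S_bmeas Sp) (S_bmeas Sq)))).2.
  - exact: intgD (intgZ _ i1) (intgZ _ i2).
  - move=> z _; apply: (@le_trans _ _ (2 * f z ^+ 2 * (g z - q z) ^+ 2
      + 2 * q z ^+ 2 * (f z - p z) ^+ 2)).
      by have := sqr_ge0 (f z * (g z - q z) - q z * (f z - p z)); lra.
    by apply: lerD; apply: ler_wpM2r; rewrite ?sqr_ge0// ler_pM2l//
      -(real_normK (num_real _)) ler_pXn2r// nnegrE ?(le_trans _ (hC z)) ?(le_trans _ (hD z)).
have h1 : 2 * C ^+ 2 * dist2 mu g q <= 2 * C ^+ 2 * (e / (4 * (C ^+ 2 + 1))).
  by rewrite ler_wpM2l// mulr_ge0 ?sqr_ge0.
have h2 : 2 * D ^+ 2 * dist2 mu f p <= 2 * D ^+ 2 * (e / (4 * (D ^+ 2 + 1))).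
  by rewrite ler_wpM2l// mulr_ge0 ?sqr_ge0.
have := share_le C e0; have := share_le D e0; lra.
Qed.

Lemma bapprox_comb c f c' g : bapprox f -> bapprox g -> bapprox (fun z => c * f z + c' * g z).
Proof.
move=> [bf af] [bg ag].
have bb : bmeas (fun z => c * f z + c' * g z).
  by apply: bmeasD; apply: bmeasM => //; exact: bmeas_cst.
split=> // e e0.
have c1 := share_gt0 c.
have c2 := share_gt0 c'.
have [p Sp fp] := af _ (divr_gt0 e0 c1); have [q Sq gq] := ag _ (divr_gt0 e0 c2).
exists (fun z => c * p z + c' * q z); first by apply: SD; exact: SZ.
have hq := sqint_bmeas mu (S_bmeas Sq); have hp := sqint_bmeas mu (S_bmeas Sp).
have hf := sqint_bmeas mu bf; have hg := sqint_bmeas mu bg.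
have i1 := (sqintB hf hp).2; have i2 := (sqintB hg hq).2.
apply: (@le_trans _ _ (2 * c ^+ 2 * dist2 mu f p + 2 * c' ^+ 2 * dist2 mu g q)).
  rewrite /dist2 -!RintegralZl// -RintegralD//; try exact: intgZ.
  apply: le_Rintegral => //.
  - apply: (sqintB (sqint_bmeas mu bb) _).2.
    by apply: sqintD; exact: sqintZ.
  - exact: intgD (intgZ _ i1) (intgZ _ i2).
  - by move=> z _; have := sqr_ge0 (c * (f z - p z) - c' * (g z - q z)); lra.
have h1 : 2 * c ^+ 2 * dist2 mu f p <= 2 * c ^+ 2 * (e / (4 * (c ^+ 2 + 1))).
  by rewrite ler_wpM2l// mulr_ge0 ?sqr_ge0.
have h2 : 2 * c' ^+ 2 * dist2 mu g q <= 2 * c' ^+ 2 * (e / (4 * (c' ^+ 2 + 1))).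
  by rewrite ler_wpM2l// mulr_ge0 ?sqr_ge0.
have := share_le c e0; have := share_le c' e0; lra.
Qed.

Lemma bapprox_cvg (f_ : nat -> T -> R) f (C : R) :
  (forall n, bapprox (f_ n)) -> (forall n z, `|f_ n z| <= C) ->
  (forall z, f_ n z @[n --> \oo] --> f z) -> bapprox f.
Proof.
move=> hf_ hC cf.
have mf : measurable_fun setT f.
  apply: (@measurable_fun_cvg _ _ _ setT f_) => [n|z _]; last exact: cf.
  by have [[]] := hf_ n.
have fC z : `|f z| <= C.
  have cn : `|f_ n z| @[n --> \oo] --> `|f z| by exact: cvg_norm.
  rewrite -(cvg_lim _ cn)//; apply: limr_le; first by apply/cvg_ex; exists `|f z|.
  by apply: nearW => n.
have bf : bmeas f by split=> //; exists C.
split=> //; apply: approx_trans; first exact: sqint_bmeas.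
move=> e e0.
have hb m z : (f z - f_ m z) ^+ 2 <= cst ((2 * C) ^+ 2) z.
  have d2 : `|f z - f_ m z| <= 2 * C.
    by rewrite (le_trans (ler_normB _ _))//; have := fC z; have := hC m z; lra.
  by rewrite /= -(real_normK (num_real _)) ler_pXn2r// nnegrE (le_trans _ d2).
have [n hn] := dominated_dist2 (fun n => (hf_ n).1.1) mf cf
  (intg_bmeas mu (bmeas_cst _)) hb e0.
by exists (f_ n); split => //; [exact: sqint_bmeas (hf_ n).1|exact: (hf_ n).2].
Qed.

Lemma bapprox_poly3 (c0 c1 c2 c3 : R) f : bapprox f ->
  bapprox (fun z => c0 + c1 * f z + c2 * f z ^+ 2 + c3 * f z ^+ 3).
Proof.
move=> hf; have h1 := bapprox_S S1.
have h2 := bapproxM hf hf; have h3 := bapproxM hf h2.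
have h := bapprox_comb 1 1 (bapprox_comb c0 c1 h1 hf) (bapprox_comb c2 c3 h2 h3).
by move: h; congr bapprox; apply/funext => z /=; ring.
Qed.

(** An affine map sends the level r to 1/2; then [smoothstep] is iterated. The
    limit is 1/2 where f = r, a value which v -> 2 v^2 - v sends to 0, fixing 0 and 1. *)
Lemma bapprox_superlevel f (r : R) : bapprox f ->
  bapprox (\1_[set z | r < f z] : T -> R).
Proof.
move=> hf; have [[_ [C0 hC0]] _] := hf.
pose C := `|C0| + `|r| + 1.
have C1 : 0 < C by rewrite /C; have := normr_ge0 C0; have := normr_ge0 r; lra.
pose g z := (f z - r) / (2 * C) + 2^-1.
have g01 z : 0 <= g z <= 1.
  have : `|f z - r| <= C.
    rewrite (le_trans (ler_normB _ _))// /C; have := hC0 z; have := ler_norm C0; lra.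
  have -> : g z = ((f z - r) + C) / (2 * C) by rewrite /g; field; rewrite gt_eqF.
  have C2 : 0 < 2 * C by lra.
  rewrite ler_norml => /andP[h1 h2]; rewrite ler_pdivrMr// divr_ge0/=; lra.
have hg : bapprox g.
  move: (bapprox_poly3 (2^-1 - r / (2 * C)) (2 * C)^-1 0 0 hf).
  by congr bapprox; apply/funext => z; rewrite /g; ring.
have hs n : bapprox (fun z => iter n smoothstep (g z)).
  elim: n => //= n IH; move: (bapprox_poly3 0 0 3 (-2) IH).
  by congr bapprox; apply/funext => z; rewrite /smoothstep; ring.
pose h z := (if g z < 2^-1 then 0 else if g z == 2^-1 then 2^-1 else 1 : R).
have hh : bapprox h.
  apply: (@bapprox_cvg (fun n z => iter n smoothstep (g z)) _ 1) => // [n z|z].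
    have /andP[h0 h1] := smoothstep_bounds n (g01 z).
    by rewrite ger0_norm.
  exact: smoothstep_cvg.
move: (bapprox_poly3 0 (-1) 2 0 hh); congr bapprox; apply/funext => z.
have C2 : 0 < (2 * C)^-1 by rewrite invr_gt0; lra.
have gE : g z - 2^-1 = (f z - r) / (2 * C) by rewrite /g addrK.
have e1 : (g z < 2^-1) = (f z < r) by rewrite -subr_lt0 gE pmulr_llt0// subr_lt0.
have e2 : (g z == 2^-1) = (f z == r).
  by rewrite -subr_eq0 gE mulf_eq0 subr_eq0 (gt_eqF C2) orbF.
rewrite /h e1 e2 indicE /=; case: ltgtP => [fr|rf|fr].
- by rewrite memNset/=; [ring|move=> /=; apply/negP; rewrite -leNgt ltW].
- by rewrite mem_set//=; ring.
- by rewrite memNset/=; [field|move=> /=; rewrite fr ltxx].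
Qed.

Definition approxset A := bapprox (\1_A : T -> R).

Lemma approxsetT : approxset setT.
Proof. by move: (bapprox_S S1); congr bapprox; apply/funext => z; rewrite indicT. Qed.

Lemma approxsetC A : approxset A -> approxset (~` A).
Proof.
move=> hA; move: (bapprox_comb 1 (-1) (bapprox_S S1) hA); congr bapprox.
by apply/funext => z; rewrite /= !indicE in_setC; case: (z \in A) => /=; ring.
Qed.

Lemma approxsetI A B : approxset A -> approxset B -> approxset (A `&` B).
Proof.
by move=> hA hB; move: (bapproxM hA hB); congr bapprox; apply/funext => z; rewrite indicI.
Qed.

Lemma approxset_bigcup (F : nat -> set T) : (forall n, approxset (F n)) ->
  approxset (\bigcup_n F n).
Proof.
move=> hF; have hfin n : approxset (\bigcup_(i < n) F i).
  elim: n => [|n IH].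
    have -> : \bigcup_(i < 0) F i = ~` setT by rewrite setCT bigcup_mkord big_ord0.
    exact: approxsetC approxsetT.
  have -> : \bigcup_(i < n.+1) F i = ~` (~` (\bigcup_(i < n) F i) `&` ~` F n).
    by rewrite -setCU setCK !bigcup_mkord big_ord_recr.
  by apply: approxsetC; apply: approxsetI; exact: approxsetC.
apply: (@bapprox_cvg (fun n => \1_(\bigcup_(i < n) F i)) _ 1) => // [n z|z].
  by rewrite indicE; case: (_ \in _); rewrite ?normr1 ?normr0.
have [[n _ Fn]|nF] := pselect ((\bigcup_n F n) z).
  apply: cvg_near_cst; exists n.+1 => // m /= nm.
  rewrite !indicE !mem_set//; first by exists n.
  by exists n.
apply: cvg_near_cst; apply: nearW => m; rewrite !indicE !memNset//.
by move=> [i _ Fi]; apply: nF; exists i.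
Qed.

Lemma approxset_ae (D A B : set T) : measurable D -> mu (~` D) = 0%E ->
  measurable B -> A `&` D = B `&` D -> approxset A -> approxset B.
Proof.
move=> mD D0 mB AB [[mA _] aA]; split.
  by split; [exact: measurable_indic|exists 1 => z; rewrite indicE; case: (_ \in _);
     rewrite ?normr1 ?normr0].
move=> e e0; have [p Sp Ap] := aA e e0; exists p => //; apply: le_trans Ap.
rewrite le_eqVlt; apply/orP; left; apply/eqP; rewrite /dist2 /Rintegral; congr fine.
apply: ae_eq_integral => //.
- apply/measurable_EFinP; apply: measurable_funX; apply: measurable_funB.
    exact: measurable_indic.
  by have [] := S_bmeas Sp.
- apply/measurable_EFinP; apply: measurable_funX; apply: measurable_funB => //.
  by have [] := S_bmeas Sp.
- exists (~` D); split => //; first exact: measurableC.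
  move=> z /=; apply: contra_not => /= zD _; congr ((_ - _) ^+ 2)%:E.
  have : (A `&` D) z <-> (B `&` D) z by rewrite AB.
  rewrite !indicE => -[h1 h2]; congr (_%:R); congr nat_of_bool.
  apply/idP/idP => /set_mem h; apply: mem_set.
    by have [] := h2 (conj h zD).
  by have [] := h1 (conj h zD).
Qed.

Hypothesis gen : forall A, measurable A -> approxset A.

Lemma count_below (N : nat) (y : R) : 0 <= y <= N%:R ->
  y <= \sum_(k < N) (k%:R < y)%R%:R <= y + 1.
Proof.
elim: N => [|N IH] /andP[y0 yN]; first by rewrite big_ord0; apply/andP; split; [exact: yN|exact: addr_ge0].
rewrite big_ord_recr/=; case: (ltP N%:R y) => Ny.
  have -> : \sum_(i < N) (i%:R < y)%R%:R = N%:R :> R.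
    rewrite (eq_bigr (fun=> 1)) ?sumr_const ?card_ord// => i _.
    by rewrite (le_lt_trans _ Ny)// ler_nat ltnW.
  move: yN; rewrite -natr1 -[X in _ + X]/(1 : R) => yN.
  by apply/andP; split; lra.
by rewrite -[X in _ + X]/(0 : R) addr0; apply: IH; rewrite y0.
Qed.

(** Averages of N + 1 indicators of superlevel sets approximate f uniformly. *)
Lemma bapprox_unit f : measurable_fun setT f -> (forall z, 0 <= f z <= 1) -> bapprox f.
Proof.
move=> mf f01.
pose f_ N z := N.+1%:R^-1 * \sum_(k < N.+1) \1_[set z | k%:R / N.+1%:R < f z] z : R.
have fE N z : f z <= f_ N z <= f z + N.+1%:R^-1.
  have N0 : 0 < N.+1%:R :> R by rewrite ltr0n.
  have yN : 0 <= N.+1%:R * f z <= N.+1%:R.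
    by have /andP[a b] := f01 z; rewrite mulr_ge0//= ler_piMr.
  have := count_below yN.
  have -> : \sum_(k < N.+1) (k%:R < N.+1%:R * f z)%R%:R =
     \sum_(k < N.+1) \1_[set z | k%:R / N.+1%:R < f z] z :> R.
    apply: eq_bigr => k _; rewrite indicE; congr (_%:R); congr nat_of_bool.
    by rewrite -ltr_pdivrMl// mulrC; apply/idP/idP => [h|/set_mem//]; exact: mem_set.
  rewrite /f_ => /andP[h1 h2]; rewrite ler_pdivlMl// h1/=.
  by rewrite ler_pdivrMl// mulrDr mulfV ?gt_eqF.
have hf_ N : bapprox (f_ N).
  have hs n : bapprox (fun z => \sum_(k < n) \1_[set z | k%:R / N.+1%:R < f z] z : R).
    elim: n => [|n IH].
      move: (bapprox_comb 0 0 (bapprox_S S1) (bapprox_S S1)); congr bapprox.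
      by apply/funext => z; rewrite big_ord0 !mul0r addr0.
    have mS : measurable [set z | n%:R / N.+1%:R < f z].
      have := mf measurableT _ (measurable_itv `]n%:R / N.+1%:R, +oo[).
      rewrite setTI; congr measurable; apply/seteqP; split => z /=.
        by rewrite in_itv/= andbT.
      by rewrite in_itv/= andbT.
    move: (bapprox_comb 1 1 IH (gen mS)); congr bapprox.
    by apply/funext => z; rewrite big_ord_recr/= !mul1r.
  move: (bapprox_comb (N.+1%:R^-1) 0 (hs N.+1) (bapprox_S S1)); congr bapprox.
  by apply/funext => z; rewrite mul0r addr0.
apply: (@bapprox_cvg f_ _ 2) => // [N z|z].
  have /andP[h1 h2] := fE N z; have /andP[h3 h4] := f01 z.
  rewrite (ger0_norm (le_trans h3 h1)); apply: le_trans h2 _.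
  have : (N.+1%:R : R)^-1 <= 1 by rewrite invf_le1 ?ltr0n// ler1n.
  by move=> w1; rewrite (le_trans (lerD h4 w1))//; lra.
apply: (@squeeze_cvgr _ _ _ _ (fun=> f z) (fun N => f z + N.+1%:R^-1)).
- by apply: nearW => N; exact: fE.
- exact: cvg_cst.
- rewrite -[X in _ --> X]addr0; apply: cvgD; first exact: cvg_cst.
  exact: cvg_harmonic.
Qed.

Lemma bapprox_bounded f : bmeas f -> bapprox f.
Proof.
move=> [mf [C0 hC]]; pose C := `|C0| + 1.
have C1 : 0 < C by rewrite /C; have := normr_ge0 C0; lra.
have hg : bapprox (fun z => (f z + C) / (2 * C)).
  apply: bapprox_unit.
    by apply: measurable_funM => //; exact: measurable_funD.
  move=> z; have C2 : 0 < 2 * C by lra.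
  have : `|f z| <= C by rewrite (le_trans (hC z))// /C; have := ler_norm C0; lra.
  rewrite ler_norml => /andP[h1 h2].
  by rewrite ler_pdivrMr// divr_ge0/=; lra.
move: (bapprox_comb (2 * C) (- C) hg (bapprox_S S1)); congr bapprox.
by apply/funext => z; rewrite /=; field; rewrite gt_eqF.
Qed.

(** Truncations of f are bounded and converge to f, dominated by f^2. *)
Theorem algebra_dense f : sqint mu f -> approximable f.
Proof.
move=> hf; have [mf f2] := hf; apply: approx_trans => // e e0.
pose f_ n z := Num.max (- n%:R) (Num.min n%:R (f z)) : R.
have mf_ n : measurable_fun setT (f_ n).
  by apply: measurable_maxr => //; exact: measurable_minr.
have bf_ n : bmeas (f_ n).
  split=> //; exists n%:R => z; rewrite /f_ ler_norml le_max lexx/= ge_max ge_min lexx/= andbT.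
  by rewrite (le_trans (y := 0))// ?oppr_le0.
have dom n z : (f z - f_ n z) ^+ 2 <= f z ^+ 2.
  have n0 : 0 <= n%:R :> R by [].
  rewrite /f_; move: (n%:R : R) (f z) n0 => c y c0.
  have h3 : 0 <= c ^+ 2 := sqr_ge0 c.
  have cy1 : c <= y -> 0 <= c * (y - c) by move=> cy; rewrite mulr_ge0// subr_ge0.
  have cy2 : y < - c -> 0 <= c * (- c - y).
    by move=> cy; rewrite mulr_ge0// subr_ge0 ltW.
  by case: (leP c y) => h1; case: (leP (- c)) => h2;
    first [by rewrite subrr expr0n sqr_ge0|by have := cy1 h1; lra
          |by have := cy2 h2; lra|by exfalso; lra].
have cf z : f_ n z @[n --> \oo] --> f z.
  apply: cvg_near_cst; exists (Num.truncn `|f z|).+1 => // n /= hn.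
  have h : `|f z| <= n%:R.
    by apply: ltW; apply: lt_le_trans (truncnS_gt _) _; rewrite ler_nat.
  move: h; rewrite ler_norml /f_ => /andP[h1 h2].
  by rewrite (min_idPr h2) (max_idPr h1).
have [n hn] := dominated_dist2 mf_ mf cf f2 dom e0.
exists (f_ n); split=> //; first exact: sqint_bmeas.
exact: (bapprox_bounded (bf_ n)).2.
Qed.

End Density.

(** * Orthogonal families *)

Section Orthogonal.
Context d (T : measurableType d) (R : realType).
Variable mu : {finite_measure set T -> \bar R}.
Variables (I : eqType) (e : I -> T -> R) (V : R).
Hypothesis e_bmeas : forall i, bmeas (e i).
Hypothesis V0 : 0 < V.
Hypothesis e_orth : forall i j, ip mu (e i) (e j) = if i == j then V else 0.
Implicit Types (f g h : T -> R) (s : seq I) (L : seq (I * R)).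

Definition comb L : T -> R := fun z => \sum_(x <- L) x.2 * e x.1 z.

Lemma sqint_comb L : sqint mu (comb L).
Proof.
rewrite /comb; elim: L => [|x L IH].
  have := sqintZ 0 (sqint_bmeas mu (bmeas_cst T (0 : R))).
  by congr sqint; apply/funext => z; rewrite big_nil mul0r.
have := sqintD (sqintZ x.2 (sqint_bmeas mu (e_bmeas x.1))) IH.
by congr sqint; apply/funext => z; rewrite big_cons.
Qed.

Lemma ip_comb L h : sqint mu h -> ip mu (comb L) h = \sum_(x <- L) x.2 * ip mu (e x.1) h.
Proof.
move=> hh; elim: L => [|x L IH].
  rewrite big_nil /ip /comb; under eq_Rintegral do rewrite big_nil mul0r.
  by rewrite Rintegral_cst// mul0r.
have hx := sqint_bmeas mu (e_bmeas x.1); have hL := sqint_comb L.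
have -> : comb (x :: L) = (fun z => x.2 * e x.1 z + comb L z).
  by apply/funext => z; rewrite /comb big_cons.
by rewrite big_cons ipD ?ipZ ?IH//; exact: sqintZ.
Qed.

Definition proj s f := comb [seq (i, ip mu f (e i) / V) | i <- s].

Lemma ip_proj s f i : uniq s -> i \in s -> ip mu (proj s f) (e i) = ip mu f (e i).
Proof.
move=> us si; rewrite /proj ip_comb; last exact: sqint_bmeas.
rewrite big_map (bigD1_seq i)//=.
rewrite e_orth eqxx divfK ?gt_eqF// big1 ?addr0// => j ji.
by rewrite e_orth (negPf ji) mulr0.
Qed.

Lemma proj_orth s f : sqint mu f -> uniq s ->
  ip mu (fun z => f z - proj s f z) (fun z => f z - proj s f z) =
  ip mu f f - (\sum_(i <- s) ip mu f (e i) ^+ 2) / V.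
Proof.
move=> hf us; have hp : sqint mu (proj s f) := sqint_comb _.
have -> : ip mu (fun z => f z - proj s f z) (fun z => f z - proj s f z) = dist2 mu f (proj s f).
  by apply: eq_Rintegral => z _; rewrite expr2.
rewrite dist2E//.
have e1 : ip mu f (proj s f) = (\sum_(i <- s) ip mu f (e i) ^+ 2) / V.
  rewrite ipC /proj ip_comb// big_map mulr_suml; apply: eq_bigr => i _ /=.
  by rewrite [ip mu (e i) f]ipC expr2 mulrAC.
have -> : ip mu (proj s f) (proj s f) = ip mu f (proj s f).
  rewrite [RHS]ipC {1 3}/proj !ip_comb// !big_map big_seq [RHS]big_seq.
  by apply: eq_bigr => i si /=; rewrite [ip mu (e i) (proj s f)]ipC ip_proj// ipC.
by rewrite e1; ring.
Qed.

Lemma bessel s f : sqint mu f -> uniq s -> \sum_(i <- s) ip mu f (e i) ^+ 2 <= V * ip mu f f.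
Proof.
move=> hf us; have := proj_orth hf us.
have := ip_ge0 mu (fun z => f z - proj s f z) => h0 h; rewrite h subr_ge0 in h0.
by rewrite mulrC -ler_pdivrMr.
Qed.

(** With L a combination close to f and P the projection of f on the span of the
    functions in L, the distance from f to L splits into those from f to P and from
    P to L; hence f is at least as close to P. *)
Lemma parseval_le f (B : R) : sqint mu f -> approximable mu [set comb L | L in setT] f ->
  (forall s, uniq s -> \sum_(i <- s) ip mu f (e i) ^+ 2 <= B) -> V * ip mu f f <= B.
Proof.
move=> hf af hB; apply/ler_addgt0Pr => eps eps0.
have [_ [L _ <-] fL] := af _ (divr_gt0 eps0 V0).
pose s := undup [seq x.1 | x <- L]; have us : uniq s := undup_uniq _.
pose r z := f z - proj s f z; pose w z := proj s f z - comb L z.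
have hp : sqint mu (proj s f) := sqint_comb _.
have hr : sqint mu r := sqintB hf hp.
have hL := sqint_comb L.
have hw : sqint mu w := sqintB hp hL.
have r0 i : i \in s -> ip mu r (e i) = 0.
  move=> si; have he := sqint_bmeas mu (e_bmeas i).
  have -> : ip mu r (e i) = ip mu (fun z => f z + (-1) * proj s f z) (e i).
    by congr ip; apply/funext => z; rewrite /r mulN1r.
  by rewrite ipD//; [rewrite ipZ// ip_proj// mulN1r subrr|exact: sqintZ].
have rw : ip mu r w = 0.
  rewrite ipC; have -> : ip mu w r = ip mu (fun z => proj s f z + (-1) * comb L z) r.
    by congr ip; apply/funext => z; rewrite /w mulN1r.
  rewrite ipD//; last exact: sqintZ.
  rewrite ipZ// !ip_comb// big_map !big_seq !big1 ?mulr0 ?addr0// => [x xL|i si] /=.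
    by rewrite [ip mu (e _) r]ipC r0 ?mulr0// mem_undup; apply: map_f.
  by rewrite [ip mu (e _) r]ipC r0 ?mulr0.
have e1 : dist2 mu f (comb L) = ip mu r r + ip mu w w.
  have -> : dist2 mu f (comb L) = dist2 mu r (fun z => (-1) * w z).
    by apply: eq_Rintegral => z _; rewrite /r /w; ring.
  have hw' := sqintZ (-1) hw.
  rewrite dist2E// ipC ipZ// ipC rw !mulr0 subr0; congr (_ + _).
  by apply: eq_Rintegral => z _; ring.
have := proj_orth hf us; rewrite -/r => e2.
have h1 : ip mu f f <= (\sum_(i <- s) ip mu f (e i) ^+ 2) / V + eps / V.
  by have := ip_ge0 mu w; rewrite e1 in fL; lra.
have := ler_wpM2l (ltW V0) h1; rewrite mulrDr ![V * (_ / V)]mulrC !divfK ?gt_eqF//.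
by move=> h; apply: le_trans h _; rewrite lerD2r hB.
Qed.

End Orthogonal.

(** * Fourier analysis on the torus *)

Lemma torus_measure_finite (R : realType) (delta : R) : fin_num_fun (torus_measure delta).
Proof. by apply: lty_fin_num_fun; rewrite -ge0_fin_numE// torus_measure_fin. Qed.

HB.instance Definition _ (R : realType) (delta : R) :=
  @Measure_isFinite.Build _ _ _ (torus_measure delta) (@torus_measure_finite R delta).

Section Circle.
Context {R : realType}.
Implicit Types (L w c x : R) (k l : int).

Lemma cos_period k x : cos (x + 2 * pi * k%:~R) = cos x.
Proof.
have e : 2 * pi = pi *+ 2 :> R by rewrite mulr_natl.
case: k => n; rewrite e.
  by rewrite -pmulrn mulr_natr; exact: (periodicn (@cosD2pi R)).
rewrite NegzE mulrNz -pmulrn mulrN mulr_natr.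
by rewrite -[LHS](periodicn (@cosD2pi R) n.+1) subrK.
Qed.

Lemma sin_period k x : sin (x + 2 * pi * k%:~R) = sin x.
Proof. by rewrite -!cosBpihalf addrAC cos_period. Qed.

Lemma circle_measureT L : 0 <= L -> circle_measure L setT = L%:E.
Proof.
move=> L0; rewrite /circle_measure /mrestr setTI lebesgue_measure_itv/= lte_fin.
by move: L0; rewrite le_eqVlt => /orP[/eqP <-|->]; rewrite ?ltxx ?oppr0 ?adde0 ?sube0.
Qed.

Lemma circle_integral L (f F : R -> R) : 0 < L -> continuous f ->
  (forall x, is_derive x (1 : R) F (f x)) ->
  bmeas (f : measurableTypeR R -> R) ->
  (\int[circle_measure L]_x (f x)%:E = (F L - F 0)%:E)%E.
Proof.
move=> L0 cf dF bf.
have mL : measurable (`[0, L[%classic : set (measurableTypeR R)) by exact: measurable_itv.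
have N0 : circle_measure L (~` `[0, L[) = 0%E.
  by rewrite /circle_measure /mrestr setICl measure0.
rewrite (negligible_integral (measurableC mL) measurableT _ N0); last exact: intg_bmeas.
rewrite setDE setCK setTI.
rewrite (eq_measure_integral lebesgue_measure); last first.
  by move=> A mA AL; rewrite /circle_measure /mrestr; congr (lebesgue_measure _); exact/setIidl.
rewrite integral_itv_bndo_bndc; last first.
  by apply/measurable_EFinP; apply: measurable_funTS; exact: continuous_measurable_fun.
rewrite (@continuous_FTC2 _ f F)//.
- exact: continuous_subspaceT.
- split=> [x _||].
  + exact: ex_derive.
  + apply: cvg_at_right_filter; apply: differentiable_continuous; apply/derivable1_diffP.
    exact: ex_derive.
  + apply: cvg_at_left_filter; apply: differentiable_continuous; apply/derivable1_diffP.
    exact: ex_derive.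
- by move=> x _; rewrite derive1E; apply: derive_val.
Qed.

Lemma circle_cos L w c k : 0 < L -> w * L = 2 * pi * k%:~R -> k != 0 ->
  (\int[circle_measure L]_x (cos (w * x + c))%:E = 0)%E.
Proof.
move=> L0 wL k0.
have w0 : w != 0.
  apply: contra_neq k0 => w0; move: wL; rewrite w0 mul0r => /esym/eqP.
  by rewrite mulf_eq0 intr_eq0 gt_eqF//= ?mulr_gt0 ?pi_gt0// => /eqP.
have dF x : is_derive x (1 : R) (fun x => w^-1 * sin (w * x + c)) (cos (w * x + c)).
  apply: is_derive_eq; rewrite /GRing.scale/=; by field.
rewrite (circle_integral L0 _ dF).
- by rewrite wL mulr0 [_ + c]addrC sin_period add0r subrr.
- move=> x; apply: continuous_comp; last exact: continuous_cos.
  by apply: cvgD; [apply: cvgM; [exact: cvg_cst|exact: cvg_id]|exact: cvg_cst].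
- split.
    apply: measurableT_comp; first by apply: continuous_measurable_fun; exact: continuous_cos.
    by apply: measurable_funD => //; apply: measurable_funM.
  by exists 1 => x; rewrite ler_norml cos_geN1 cos_le1.
Qed.

End Circle.

Section Hartley.
Context {R : realType}.
Variable delta : R.
Hypothesis delta0 : 0 < delta.
Implicit Types (c : R) (k l : int) (z : plane R) (i j : int * int).

Let Lx := 2 * pi * delta.
Let Ly : R := 2 * pi.
Definition area : R := 2 * pi * delta * (2 * pi).

Lemma Lx_gt0 : 0 < Lx. Proof. by rewrite /Lx !mulr_gt0// pi_gt0. Qed.
Lemma Ly_gt0 : 0 < Ly. Proof. by rewrite /Ly !mulr_gt0// pi_gt0. Qed.
Lemma area_gt0 : 0 < area. Proof. exact: mulr_gt0 Lx_gt0 Ly_gt0. Qed.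

Lemma freq_xL k : freq_x delta k * Lx = 2 * pi * k%:~R.
Proof. by rewrite /freq_x /Lx; field; rewrite gt_eqF. Qed.

Lemma freq_yL l : freq_y l * Ly = 2 * pi * l%:~R.
Proof. by rewrite /freq_y /Ly mulrC. Qed.

Lemma bmeas_cos_phase k l c : bmeas (fun z => cos (phase delta k l z + c)).
Proof.
split.
  apply: measurableT_comp; first by apply: continuous_measurable_fun; exact: continuous_cos.
  by apply: measurable_funD => //; exact: measurable_phase.
by exists 1 => x; rewrite ler_norml cos_geN1 cos_le1.
Qed.

Lemma bmeas_cos k l : bmeas (fun z => cos (phase delta k l z)).
Proof. by have := bmeas_cos_phase k l 0; congr bmeas; apply/funext => z; rewrite addr0. Qed.

Lemma bmeas_sin k l : bmeas (fun z => sin (phase delta k l z)).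
Proof.
by have := bmeas_cos_phase k l (- (pi / 2)); congr bmeas; apply/funext => z; rewrite cosBpihalf.
Qed.

Lemma torus_measureT : torus_measure delta setT = area%:E.
Proof.
rewrite /torus_measure -setXTT product_measure1E//.
have e1 := circle_measureT (ltW Lx_gt0); have e2 := circle_measureT (ltW Ly_gt0).
by have := congr2 mule e1 e2; apply: etrans.
Qed.

Lemma torus_cos k l c : \int[torus_measure delta]_z cos (phase delta k l z + c) =
  if (k, l) == (0, 0) then area * cos c else 0.
Proof.
have hi := intg_bmeas (torus_measure delta) (bmeas_cos_phase k l c).
case: eqP => [[-> ->]|kl].
  transitivity (\int[torus_measure delta]_z cst (cos c) z).
    apply: eq_Rintegral => z _; congr cos.
    by rewrite /phase /freq_x /freq_y !mul0r !add0r.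
  by rewrite Rintegral_cst// mulrC; congr (_ * _); exact: (congr1 fine torus_measureT).
rewrite /Rintegral; have [k0|k0] := eqVneq k 0.
  have l0 : l != 0 by apply/eqP => l0; apply: kl; rewrite k0 l0.
  rewrite -(integral12_prod_meas1 hi) (eq_integral (cst 0%E)) ?integral0// => x _.
  rewrite /fubini_F -(circle_cos (freq_x delta k * x + c) Ly_gt0 (freq_yL l) l0).
  by apply: eq_integral => y _; congr (cos _)%:E; rewrite /phase/=; ring.
rewrite -(integral21_prod_meas1 hi) (eq_integral (cst 0%E)) ?integral0// => y _.
rewrite /fubini_G -(circle_cos (freq_y l * y + c) Lx_gt0 (freq_xL k) k0).
by apply: eq_integral => x _; congr (cos _)%:E; rewrite /phase/=; ring.
Qed.

(** The Hartley functions: they are real, orthogonal, closed under products up to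
    combinations, and carry the same information as the characters. *)
Definition cas i z : R := cos (phase delta i.1 i.2 z) + sin (phase delta i.1 i.2 z).

Lemma phaseD i j z : phase delta (i + j).1 (i + j).2 z = phase delta i.1 i.2 z + phase delta j.1 j.2 z.
Proof. by rewrite /phase /freq_x /freq_y/= !rmorphD/=; ring. Qed.

Lemma phaseN i z : phase delta (- i).1 (- i).2 z = - phase delta i.1 i.2 z.
Proof. by rewrite /phase /freq_x /freq_y/= !rmorphN/=; ring. Qed.

Lemma bmeas_cas i : bmeas (cas i).
Proof. exact: bmeasD (bmeas_cos _ _) (bmeas_sin _ _). Qed.

Lemma cas_mul i j z :
  cas i z * cas j z = cos (phase delta (i - j).1 (i - j).2 z + 0)
    + cos (phase delta (i + j).1 (i + j).2 z + - (pi / 2)).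
Proof.
by rewrite cosBpihalf addr0 !phaseD phaseN cosD sinD cosN sinN /cas; ring.
Qed.

Lemma cas_orth i j : ip (torus_measure delta) (cas i) (cas j) = if i == j then area else 0.
Proof.
rewrite /ip; under eq_Rintegral do rewrite cas_mul.
rewrite RintegralD//; [|exact: intg_bmeas (bmeas_cos_phase _ _ _)..].
rewrite !torus_cos -!surjective_pairing cos0 mulr1 cosN cos_pihalf mulr0 if_same addr0.
by congr (if _ then _ else _); exact: subr_eq0.
Qed.

Definition trig : set (plane R -> R) := [set comb cas L | L in setT].

Lemma trigD p q : trig p -> trig q -> trig (fun z => p z + q z).
Proof.
move=> [L _ <-] [L' _ <-]; exists (L ++ L') => //.
by apply/funext => z; rewrite /comb big_cat.
Qed.

Lemma trigZ c p : trig p -> trig (fun z => c * p z).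
Proof.
move=> [L _ <-]; exists [seq (x.1, c * x.2) | x <- L] => //.
by apply/funext => z; rewrite /comb big_map mulr_sumr; apply: eq_bigr => x _; rewrite mulrA.
Qed.

Lemma trig_cas i : trig (cas i).
Proof. by exists [:: (i, 1)] => //; apply/funext => z; rewrite /comb big_seq1 mul1r. Qed.

Lemma trig1 : trig (cst 1).
Proof.
have := trig_cas 0; congr trig; apply/funext => z.
by rewrite /cas /phase /freq_x /freq_y !mul0r addr0 cos0 sin0 addr0.
Qed.

Lemma trigM p q : trig p -> trig q -> trig (fun z => p z * q z).
Proof.
have t0 : trig (fun=> 0).
  by have := trigZ 0 trig1; congr trig; apply/funext => z; rewrite mul0r.
have h i L : trig (fun z => cas i z * comb cas L z).
  elim: L => [|x L IH].
    by move: t0; congr trig; apply/funext => z; rewrite /comb big_nil mulr0.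
  have := trigD (trigZ (x.2 / 2) (trigD (trigD (trig_cas (i - x.1)) (trig_cas (- (i - x.1))))
     (trigD (trig_cas (i + x.1)) (trigZ (-1) (trig_cas (- (i + x.1))))))) IH.
  congr trig; apply/funext => z; rewrite [comb cas (x :: L) z]big_cons [in RHS]mulrDr; congr (_ + _).
  rewrite mulrCA cas_mul cosBpihalf /cas !phaseN !cosN !sinN addr0.
  by field.
move=> [L _ <-] tq; elim: L => [|x L IH].
  by move: t0; congr trig; apply/funext => z; rewrite /comb big_nil mul0r.
have tx : trig (fun z => cas x.1 z * q z) by case: tq => L' _ <-; exact: h.
have := trigD (trigZ x.2 tx) IH.
by congr trig; apply/funext => z; rewrite [comb cas (x :: L) z]big_cons [in RHS]mulrDl mulrA.
Qed.

Lemma trig_bmeas p : trig p -> bmeas p.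
Proof.
move=> [L _ <-]; elim: L => [|x L IH].
  by move: (bmeas_cst (plane R) (0 : R)); congr bmeas; apply/funext => z; rewrite /comb big_nil.
move: (bmeasD (bmeasM (bmeas_cst _ x.2) (bmeas_cas x.1)) IH).
by congr bmeas; apply/funext => z; rewrite /comb big_cons.
Qed.

Let aset := @approxset _ _ R (torus_measure delta) trig.

Lemma trig_cos k l c : trig (fun z => cos (phase delta k l z - c)).
Proof.
pose i : int * int := (k, l).
have := trigD (trigZ (cos c / 2) (trigD (trig_cas i) (trig_cas (- i))))
  (trigZ (sin c / 2) (trigD (trig_cas i) (trigZ (-1) (trig_cas (- i))))).
congr trig; apply/funext => z; rewrite /cas !phaseN !cosN !sinN cosB /=; by field.
Qed.

Lemma cos_gt_arc (w a x : R) : 0 < w -> 0 <= a -> w * a < 2 * pi -> 0 <= x -> w * x < 2 * pi ->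
  (cos (w * x - w * a / 2) < cos (w * a / 2)) = (a < x).
Proof.
move=> w0 a0 wa x0 wx.
have e : cos (w * a / 2) - cos (w * x - w * a / 2) = 2 * sin (w * x / 2) * sin (w * (x - a) / 2).
  have -> : w * x - w * a / 2 = w * x / 2 + w * (x - a) / 2 by field.
  have -> : w * a / 2 = w * x / 2 - w * (x - a) / 2 by field.
  by rewrite cosB cosD; ring.
rewrite -subr_gt0 e; case: (ltP a x) => ax.
  have wax : 0 < w * (x - a) by rewrite mulr_gt0// subr_gt0.
  have waa : 0 <= w * a by rewrite mulr_ge0// ltW.
  have wxa : w * (x - a) = w * x - w * a by ring.
  by rewrite !mulr_gt0// sin_gt0_pi//; apply/andP; split; lra.
apply/negbTE; rewrite -leNgt; have wxx : 0 <= w * x by rewrite mulr_ge0// ltW.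
have s1 : 0 <= sin (w * x / 2) by apply: sin_ge0_pi; apply/andP; split; lra.
rewrite mulr_ge0_le0 ?mulr_ge0//.
have -> : w * (x - a) / 2 = - (w * (a - x) / 2) by field.
rewrite sinN oppr_le0; apply: sin_ge0_pi.
have : 0 <= w * (a - x) by rewrite mulr_ge0 ?subr_ge0// ltW.
have -> : w * (a - x) = w * a - w * x by ring.
by move=> ?; apply/andP; split; lra.
Qed.

End Hartley.

Section Generate.
Context {R : realType}.
Variable delta : R.
Hypothesis delta0 : 0 < delta.

Let aset := @approxset _ _ R (torus_measure delta) (trig delta).

Let asetT : aset setT.
Proof. by apply: approxsetT; [exact: trig_bmeas|exact: trig1]. Qed.

Let asetC A : aset A -> aset (~` A).
Proof.
by apply: approxsetC; [exact: trig_bmeas|exact: trig1|exact: trigD|exact: trigZ].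
Qed.

Let aset_bigcup (F : nat -> set (plane R)) : (forall n, aset (F n)) -> aset (\bigcup_n F n).
Proof.
apply: approxset_bigcup; [exact: trig_bmeas|exact: trig1|exact: trigD|exact: trigZ|exact: trigM].
Qed.

(** In a fundamental domain, the half-plane {a < x} is the arc on which a
    translate of the cosine is below a given level. *)
Lemma approxset_ray (p : plane R -> R) (L w a : R) k l : 0 < L -> 0 < w -> w * L = 2 * pi ->
  measurable_fun setT p -> (forall z, phase delta k l z = w * p z) ->
  torus_measure delta (~` (p @^-1` `[0, L[)) = 0%E ->
  aset (p @^-1` `]a, +oo[).
Proof.
move=> L0 w0 wL mp hp N0.
have mB : measurable (p @^-1` `]a, +oo[) by rewrite -[X in measurable X]setTI; exact: mp.
have mD : measurable (p @^-1` `[0, L[) by rewrite -[X in measurable X]setTI; exact: mp.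
have key A : A `&` p @^-1` `[0, L[ = p @^-1` `]a, +oo[ `&` p @^-1` `[0, L[ -> aset A ->
    aset (p @^-1` `]a, +oo[).
  by move=> h; apply: (approxset_ae _ mD N0 mB h); exact: trig_bmeas.
have [a0|a0] := ltP a 0.
  apply: key asetT; apply/seteqP; split=> z [_ /=]; rewrite !in_itv/= ?andbT => h; split=> //.
  by case/andP: h => h1 _; exact: lt_le_trans a0 h1.
have [aL|aL] := leP L a.
  apply: key (asetC asetT); rewrite setCT set0I; apply/seteqP; split=> z //= [].
  by rewrite !in_itv/= andbT => h1 /andP[h2 h3]; have := lt_trans h1 (lt_le_trans h3 aL); rewrite ltxx.
have hf : bapprox (torus_measure delta) (trig delta) (fun z => (-1) * cos (phase delta k l z - w * a / 2)).
  by apply: bapprox_S; [exact: trig_bmeas|apply: trigZ; exact: trig_cos].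
have := @bapprox_superlevel _ _ R (torus_measure delta) (trig delta) (@trig_bmeas R delta)
   (@trig1 R delta) (@trigD R delta) (@trigZ R delta) (@trigM R delta) _ (- cos (w * a / 2)) hf.
apply: key; apply/seteqP; split=> z /= []; rewrite !in_itv/= andbT hp mulN1r ltrN2 => h1 /andP[h2 h3].
  split; last by rewrite h2.
  by rewrite -(@cos_gt_arc _ w) -?wL// ltr_pM2l.
split; last by rewrite h2.
by rewrite (@cos_gt_arc _ w) -?wL// ltr_pM2l.
Qed.

Let aset_proj (p : plane R -> R) : (forall a, aset (p @^-1` `]a, +oo[)) ->
  forall A : set (measurableTypeR R), measurable A -> aset (p @^-1` A).
Proof.
move=> h A mA; have : (@ocitv R).-sigma.-measurable A by exact: mA.
rewrite RGenOInfty.measurableE => mA'; apply: (mA' [set A | aset (p @^-1` A)]).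
split; last by move=> _ [x ->]; exact: h.
split=> /=.
- by rewrite preimage_set0 -setCT; exact: asetC.
- by move=> B hB; rewrite setTD preimage_setC; exact: asetC.
- by move=> F hF; rewrite preimage_bigcup; exact: aset_bigcup.
Qed.

Lemma approxset_measurable A : measurable A -> aset A.
Proof.
have Lx := Lx_gt0 delta0; have Ly := @Ly_gt0 R.
have m0 (L : R) : circle_measure L (~` `[0, L[) = 0%E.
  by rewrite /circle_measure /mrestr setICl measure0.
have hx B : measurable B -> aset (fst @^-1` B).
  apply: aset_proj => a; apply: (@approxset_ray fst _ (freq_x delta 1) a 1 0 Lx).
  - by rewrite /freq_x divr_gt0.
  - by rewrite freq_xL// mulr1.
  - exact: measurable_fst.
  - by move=> z; rewrite /phase /freq_y mul0r addr0.
  - rewrite preimage_setC -setXT; rewrite /torus_measure product_measure1E//.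
      by apply/eqP; rewrite mule_eq0; apply/orP; left; apply/eqP; exact: m0.
    by apply: measurableC; exact: measurable_itv.
have hy B : measurable B -> aset (snd @^-1` B).
  apply: aset_proj => a; apply: (@approxset_ray snd _ 1 a 0 1 Ly).
  - by [].
  - by rewrite mul1r.
  - exact: measurable_snd.
  - by move=> z; rewrite /phase /freq_x /freq_y mul0r mul0r add0r.
  - rewrite preimage_setC -setTX; rewrite /torus_measure product_measure1E//.
      by apply/eqP; rewrite mule_eq0; apply/orP; right; apply/eqP; exact: m0.
    by apply: measurableC; exact: measurable_itv.
move=> mA; apply: (mA aset); split.
  split.
  - by rewrite -setCT; exact: asetC.
  - by move=> B hB; rewrite setTD; exact: asetC.
  - exact: aset_bigcup.
by move=> _ [] [B mB <-]; rewrite setTI; [exact: hx|exact: hy].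
Qed.

Lemma trig_dense f : sqint (torus_measure delta) f -> approximable (torus_measure delta) (trig delta) f.
Proof.
move=> hf; apply: (algebra_dense _ _ _ _ _ hf).
- exact: trig_bmeas.
- exact: trig1.
- exact: trigD.
- exact: trigZ.
- exact: approxset_measurable.
Qed.
End Generate.

(** * Fourier coefficients and the mean in x *)

Section Coefficients.
Context {R : realType}.
Variable delta : R.
Hypothesis delta0 : 0 < delta.
Implicit Types (f g : plane R -> R) (k l : int) (z : plane R).

Let mu := torus_measure delta.
Let V : R := area delta.
Let V0 : 0 < V := area_gt0 delta0.

Definition coefRe f k l : R := complex.Re (fourier delta f k l).
Definition coefIm f k l : R := complex.Im (fourier delta f k l).

Definition intensity f k l := coefRe f k l ^+ 2 + coefIm f k l ^+ 2.

Lemma sqint_L2 f : torus_L2 delta f -> sqint mu f.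
Proof.
move=> [_ _ fL]; split; last exact: Lfun2_integrable_sqr.
by move: fL; rewrite inE => /andP[mf _]; move: mf; rewrite inE.
Qed.

Lemma L2norm_sqint f : sqint mu f -> L2norm delta f = (Num.sqrt (ip mu f f))%:E.
Proof.
move=> hf; rewrite /L2norm unlock.
have -> : (\int[mu]_x `|(EFin \o f) x| `^ 2 = (ip mu f f)%:E)%E.
  rewrite /ip /Rintegral fineK; last exact: integrable_fin_num (intg_mul hf hf).
  apply: eq_integral => z _ /=.
  by rewrite powR_mulrn// real_normK ?num_real// expr2.
by rewrite poweR_EFin powR12_sqrt// ip_ge0.
Qed.

Let cs k l z : R := cos (phase delta k l z).
Let sn k l z : R := sin (phase delta k l z).

Lemma coefReE f k l : coefRe f k l = V^-1 * ip mu f (cs k l).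
Proof. by rewrite /coefRe /fourier/= mul0r subr0. Qed.

Lemma coefImE f k l : coefIm f k l = - (V^-1 * ip mu f (sn k l)).
Proof. by rewrite /coefIm /fourier/= mul0r addr0 mulrN. Qed.

Lemma ip_cas f k l : sqint mu f -> ip mu f (cas delta (k, l)) = V * (coefRe f k l - coefIm f k l).
Proof.
move=> hf; rewrite coefReE coefImE opprK -mulrDr mulrA mulfV ?gt_eqF// mul1r.
have hc := sqint_bmeas mu (bmeas_cos delta k l); have hs := sqint_bmeas mu (bmeas_sin delta k l).
by rewrite ipC ![ip mu f _]ipC -ipD.
Qed.

Lemma coefReN f k l : coefRe f (- k) (- l) = coefRe f k l.
Proof.
rewrite !coefReE; congr (_ * _); apply: eq_Rintegral => z _.
by rewrite /cs (phaseN delta (k, l)) cosN.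
Qed.

Lemma coefImN f k l : sqint mu f -> coefIm f (- k) (- l) = - coefIm f k l.
Proof.
move=> hf; rewrite !coefImE; congr (- _); rewrite -mulrN; congr (_ * _).
have hs := sqint_bmeas mu (bmeas_sin delta k l).
rewrite [ip mu f (sn k l)]ipC -mulN1r -ipZ// ipC; apply: eq_Rintegral => z _.
by rewrite /sn (phaseN delta (k, l)) sinN mulN1r.
Qed.

Lemma sum_box_sym (F : int -> R) N : \sum_(l <- box N) F (- l) = \sum_(l <- box N) F l.
Proof.
rewrite -(big_map -%R xpredT F); apply: perm_big; apply: uniq_perm.
- by rewrite map_inj_uniq ?uniq_box//; exact: oppr_inj.
- exact: uniq_box.
- move=> l; apply/mapP/idP => [[m hm ->]|hl]; first by move: hm; rewrite !mem_box; lia.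
  by exists (- l); rewrite ?opprK//; move: hl; rewrite !mem_box; lia.
Qed.

(** The cross products of real and imaginary parts are odd under
    (k, l) -> (- k, - l), and cancel over a symmetric box. *)
Lemma sum_cas f M N : sqint mu f ->
  \sum_(i <- [seq (k, l) | k <- box M, l <- box N]) ip mu f (cas delta i) ^+ 2 =
  V ^+ 2 * \sum_(k <- box M) \sum_(l <- box N) intensity f k l.
Proof.
move=> hf; rewrite big_allpairs_dep/= mulr_sumr.
have e0 : \sum_(k <- box M) \sum_(l <- box N) coefRe f k l * coefIm f k l = 0.
  have : \sum_(k <- box M) \sum_(l <- box N) coefRe f k l * coefIm f k l
     = - \sum_(k <- box M) \sum_(l <- box N) coefRe f k l * coefIm f k l.
    rewrite -[LHS]sum_box_sym -sumrN; apply: eq_bigr => k _.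
    rewrite -[LHS]sum_box_sym -sumrN; apply: eq_bigr => l _.
    by rewrite coefReN coefImN// mulrN.
  by move=> h; lra.
transitivity (\sum_(k <- box M) \sum_(l <- box N)
   (V ^+ 2 * intensity f k l - V ^+ 2 * 2 * (coefRe f k l * coefIm f k l))).
  apply: eq_bigr => k _; apply: eq_bigr => l _; rewrite ip_cas// /intensity; ring.
under eq_bigr do rewrite sumrB -!mulr_sumr.
by rewrite sumrB -!mulr_sumr e0 mulr0 subr0 mulr_sumr.
Qed.

Lemma bessel_fourier f M N : sqint mu f ->
  V * \sum_(k <- box M) \sum_(l <- box N) intensity f k l <= ip mu f f.
Proof.
move=> hf; have us : uniq [seq (k, l) | k <- box M, l <- box N].
  by apply: allpairs_uniq; rewrite ?uniq_box// => -[? ?] [? ?] _ _ [-> ->].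
have := bessel (bmeas_cas delta) V0 (cas_orth delta0) hf us.
by rewrite sum_cas// expr2 -mulrA ler_pM2l.
Qed.

Lemma parseval_fourier f (S : R) : sqint mu f ->
  (forall M N, \sum_(k <- box M) \sum_(l <- box N) intensity f k l <= S) -> ip mu f f <= V * S.
Proof.
move=> hf hS; rewrite -(ler_pM2l V0).
apply: (parseval_le (bmeas_cas delta) V0 (cas_orth delta0) hf); first exact: trig_dense.
move=> s us; pose M := \max_(i <- s) (maxn `|i.1| `|i.2|)%N.
apply: (@le_trans _ _ (\sum_(i <- [seq (k, l) | k <- box M, l <- box M]) ip mu f (cas delta i) ^+ 2)).
  apply: ler_sum_uniq => //.
  - by apply: allpairs_uniq; rewrite ?uniq_box// => -[? ?] [? ?] _ _ [-> ->].
  - move=> [k l] kl; apply/allpairsP; exists (k, l); split=> //=; rewrite mem_box.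
      by apply: leq_trans (leq_maxl _ `|l|%N) _; rewrite /M (big_rem _ kl)/= leq_maxl.
    by apply: leq_trans (leq_maxr `|k|%N _) _; rewrite /M (big_rem _ kl)/= leq_maxl.
  - by move=> i; exact: sqr_ge0.
by rewrite sum_cas// expr2 -mulrA !ler_pM2l.
Qed.

End Coefficients.

Section NonzeroModes.
Context {R : realType}.
Variable delta : R.
Hypothesis delta0 : 0 < delta.
Variable f : plane R -> R.

Let mu := torus_measure delta.
Let L := 2 * pi * delta.
Let L0 : 0 < L := Lx_gt0 delta0.
Let mx := circle_measure L.
Hypothesis hf : sqint mu f.

Let fi : intg mu f.
Proof.
have := intg_mul hf (sqint_bmeas mu (bmeas_cst _ 1)).
by congr intg; apply/funext => z; rewrite mulr1.
Qed.

Let m (y : measurableTypeR R) : R := L^-1 * \int[mx]_x f (x, y).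

Let mm : measurable_fun setT (fun z : plane R => m z.2).
Proof.
apply: (@measurableT_comp _ _ _ _ _ _ m) => //.
apply: measurable_funM => //.
have := measurable_fubini_G fi; apply: measurableT_comp.
exact: fine_measurable.
Qed.

Let mfy y : measurable_fun setT (fun x : measurableTypeR R => f (x, y)).
Proof.
by apply: measurableT_comp; [exact: hf.1|exact: measurable_pair2].
Qed.

Let mxT : mx setT = L%:E. Proof. exact: circle_measureT (ltW L0). Qed.

Let integral_mx_cst (c : R) : (\int[mx]_x c%:E = c%:E * L%:E)%E.
Proof. by rewrite (integral_cst _ measurableT c%:E); congr (_ * _)%E; exact: mxT. Qed.

Let jensen y : ((m y ^+ 2)%:E * L%:E <= \int[mx]_x (f (x, y) ^+ 2)%:E)%E.
Proof.
have [Ioo|] := ltP (\int[mx]_x (f (x, y) ^+ 2)%:E)%E +oo%E; last first.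
  by rewrite leye_eq => /eqP ->; rewrite leey.
have hfy : sqint mx (fun x => f (x, y)).
  split; first exact: mfy.
  apply/integrableP; split.
    by apply/measurable_EFinP; apply: measurable_funX; exact: mfy.
  by under eq_integral do rewrite gee0_abs ?lee_fin ?sqr_ge0//.
have h1 : sqint mx (cst 1 : measurableTypeR R -> R) by exact: sqint_bmeas (bmeas_cst _ _).
have hm : sqint mx (cst (m y) : measurableTypeR R -> R) by exact: sqint_bmeas (bmeas_cst _ _).
have e1 : ip mx (fun x => f (x, y)) (cst (m y)) = m y ^+ 2 * L.
  have -> : ip mx (fun x => f (x, y)) (cst (m y)) = ip mx (fun x => m y * cst 1 x) (fun x => f (x, y)).
    by apply: eq_Rintegral => x _ /=; rewrite mulr1 mulrC.
  rewrite ipZ// expr2 -mulrA; congr (_ * _).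
  rewrite /m mulrAC mulVf ?gt_eqF// mul1r.
  by apply: eq_Rintegral => x _; rewrite mul1r.
have e2 : ip mx (cst (m y)) (cst (m y)) = m y ^+ 2 * L.
  transitivity (\int[mx]_x cst (m y ^+ 2) x); first by apply: eq_Rintegral => x _; rewrite expr2.
  by rewrite Rintegral_cst//; congr (_ * _); exact: (congr1 fine mxT).
have h := dist2E hfy hm; rewrite e1 e2 in h.
have : 0 <= dist2 mx (fun x => f (x, y)) (cst (m y)).
  by apply: Rintegral_ge0 => x _; exact: sqr_ge0.
rewrite h => h0.
have -> : (\int[mx]_x (f (x, y) ^+ 2)%:E)%E = (ip mx (fun x => f (x, y)) (fun x => f (x, y)))%:E.
  rewrite /ip /Rintegral fineK; first by apply: eq_integral => x _; rewrite expr2.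
  exact: integrable_fin_num (intg_mul hfy hfy).
by rewrite -EFinM lee_fin; lra.
Qed.

Let hm : sqint mu (fun z => m z.2).
Proof.
split=> //; apply/integrableP; split.
  by apply/measurable_EFinP; apply: measurable_funX.
under eq_integral do rewrite gee0_abs ?lee_fin ?sqr_ge0//.
rewrite fubini_tonelli2; last 2 first.
- by apply/measurable_EFinP; apply: measurable_funX.
- by move=> z; rewrite lee_fin sqr_ge0.
have /integrableP[_] := hf.2.
under eq_integral do rewrite gee0_abs ?lee_fin ?sqr_ge0//.
rewrite fubini_tonelli2; last 2 first.
- by apply/measurable_EFinP; apply: measurable_funX; exact: hf.1.
- by move=> z; rewrite lee_fin sqr_ge0.
apply: le_lt_trans; apply: ge0_le_integral => //.
- by move=> y _; apply: integral_ge0 => x _; rewrite lee_fin sqr_ge0.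
- apply: measurable_fun_fubini_tonelli_G; last by move=> z; rewrite lee_fin sqr_ge0.
  by apply/measurable_EFinP; apply: measurable_funX.
- apply: measurable_fun_fubini_tonelli_G; last by move=> z; rewrite lee_fin sqr_ge0.
  by apply/measurable_EFinP; apply: measurable_funX; exact: hf.1.
- move=> y _; apply: le_trans (jensen y).
  rewrite le_eqVlt; apply/orP; left; apply/eqP. by rewrite -integral_mx_cst.
Qed.

Let g := nonzero_modes delta f.

Lemma sqint_nonzero : sqint mu g.
Proof. exact: sqintB. Qed.

(** The mean in x is orthogonal to the modes with k <> 0; against a mode with
    k = 0, which is constant in x, it has the same integral as f. *)
Lemma ip_nonzero k l c : ip mu g (fun z => cos (phase delta k l z + c)) =
  if k == 0 then 0 else ip mu f (fun z => cos (phase delta k l z + c)).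
Proof.
set h := fun z => _.
have bh : bmeas h := bmeas_cos_phase delta k l c.
have hh : sqint mu h := sqint_bmeas mu bh.
have -> : ip mu g h = ip mu f h - ip mu (fun z => m z.2) h.
  rewrite -mulN1r -ipZ// -ipD//; last exact: sqintZ.
  by apply: eq_Rintegral => z _; rewrite mulN1r.
suff -> : ip mu (fun z => m z.2) h = if k == 0 then ip mu f h else 0.
  by case: ifP => _; rewrite ?subrr ?subr0.
have i1 := intg_mul hm hh; have i2 := intg_mul hf hh.
have hE x y : k = 0 -> h (x, y) = cos (freq_y l * y + c).
  by move=> k0; rewrite /h /phase k0 /freq_x mul0r mul0r add0r.
case: eqVneq => [k0|k0]; rewrite /ip /Rintegral; last first.
  rewrite -(integral21_prod_meas1 i1) (eq_integral (cst 0%E)) ?integral0// => y _.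
  rewrite /fubini_G.
  transitivity ((m y)%:E * (\int[mx]_x (cos (freq_x delta k * x + (freq_y l * y + c)))%:E))%E.
    rewrite -integralZl//; last first.
      apply: intg_bmeas; split.
        apply: measurableT_comp; first by apply: continuous_measurable_fun; exact: continuous_cos.
        by apply: measurable_funD => //; exact: measurable_funM.
      by exists 1 => x; rewrite ler_norml cos_geN1 cos_le1.
    by apply: eq_integral => x _; rewrite -EFinM /h /phase/= addrA.
  by rewrite (circle_cos _ L0 (freq_xL delta0 k) k0) mule0.
congr fine; rewrite -(integral21_prod_meas1 i1) -(integral21_prod_meas1 i2).
apply: ae_eq_integral => //.
- by move=> mT; apply: (measurable_fubini_G i1).
- by move=> mT; apply: (measurable_fubini_G i2).
move: (ae_integrable2 fi); apply: filterS => y iy _; rewrite /fubini_G/=.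
under eq_integral do rewrite (hE _ _ k0).
under [RHS]eq_integral do rewrite (hE _ _ k0).
rewrite integral_mx_cst.
transitivity ((cos (freq_y l * y + c))%:E * \int[mx]_x (f (x, y))%:E)%E; last first.
  by rewrite -integralZl//; apply: eq_integral => x _; rewrite -EFinM mulrC.
rewrite -(@fineK _ (\int[mx]_x (f (x, y))%:E)%E); last exact: integrable_fin_num iy.
rewrite -!EFinM /m /Rintegral; congr EFin; field; by rewrite gt_eqF.
Qed.

Lemma intensity_nonzero k l : intensity delta g k l =
  if k == 0 then 0 else intensity delta f k l.
Proof.
have ec (u : plane R -> R) :
    ip mu u (fun z => cos (phase delta k l z)) =
    ip mu u (fun z => cos (phase delta k l z + 0)).
  by congr ip; apply/funext => z; rewrite addr0.
have es (u : plane R -> R) :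
    ip mu u (fun z => sin (phase delta k l z)) =
    ip mu u (fun z => cos (phase delta k l z + - (pi / 2))).
  by congr ip; apply/funext => z; rewrite cosBpihalf.
rewrite /intensity !coefReE !coefImE !ec !es !ip_nonzero.
by case: ifP => // _; rewrite mulr0 oppr0 expr0n addr0.
Qed.

End NonzeroModes.

(** * Solutions *)

Lemma cauchy_schwarz d (T : measurableType d) (R : realType)
    (mu : {finite_measure set T -> \bar R}) (f g : T -> R) : sqint mu f -> sqint mu g ->
  ip mu f g ^+ 2 <= ip mu f f * ip mu g g.
Proof.
move=> hf hg.
have h (r : R) : 0 <= ip mu f f - 2 * r * ip mu f g + r ^+ 2 * ip mu g g.
  have hr := sqintZ r hg.
  have e1 : ip mu f (fun z => r * g z) = r * ip mu f g by rewrite ipC ipZ// ipC.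
  have e2 : ip mu (fun z => r * g z) (fun z => r * g z) = r ^+ 2 * ip mu g g.
    by rewrite ipZ// ipC ipZ//; ring.
  have e := dist2E hf hr; rewrite e1 e2 in e.
  have : 0 <= dist2 mu f (fun z => r * g z) by apply: Rintegral_ge0 => z _; exact: sqr_ge0.
  by rewrite e; congr (0 <= _); ring.
have g0 := ip_ge0 mu g; move: g0; rewrite le_eqVlt => /orP[/eqP g0|g0].
  have [c0|c0] := eqVneq (ip mu f g) 0; first by rewrite c0 expr0n/= mulr_ge0 ?ip_ge0.
  have := h ((ip mu f f + 1) / (2 * ip mu f g)); rewrite -g0 mulr0 addr0.
  have -> : 2 * ((ip mu f f + 1) / (2 * ip mu f g)) * ip mu f g = ip mu f f + 1 by field.
  by lra.
have := h (ip mu f g / ip mu g g); rewrite -(pmulr_lge0 _ g0).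
by rewrite -subr_ge0; congr (0 <= _); field; rewrite gt_eqF.
Qed.

Section Solution.
Context {R : realType}.
Variables (delta nu : R) (theta_in : plane R -> R) (theta : R -> plane R -> R).
Hypothesis delta0 : 0 < delta.
Hypothesis sol : is_solution delta nu theta_in theta.

Let mu := torus_measure delta.
Let hth (t : R) : 0 <= t -> sqint mu (theta t).
Proof. by case: sol => h _ _ _ /h; exact: sqint_L2. Qed.

Let diff (t s : R) : plane R -> R := theta s \- theta t.

Lemma diff_cvg (t : R) : 0 <= t ->
  Num.sqrt (ip mu (diff t s) (diff t s)) @[s --> within [set s | 0 <= s] (nbhs t)] --> (0 : R).
Proof.
move=> t0; case: sol => _ /(_ t t0) h _ _.
have h2 : fine (L2norm delta (theta s \- theta t)) @[s --> within [set s | 0 <= s] (nbhs t)] --> (0 : R).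
  exact: fine_cvg h.
apply: cvg_trans h2; apply: near_eq_cvg.
near=> s; have s0 : 0 <= s by near: s; rewrite near_withinE; exact: nearW.
by rewrite /= L2norm_sqint//; exact: (sqintB (hth s0) (hth t0)).
Unshelve. all: by end_near. Qed.

Lemma ip_cvg (t : R) (h : plane R -> R) : 0 <= t -> sqint mu h ->
  ip mu (theta s) h @[s --> within [set s | 0 <= s] (nbhs t)] --> ip mu (theta t) h.
Proof.
move=> t0 hh; apply/subr_cvg0.
apply: norm_cvg0.
apply: (@squeeze_cvgr _ _ _ _ (fun=> 0)
  (fun s => Num.sqrt (ip mu (diff t s) (diff t s)) * Num.sqrt (ip mu h h))).
- near=> s; have s0 : 0 <= s by near: s; rewrite near_withinE; exact: nearW.
  rewrite normr_ge0/= -sqrtrM ?ip_ge0// -sqrtr_sqr ler_wsqrtr//.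
  have -> : ip mu (theta s) h - ip mu (theta t) h = ip mu (diff t s) h.
    have -> : ip mu (diff t s) h = ip mu (fun z => theta s z + (-1) * theta t z) h.
      by congr ip; apply/funext => z; rewrite mulN1r.
    by rewrite ipD ?ipZ ?mulN1r//; try exact: hth; exact: sqintZ (hth _).
  by apply: cauchy_schwarz => //; exact: (sqintB (hth s0) (hth t0)).
- exact: cvg_cst.
- rewrite -[X in _ --> X](mul0r (Num.sqrt (ip mu h h))).
  by apply: cvgM; [exact: diff_cvg|exact: cvg_cst].
Unshelve. all: by end_near. Qed.

Lemma energy_cvg (t : R) : 0 <= t ->
  ip mu (theta s) (theta s) @[s --> within [set s | 0 <= s] (nbhs t)] --> ip mu (theta t) (theta t).
Proof.
move=> t0.
have h : (2 * ip mu (theta s) (theta t) - ip mu (theta t) (theta t)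
   + Num.sqrt (ip mu (diff t s) (diff t s)) ^+ 2) @[s --> within [set s | 0 <= s] (nbhs t)]
   --> 2 * ip mu (theta t) (theta t) - ip mu (theta t) (theta t) + 0 ^+ 2.
  apply: cvgD; last by apply: cvgM; exact: diff_cvg.
  apply: cvgB; last exact: cvg_cst.
  by apply: cvgM; [exact: cvg_cst|exact: ip_cvg (hth t0)].
have e : 2 * ip mu (theta t) (theta t) - ip mu (theta t) (theta t) + 0 ^+ 2 = ip mu (theta t) (theta t).
  by rewrite expr0n/=; ring.
rewrite e in h; apply: cvg_trans h; apply: near_eq_cvg.
near=> s; have s0 : 0 <= s by near: s; rewrite near_withinE; exact: nearW.
rewrite sqr_sqrtr ?ip_ge0//.
have -> : ip mu (diff t s) (diff t s) = dist2 mu (theta s) (theta t).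
  by apply: eq_Rintegral => z _; rewrite expr2.
by rewrite dist2E//; try exact: hth; ring.
Unshelve. all: by end_near. Qed.

Lemma within_segment (f : R -> R) tau :
  (forall t : R, 0 <= t -> f s @[s --> within [set s | 0 <= s] (nbhs t)] --> f t) ->
  {within `[0, tau], continuous f}.
Proof.
move=> h; apply/subspace_continuousP => t; rewrite /= in_itv/= => /andP[t0 _].
apply: cvg_trans (h t t0); apply: cvg_app.
by apply: within_subset => s; rewrite /= in_itv/= => /andP[].
Qed.

Lemma energy_bounded tau : 0 <= tau -> exists E, forall s, 0 <= s <= tau ->
  ip mu (theta s) (theta s) <= E.
Proof.
move=> tau0; have [c _ hc] := EVT_max tau0 (within_segment (tau := tau) energy_cvg).
by exists (ip mu (theta c) (theta c)) => s hs; apply: hc; rewrite in_itv.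
Qed.

Lemma coef_within tau k l :
  {within `[0, tau], continuous (fun s => coefRe delta (theta s) k l)} /\
  {within `[0, tau], continuous (fun s => coefIm delta (theta s) k l)}.
Proof.
have hc := sqint_bmeas mu (bmeas_cos delta k l).
have hs := sqint_bmeas mu (bmeas_sin delta k l).
split; apply: within_segment => t t0.
  under eq_fun do rewrite coefReE; rewrite coefReE.
  by apply: cvgM; [exact: cvg_cst|exact: ip_cvg].
under eq_fun do rewrite coefImE; rewrite coefImE.
by apply: cvgN; apply: cvgM; [exact: cvg_cst|exact: ip_cvg].
Qed.

End Solution.

Section Modes.
Context {R : realType}.
Implicit Types (delta nu a sg t e : R) (k l : int) (u : @fourier_series R).

Lemma laplacian_lam delta a sg k l u : 0 < a -> freq_x delta k = sg * a -> sg ^+ 2 = 1 ->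
  laplacian_pow delta (1 / 2) u k l = (lam a l)%:C%C * u k l /\
  laplacian_pow delta (- (1 / 2)) u k l = (lam a l)^-1%:C%C * u k l.
Proof.
move=> a0 fa sg1; have e : freq_x delta k ^+ 2 + freq_y l ^+ 2 = a ^+ 2 + l%:~R ^+ 2.
  by rewrite fa exprMn sg1 mul1r.
have p0 : 0 <= a ^+ 2 + l%:~R ^+ 2 by rewrite addr_ge0 ?sqr_ge0.
by rewrite /laplacian_pow e powRN div1r powR12_sqrt.
Qed.

(** [sg] is the sign of the wave number, and a its absolute value. *)
Lemma rhs_components delta a sg nu e k l u : 0 < a -> freq_x delta k = sg * a -> sg ^+ 2 = 1 ->
  let w := - (nu%:C * laplacian_pow delta (1 / 2) u k l + e%:C * transport delta u k l)%C in
  let re l := complex.Re (u k l) in let im l := complex.Im (u k l) in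
  complex.Re w = e * (sg * a) * avg (fun l => bsym a l * im l) l - nu * (lam a l * re l) /\
  complex.Im w = - (e * (sg * a) * avg (fun l => bsym a l * re l) l) - nu * (lam a l * im l).
Proof.
move=> a0 fa sg1 w re im; rewrite /w /transport /mul_cos_y /partial_x.
rewrite (laplacian_lam l u a0 fa sg1).1 !(laplacian_lam _ u a0 fa sg1).2 fa.
have -> : (2^-1 : R[i]%C) = (2^-1)%:C%C by rewrite fmorphV rmorph_nat.
rewrite /avg /bsym /re /im.
case: (u k l) => x y; case: (u k (l - 1)) => x1 y1; case: (u k (l + 1)) => x2 y2 /=.
split; ring.
Qed.

End Modes.

Lemma admissible_exists (R : rcfType) (ib : R) : 1 <= ib ->
  exists kap eta r M Q c : R, 0 < c /\
    forall a n, 1 < a -> (forall l, (bsym a l)^-1 <= ib) -> 1 <= n ->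
      admissible a ib n kap eta r M Q c.
Proof.
move=> ib1; have ib0 : 0 < ib by lra.
pose Q := 17 + 6 * ib; pose M := 48 * Q.
pose r := 1536 * M + 128 * Q + 18 * (6 + M) * ib.
have Q1 : 1 <= Q by rewrite /Q; lra.
have M1 : 48 <= M by rewrite /M; lra.
have w0 : 0 <= 18 * (6 + M) * ib by rewrite !mulr_ge0//; lra.
have r1 : 1536 <= r by rewrite /r; lra.
pose kap := (2 * (6 + M))^-1.
have kap0 : 0 < kap by rewrite invr_gt0; lra.
have kap1 : kap <= 1 by rewrite invf_le1; lra.
have r0 : 0 < r by lra.
pose eta := kap ^+ 2 / (50 * r ^+ 2).
have r2 : 0 < 50 * r ^+ 2 by rewrite mulr_gt0// exprn_gt0.
have eta0 : 0 < eta by rewrite divr_gt0// exprn_gt0.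
exists kap, eta, r, M, Q, (eta / ib); split; first exact: divr_gt0.
move=> a n a1 hib n1; split=> //.
- by rewrite /kap invfM mulrA mulfV// mul1r mulVf// gt_eqF//; lra.
- by rewrite divr_ge0// ltW.
- by rewrite divfK// gt_eqF.
- by rewrite /r; lra.
- by rewrite /r; lra.
- rewrite ler_pdivlMr// /r; lra.
- by rewrite /eta mulrC divfK// gt_eqF.
- have -> : r * eta = kap ^+ 2 * (50 * r)^-1 by rewrite /eta; field; rewrite gt_eqF.
  have k2 : kap ^+ 2 <= 1 by rewrite expr_le1// ltW.
  apply: le_trans (_ : 1 * (50 * r)^-1 <= _).
    by rewrite ler_wpM2r// invr_ge0; lra.
  by rewrite mul1r lef_pV2 ?posrE//; lra.
Qed.

Section EnergyDecay.
Context {R : realType}.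
Variables (delta n : R) (theta_in : plane R -> R) (theta : R -> plane R -> R).
Hypothesis delta0 : 0 < delta.
Hypothesis delta1 : delta < 1.
Hypothesis sol : is_solution delta (n ^- 5) theta_in theta.
Implicit Types (k l : int).

Let ib : R := (1 - delta)^-1.
(** At k = 0 any value above 1 would do: [signum] will annihilate that mode. *)
Definition wavenum k : R := (maxn 1 `|k|)%:R / delta.
Definition signum k : R := (sgz k)%:~R.
(** The unknown q = b u, conjugated for k < 0 so that all modes obey the equation
    of a positive wave number, and set to 0 for k = 0. *)
Let X k t l := signum k ^+ 2 * (bsym (wavenum k) l * coefRe delta (theta t) k l).
Let Y k t l := signum k * (bsym (wavenum k) l * coefIm delta (theta t) k l).

Lemma wavenum_ge k : delta^-1 <= wavenum k.
Proof. by rewrite ler_pdivlMr// mulVf ?gt_eqF// ler1n leq_max. Qed.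

Lemma wavenum_gt1 k : 1 < wavenum k.
Proof. by apply: lt_le_trans (wavenum_ge k); rewrite invf_gt1. Qed.

Lemma bsym_wavenum k l : (bsym (wavenum k) l)^-1 <= ib.
Proof.
rewrite lef_pV2 ?posrE ?bsym_gt0 ?wavenum_gt1 ?subr_gt0//.
have a0 : 0 < wavenum k := lt_trans ltr01 (wavenum_gt1 k).
have h := lam_gea l (ltW a0).
rewrite /bsym lerD2l lerN2 -[leRHS]invrK lef_pV2 ?posrE ?invr_gt0//.
  exact: le_trans (wavenum_ge k) h.
exact: lt_le_trans a0 h.
Qed.

Lemma signum_sqr k : k != 0 -> signum k ^+ 2 = 1.
Proof. by rewrite /signum; case: sgzP => //= _ _; rewrite ?sqrrN expr1n. Qed.

Lemma signum_freq k : k != 0 -> freq_x delta k = signum k * wavenum k.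
Proof.
move=> k0; rewrite /freq_x /wavenum /signum mulrA; congr (_ / _).
have -> : maxn 1 `|k| = `|k|%N by apply/maxn_idPr; rewrite absz_gt0.
by rewrite [in LHS](intEsg k) intrM.
Qed.

Lemma modes_derive k (s : R) l : 0 < s ->
  is_derive s (1 : R) (X k ^~ l)
    (fieldX (wavenum k) (n ^- 5) (wavenum k * expR (- n ^- 5 * s)) (X k s) (Y k s) l) /\
  is_derive s (1 : R) (Y k ^~ l)
    (fieldY (wavenum k) (n ^- 5) (wavenum k * expR (- n ^- 5 * s)) (X k s) (Y k s) l).
Proof.
move=> s0; rewrite /X /Y /fieldX /fieldY /trX /trY /avg.
have [->|k0] := eqVneq k 0.
  have s0' : signum 0 = 0 by rewrite /signum sgz0.
  rewrite s0'; split; under eq_fun do rewrite ?expr0n/= mul0r.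
    by apply: is_derive_eq (der_cst 0 s) _; ring.
  by apply: is_derive_eq (der_cst 0 s) _; ring.
have sg1 := signum_sqr k0; have a0 := lt_trans ltr01 (wavenum_gt1 k).
have [_ _ _ /(_ s s0 k l)[d1 d2]] := sol.
have [e1 e2] := rhs_components (n ^- 5) (expR (- n ^- 5 * s)) l
  (fourier delta (theta s)) a0 (signum_freq k0) sg1.
rewrite e1 in d1; rewrite e2 in d2.
split.
  have := derM (der_cst (signum k ^+ 2 * bsym (wavenum k) l) s) d1.
  have -> : (fun s => signum k ^+ 2 * bsym (wavenum k) l * complex.Re (fourier delta (theta s) k l))
    = (fun s => signum k ^+ 2 * (bsym (wavenum k) l * coefRe delta (theta s) k l)).
    by apply/funext => s'; rewrite mulrA.
  move=> h; apply: is_derive_eq h _; rewrite sg1 /avg /coefIm /coefRe; ring.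
have := derM (der_cst (signum k * bsym (wavenum k) l) s) d2.
have -> : (fun s => signum k * bsym (wavenum k) l * complex.Im (fourier delta (theta s) k l))
  = (fun s => signum k * (bsym (wavenum k) l * coefIm delta (theta s) k l)).
  by apply/funext => s'; rewrite mulrA.
move=> h; apply: is_derive_eq h _; rewrite sg1 /avg /coefIm /coefRe; ring: sg1.
Qed.

Lemma nrm_XY k t l : nrm (X k t) (Y k t) l =
  signum k ^+ 2 * (bsym (wavenum k) l ^+ 2 * intensity delta (theta t) k l).
Proof.
rewrite /nrm /X /Y /intensity; have [->|k0] := eqVneq k 0.
  by rewrite /signum sgz0; ring.
by rewrite [(signum k * _) ^+ 2]exprMn !signum_sqr//; ring.
Qed.

Lemma intensity_ge0 f k l : 0 <= intensity delta f k l.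
Proof. by rewrite addr_ge0 ?sqr_ge0. Qed.

Lemma signum_sqr_le1 k : 0 <= signum k ^+ 2 <= 1.
Proof.
rewrite sqr_ge0/=; have [->|k0] := eqVneq k 0; first by rewrite /signum sgz0 expr0n.
by rewrite signum_sqr.
Qed.

Lemma nrm_XY_le k t l : (bsym (wavenum k) l)^-1 * nrm (X k t) (Y k t) l <= intensity delta (theta t) k l.
Proof.
have b0 := bsym_gt0 l (wavenum_gt1 k); have b1 := bsym_le1 (wavenum k) l.
have i0 := intensity_ge0 (theta t) k l; have /andP[s0 s1] := signum_sqr_le1 k.
rewrite nrm_XY; move: (signum k ^+ 2) (bsym _ _) (intensity _ _ _ _) b0 b1 i0 s0 s1 => s b i b0 b1 i0 s0 s1.
have -> : b^-1 * (s * (b ^+ 2 * i)) = (s * b) * i by field; rewrite gt_eqF.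
by apply: ler_piMl => //; apply: mulr_ile1 => //; exact: ltW.
Qed.

Lemma nonzero_le k t l : 0 <= t ->
  intensity delta (nonzero_modes delta (theta t)) k l <= ib ^+ 2 * nrm (X k t) (Y k t) l.
Proof.
move=> t0; have hth : sqint (torus_measure delta) (theta t).
  by case: sol => /(_ t t0) /sqint_L2.
rewrite intensity_nonzero// nrm_XY; have [->|k0] := eqVneq k 0.
  by rewrite /signum sgz0 expr0n/= mul0r mulr0.
rewrite signum_sqr// mul1r mulrA -exprMn ler_peMl ?intensity_ge0// expr_ge1//; last first.
  apply: mulr_ge0; first by rewrite /ib invr_ge0 subr_ge0 ltW.
  by apply/ltW/bsym_gt0/wavenum_gt1.
by rewrite -ler_pdivrMr ?bsym_gt0 ?wavenum_gt1// div1r bsym_wavenum.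
Qed.

Theorem energy_decay kap eta r M Q c tau : 1 <= n ->
  (forall k, admissible (wavenum k) ib n kap eta r M Q c) -> 0 < tau ->
  tau * n ^- 5 <= 2^-1 ->
  ip (torus_measure delta) (nonzero_modes delta (theta tau)) (nonzero_modes delta (theta tau)) <=
  2 * ib ^+ 2 * expR (- (c / 4 / n ^+ 3 * (tau * ramp (n ^+ 3) tau ^+ 3))) *
  ip (torus_measure delta) (theta 0) (theta 0).
Proof.
move=> n1 adm tau0 taun; set mu := torus_measure delta.
have V0 : 0 < area delta := area_gt0 delta0.
have hth (t : R) : 0 <= t -> sqint mu (theta t) by case: sol => h _ _ _ /h /sqint_L2.
have [E hE] := energy_bounded sol (ltW tau0).
have bes (t : R) : 0 <= t -> forall m N,
    \sum_(l <- box N) \sum_(k <- box m) intensity delta (theta t) k l <=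
    ip mu (theta t) (theta t) / area delta.
  move=> t0 m N; rewrite exchange_big ler_pdivlMr// mulrC; exact: bessel_fourier (hth t t0).
set e := expR _.
have -> : 2 * ib ^+ 2 * e * ip mu (theta 0) (theta 0) =
    area delta * (ib ^+ 2 * (2 * e * (ip mu (theta 0) (theta 0) / area delta))).
  by field; rewrite gt_eqF.
apply: parseval_fourier => //; first exact: sqint_nonzero (hth _ (ltW tau0)).
move=> m N; rewrite exchange_big/=.
apply: (@le_trans _ _ (ib ^+ 2 * \sum_(l <- box N) \sum_(k <- box m) nrm (X k tau) (Y k tau) l)).
  rewrite mulr_sumr; apply: ler_sum => l _; rewrite mulr_sumr; apply: ler_sum => k _.
  exact: nonzero_le (ltW tau0).
rewrite ler_wpM2l ?sqr_ge0//.
have md := @modes_decay R int (box m) wavenum ib n kap eta r M Q c X Y tau (E / area delta)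
  (ip mu (theta 0) (theta 0) / area delta) adm tau0.
apply: md.
- move=> s /andP[s0 s1]; apply: le_trans (expR_ge1Dx _).
  have : s * n ^- 5 <= tau * n ^- 5 by rewrite ler_wpM2r ?invr_ge0 ?exprn_ge0 ?(ltW s1)//; lra.
  by rewrite mulNr [n ^- 5 * s]mulrC; lra.
- by move=> k s l /andP[s0 _]; exact: (modes_derive k l s0).1.
- by move=> k s l /andP[s0 _]; exact: (modes_derive k l s0).2.
- move=> k l; exact: within_contM (@within_cont_cst R _ _)
    (within_contM (@within_cont_cst R _ _) (coef_within sol tau k l).1).
- move=> k l; exact: within_contM (@within_cont_cst R _ _)
    (within_contM (@within_cont_cst R _ _) (coef_within sol tau k l).2).
- move=> s N' /andP[s0 s1]; have s01 : 0 <= s <= tau by rewrite !ltW.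
  apply: (@le_trans _ _ (ip mu (theta s) (theta s) / area delta)); last first.
    by rewrite ler_pM2r ?invr_gt0// hE.
  apply: le_trans (bes s (ltW s0) m N'); apply: ler_sum => l _; apply: ler_sum => k _.
  apply: le_trans (nrm_XY_le k s l); rewrite ler_peMl//.
    by rewrite addr_ge0 ?sqr_ge0.
  by rewrite invf_ge1 ?bsym_gt0 ?wavenum_gt1// bsym_le1.
- move=> N'; apply: le_trans (bes 0 (lexx _) m N'); apply: ler_sum => l _; apply: ler_sum => k _.
  exact: nrm_XY_le.
Qed.

End EnergyDecay.

(** * Proof of the estimate *)

(** The slow start of the weights costs a delay of at most 3 T. *)
Lemma ramp_lower (R : realType) (T t : R) : 0 < T -> 0 < t -> t - 3 * T <= t * ramp T t ^+ 3.
Proof.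
move=> T0 t0; have s0 : 0 < T + t by lra.
pose x := T / (T + t); have e : ramp T t = 1 - x by rewrite /ramp /x; field; rewrite gt_eqF.
have x0 : 0 <= x by rewrite divr_ge0// ltW.
have x1 : x <= 1 by rewrite ler_pdivrMr//; lra.
have tx : t * x <= T by rewrite mulrA ler_pdivrMr//; have := sqr_ge0 T; rewrite mulrDr; lra.
have h : 1 - 3 * x <= (1 - x) ^+ 3.
  rewrite -subr_ge0; have -> : (1 - x) ^+ 3 - (1 - 3 * x) = x ^+ 2 * (3 - x) by ring.
  by rewrite mulr_ge0 ?sqr_ge0//; lra.
rewrite e; apply: le_trans (ler_wpM2l (ltW t0) h).
by rewrite mulrBr mulr1; lra.
Qed.

Lemma fifth_root (R : realType) (nu : R) : 0 < nu -> nu < 1 ->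
  exists n : R, [/\ 1 <= n, nu = n ^- 5 & nu `^ (3 / 5) = n ^- 3].
Proof.
move=> nu0 nu1; exists (nu `^ (- (1 / 5))).
have e (m : nat) : nu `^ (- (1 / 5)) ^- m = nu `^ (m%:R / 5).
  by rewrite -powR_mulrn ?powR_ge0// -powRrM -powRN; congr (_ `^ _); field.
split; last by rewrite e.
- by rewrite -[leLHS](powRr0 nu); apply: ger_powR; [rewrite nu0 ltW|lra].
- by rewrite e divff// powRr1// ltW.
Qed.

Lemma ip_ae d (T : measurableType d) (R : realType) (mu : {finite_measure set T -> \bar R})
  (f g : T -> R) : sqint mu f -> sqint mu g -> ae_eq mu setT f g -> ip mu f f = ip mu g g.
Proof.
move=> [mf _] [mg _] fg; rewrite /ip /Rintegral; congr fine; apply: ae_eq_integral => //.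
- by apply/measurable_EFinP; exact: measurable_funM.
- by apply/measurable_EFinP; exact: measurable_funM.
- by move: fg; apply: filterS => z h zT; rewrite h.
Qed.

Lemma nonzero_contraction (R : realType) (delta : R) (f : plane R -> R) : 0 < delta ->
  sqint (torus_measure delta) f ->
  ip (torus_measure delta) (nonzero_modes delta f) (nonzero_modes delta f) <=
  ip (torus_measure delta) f f.
Proof.
move=> delta0 hf; have V0 := area_gt0 delta0.
have -> : ip (torus_measure delta) f f = area delta * (ip (torus_measure delta) f f / area delta).
  by field; rewrite gt_eqF.
apply: parseval_fourier => //; first exact: sqint_nonzero.
move=> M N; rewrite ler_pdivlMr// mulrC; apply: le_trans (bessel_fourier delta0 M N hf).
rewrite ler_pM2l//; apply: ler_sum => k _; apply: ler_sum => l _.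
by rewrite intensity_nonzero//; case: ifP => // _; exact: intensity_ge0.
Qed.

Theorem theorem1p1 (R : realType) (delta : R) :
  0 < delta -> delta < 1 ->
  exists nu0 c C : R,
    [/\ 0 < nu0, nu0 <= 1, 0 < c & 1 < C] /\
    forall nu : R, 0 < nu -> nu < nu0 ->
    forall theta_in : plane R -> R, torus_L2 delta theta_in ->
    forall theta : R -> plane R -> R, is_solution delta nu theta_in theta ->
    forall t : R, 0 <= t -> t <= C^-1 * nu^-1 ->
      (L2norm delta (nonzero_modes delta (theta t)) <=
        (C * expR (- c * (nu `^ (3 / 5)) * t))%:E * L2norm delta theta_in)%E.
Proof.
move=> delta0 delta1; pose ib := (1 - delta)^-1.
have ib1 : 1 <= ib by rewrite invf_ge1; lra.
have [kap [eta [r [M [Q [c [c0 adm]]]]]]] := admissible_exists ib1.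
have ec1 : 1 <= expR c by rewrite -expR0 ler_expR ltW.
pose C := 2 * ib * expR c.
have C2 : 2 <= C.
  by rewrite /C -mulrA ler_peMr// -[1]mulr1; apply: ler_pM.
(* C >= 2 keeps exp (- nu t) above 1/2; the factor ib accounts for passing from
   u to q = b u and back, and expR c for the delay of [ramp_lower]. *)
exists 1, (c / 8), C; split; first by split=> //; [exact: divr_gt0|lra].
move=> nu nu0 nu1 theta_in hin theta sol t t0 tC.
have [n [n1 en en3]] := fifth_root nu0 nu1.
have hth (s : R) : 0 <= s -> sqint (torus_measure delta) (theta s).
  by case: sol => h _ _ _ /h; exact: sqint_L2.
have h0 := hth 0 (lexx _); have hi := sqint_L2 hin.
have e0 : ip (torus_measure delta) theta_in theta_in = ip (torus_measure delta) (theta 0) (theta 0).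
  by apply/esym/ip_ae => //; case: sol.
rewrite !L2norm_sqint//; last exact: sqint_nonzero (hth t t0).
rewrite e0 -EFinM lee_fin; set K := C * _.
have K0 : 0 <= K by rewrite mulr_ge0 ?expR_ge0//; lra.
rewrite -[K]ger0_norm// -sqrtr_sqr -sqrtrM ?sqr_ge0// ler_wsqrtr//.
have ip0 := ip_ge0 (torus_measure delta) (theta 0).
move: t0; rewrite le_eqVlt => /orP[/eqP t0|t0].
  apply: (@le_trans _ _ (ip (torus_measure delta) (theta 0) (theta 0))).
    by rewrite -t0; exact: nonzero_contraction.
  by rewrite ler_peMl// expr_ge1// /K -t0 mulr0 expR0 mulr1; lra.
have sol' := sol; rewrite en in sol'.
have admk k := adm _ _ (wavenum_gt1 delta0 delta1 k) (bsym_wavenum delta0 delta1 k) n1.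
have tn : t * n ^- 5 <= 2^-1.
  rewrite -en -ler_pdivlMr//; apply: le_trans tC _.
  by rewrite ler_pM2r ?invr_gt0// lef_pV2 ?posrE//; lra.
apply: le_trans (energy_decay delta0 delta1 sol' n1 admk t0 tn) _.
apply: ler_wpM2r => //.
rewrite /K /C; set e := expR _; set e2 := expR (- _ * _ * _).
have -> : (2 * ib * expR c * e2) ^+ 2 = 2 * ib ^+ 2 * (2 * (expR c * e2) ^+ 2) by ring.
apply: ler_wpM2l; first by rewrite mulr_ge0// sqr_ge0.
apply: (@le_trans _ _ ((expR c * e2) ^+ 2)); last by rewrite ler_peMl ?sqr_ge0//; lra.
rewrite -expRD expr2 -expRD ler_expR en3.
have n3 : 0 < n ^+ 3 by rewrite exprn_gt0//; lra.
have w0 : 0 <= c / 4 / n ^+ 3 by rewrite !divr_ge0// ltW.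
have := ler_wpM2l w0 (ramp_lower n3 t0).
have -> : c / 4 / n ^+ 3 * (t - 3 * n ^+ 3) = c / 4 * (t / n ^+ 3) - 3 / 4 * c.
  by field; rewrite gt_eqF//; lra.
have -> : - (c / 8) / n ^+ 3 * t = - (c / 8) * (t / n ^+ 3) by ring.
by lra.
Qed.
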